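(* Let $G$ and $H$ be locally compact groups and let $A=A_\pi$ be a closed translation-invariant subalgebra of $B(G)$ for which $\Delta(A)$ is a $*$-semigroup consisting of norm-one elements. Let $Y\in\Omega(H)$ and let $\alpha: Y\to\Delta(A)$ be a continuous pw$^2$-affine map. Then $j_\alpha: A\to B(H)$, given by $j_\alpha(u)(h)=\langle\alpha(h),u\rangle$ for $h\in Y$ and $j_\alpha(u)(h)=0$ for $h\in H\setminus Y$, is a completely bounded homomorphism.
   Context: $B(G)$ is the Fourier–Stieltjes algebra. For a continuous unitary representation $\{\pi,\mathcal H_\pi\}$ of $G$, $A_\pi$ is the closed linear span in $B(G)$ of the functions $\xi*_\pi\eta(s)=\langle\pi(s)\xi|\eta\rangle$, and $VN_\pi$ is the von Neumann algebra generated by $\pi(G)$, identified with $A_\pi^*$ via $\langle T,\xi*_\pi\eta\rangle=\langle T\xi|\eta\rangle$. Closed translation-invariant subspaces of $B(G)$ are exactly the $A_\pi$'s; $A_\pi$ has the operator space structure of the predual of $VN_\pi$, and $B(H)$ that of the predual of $W^*(H)$. $\Delta(A)\subseteq A^*=VN_\pi$ is the Gelfand spectrum with the weak$^*$-topology; ''$\Delta(A)$ is a $*$-semigroup'' means that it is closed under the product and involution of $VN_\pi$. For a projection $p\in\Delta(A)$, $D_p:=\{x\in\Delta(A):x^*x=xx^*=p\}$, a topological group with identity $p$ and inversion $x\mapsto x^*$. $\Omega(H)$ is the ring of sets generated by the open cosets of $H$; $\Omega_0(H)$ is the collection of sets $E_0\setminus\bigcup_{k=1}^mE_k$ where $E_0\subseteq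 H$ is an open coset and $E_1,\dots,E_m$ ($m\ge0$) are open subcosets of infinite index in $E_0$. A map $\alpha$ from a coset $E$ into a group $F$ is affine if $\alpha(xy^{-1}z)=\alpha(x)\alpha(y)^{-1}\alpha(z)$ for $x,y,z\in E$. A map $\alpha:Y\to F$ ($Y\subseteq H$) is piecewise affine if there are finitely many pairwise disjoint $Y_1,\dots,Y_n\in\Omega_0(H)$ with $Y=\bigcup Y_i$ such that each $\alpha|_{Y_i}$ has an affine extension mapping $\mathrm{Aff}(Y_i)$, the smallest coset containing $Y_i$, into $F$. A map $\alpha:Y\to\Delta(A)$ is pw$^2$-affine if there are projections $p_1,\dots,p_n\in\Delta(A)$ and piecewise affine maps $\alpha_i:Y_i\to D_{p_i}$ such that $Y$ is the disjoint union of $Y_1,\dots,Y_n$ and $\alpha|_{Y_i}=\alpha_i$ for each $i$. *)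

(* Defs.v *)
From HB Require Import structures.
From mathcomp Require Export all_boot all_order all_algebra.
From mathcomp Require Export complex.
From mathcomp Require Export all_classical all_reals all_analysis.

Set Implicit Arguments.
Unset Strict Implicit.
Unset Printing Implicit Defensive.

Export Order.TTheory GRing.Theory Num.Theory.
Export numFieldNormedType.Exports.

Global Open Scope classical_set_scope.
Global Open Scope ring_scope.
Global Open Scope complex_scope.

HB.mixin Record isLocallyCompactGroup G of Group G & Topological G := {
  lcg_mul_continuous : continuous (fun xy : G * G => (xy.1 * xy.2)%g) ;
  lcg_inv_continuous : continuous (fun x : G => (x^-1)%g) ;
  lcg_hausdorff : hausdorff_space G ;
  lcg_locally_compact : locally_compact [set: G]
}.

#[short(type="lcGroupType")]
HB.structure Definition LocallyCompactGroup :=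
  {G of isLocallyCompactGroup G & Group G & Topological G}.

(* The inner product is linear in its first argument. *)
Record hilbertType (R : realType) := Hilbert {
  hilbert_sort :> completeNormedModType R[i] ;
  hilbert_dot : {dot hilbert_sort for (@Num.conj R[i])} ;
  hilbert_dot_norm : forall x : hilbert_sort, hilbert_dot x x = `|x| ^+ 2
}.

Definition dot (R : realType) (K : hilbertType R) (x y : K) : R[i] :=
  hilbert_dot K x y.

(* The values of the library norm of a complex normed space lie in R[i]. *)
Definition rnorm (R : realType) (V : normedZmodType R[i]) (x : V) : R :=
  complex.Re `|x|.

Record unirep (R : realType) (G : lcGroupType) (K : hilbertType R) := Unirep {
  rep :> G -> {linear K -> K} ;
  rep1 : rep 1%g = idfun :> (K -> K) ;
  repM : forall s t, rep (s * t)%g = rep s \o rep t :> (K -> K) ;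
  rep_unitary : forall s x y, dot (rep s x) (rep s y) = dot x y ;
  rep_continuous : forall x, continuous (fun s => rep s x)
}.

Definition cyclic_rep (R : realType) (G : lcGroupType) (K : hilbertType R)
    (rho : unirep G K) : Prop :=
  exists xi : K, closure [set x | exists n (c : 'I_n -> R[i]) (s : 'I_n -> G),
    x = \sum_(i < n) c i *: rho (s i) xi] = [set: K].

(* Every cyclic representation is unitarily equivalent to a subrepresentation
   of omega.  The von Neumann algebra generated by any such omega is W^*(G),
   up to an isomorphism carrying omega(s) to the canonical image of s. *)
Definition universal_rep (R : realType) (G : lcGroupType) (L : hilbertType R)
    (omega : unirep G L) : Prop :=
  forall (K : hilbertType R) (rho : unirep G K), cyclic_rep rho ->
    exists W : {linear K -> L},
      (forall x y, dot (W x) (W y) = dot x y) /\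
      (forall s x, W (rho s x) = omega s (W x)).

Definition coef (R : realType) (G : lcGroupType) (K : hilbertType R)
    (rho : unirep G K) (xi eta : K) : G -> R[i] :=
  fun s => dot (rho s xi) eta.

Definition BG (R : realType) (G : lcGroupType) : set (G -> R[i]) :=
  [set u | exists (K : hilbertType R) (rho : unirep G K) (xi eta : K),
    u = coef rho xi eta].

Definition BG_norm (R : realType) (G : lcGroupType) (u : G -> R[i]) : R :=
  inf [set r | exists (K : hilbertType R) (rho : unirep G K) (xi eta : K),
    u = coef rho xi eta /\ r = rnorm xi * rnorm eta].

Definition BG_closure (R : realType) (G : lcGroupType) (S : set (G -> R[i])) :
    set (G -> R[i]) :=
  [set u | BG u /\ forall e : R, 0 < e ->
    exists2 v, S v & BG (u \- v) /\ BG_norm (u \- v) < e].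

Definition coef_span (R : realType) (G : lcGroupType) (K : hilbertType R)
    (pi : unirep G K) : set (G -> R[i]) :=
  [set u | exists n (c : 'I_n -> R[i]) (xi eta : 'I_n -> K),
    u = fun s => \sum_(i < n) c i * coef pi (xi i) (eta i) s].

Definition A_ (R : realType) (G : lcGroupType) (K : hilbertType R)
    (pi : unirep G K) : set (G -> R[i]) := BG_closure (coef_span pi).

Definition closed_invariant_subalgebra (R : realType) (G : lcGroupType)
    (A : set (G -> R[i])) : Prop :=
  [/\ A `<=` @BG R G /\ BG_closure A `<=` A,
      A (fun=> 0) /\
        (forall (a : R[i]) u v, A u -> A v -> A (fun s => a * u s + v s)),
      forall u v, A u -> A v -> A (u \* v) &
      forall t u, A u ->
        A (fun s => u (t * s)%g) /\ A (fun s => u (s * t)%g)].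

Definition bounded_op (R : realType) (K : hilbertType R) (T : K -> K) : Prop :=
  linear T /\ continuous T.

(* The double commutant of pi(G). *)
Definition VN (R : realType) (G : lcGroupType) (K : hilbertType R)
    (pi : unirep G K) : set (K -> K) :=
  [set T | bounded_op T /\ forall S : K -> K, bounded_op S ->
    (forall s, S \o pi s = pi s \o S) -> S \o T = T \o S].

(* 0 when T has no adjoint, which does not happen for a bounded T. *)
Definition adj (R : realType) (K : hilbertType R) (T : K -> K) : K -> K :=
  xget (fun=> 0) [set S | forall x y, dot (T x) y = dot x (S y)].

(* The bounded linear functional on A_pi that corresponds to T under the
   identification of VN_pi with the dual of A_pi; only its values on A_pi
   matter. *)
Definition represents (R : realType) (G : lcGroupType) (K : hilbertType R)
    (pi : unirep G K) (T : K -> K) (phi : (G -> R[i]) -> R[i]) : Prop :=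
  [/\ forall (a : R[i]) u v, A_ pi u -> A_ pi v ->
        phi (fun s => a * u s + v s) = a * phi u + phi v,
      exists M : R, forall u, A_ pi u -> rnorm (phi u) <= M * BG_norm u &
      forall xi eta, phi (coef pi xi eta) = dot (T xi) eta].

Definition pairing (R : realType) (G : lcGroupType) (K : hilbertType R)
    (pi : unirep G K) (T : K -> K) (u : G -> R[i]) : R[i] :=
  xget 0 [set c | exists2 phi, represents pi T phi & c = phi u].

(* The norm of a matrix [T i j] of operators on V, acting on the Hilbertian
   direct sum of copies of V indexed by I. *)
Definition opmx_norm (R : realType) (V : normedModType R[i]) (I : finType)
    (T : I -> I -> V -> V) : \bar R :=
  ereal_sup [set r | exists2 x : I -> V, \sum_i rnorm (x i) ^+ 2 <= 1 &
    r = (Num.sqrt (\sum_i rnorm (\sum_j T i j (x j)) ^+ 2))%:E].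

Definition op_norm (R : realType) (V : normedModType R[i]) (T : V -> V) :
    \bar R := opmx_norm (fun _ _ : 'I_1 => T).

Definition scalarmx_norm (R : realType) (I : finType) (a : I -> I -> R[i]) :
    \bar R := opmx_norm (fun i j (z : R[i]^o) => a i j * z).

(* The norm of M_n(A_pi) for the operator space structure of the predual of
   VN_pi: [u i j] is normed as the completely bounded map
   T |-> [<T, u i j>] from VN_pi to M_n. *)
Definition predual_mxnorm (R : realType) (G : lcGroupType) (K : hilbertType R)
    (pi : unirep G K) (n : nat) (u : 'M[G -> R[i]]_n) : \bar R :=
  ereal_sup [set r | exists m (T : 'I_m -> 'I_m -> K -> K),
    [/\ forall k l, VN pi (T k l), (opmx_norm T <= 1)%E &
     r = scalarmx_norm (fun p q : 'I_m * 'I_n =>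
           pairing pi (T p.1 q.1) (u p.2 q.2))]].

(* B(H) = A_omega for a universal representation omega of H, with W^*(H) =
   VN_omega. *)
Definition cb_homomorphism (R : realType) (G H : lcGroupType)
    (K L : hilbertType R) (pi : unirep G K) (omega : unirep H L)
    (j : (G -> R[i]) -> (H -> R[i])) : Prop :=
  [/\ forall u, A_ pi u -> BG (j u),
      forall (a : R[i]) u v, A_ pi u -> A_ pi v ->
        j (fun s => a * u s + v s) = (fun h => a * j u h + j v h),
      forall u v, A_ pi u -> A_ pi v -> j (u \* v) = j u \* j v &
      exists M : R, 0 <= M /\ forall n (u : 'M[G -> R[i]]_n),
        (forall i k, A_ pi (u i k)) ->
        (predual_mxnorm omega (map_mx j u) <= M%:E * predual_mxnorm pi u)%E].

(* The Gelfand spectrum of A_pi, inside VN_pi. *)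
Definition spectrum (R : realType) (G : lcGroupType) (K : hilbertType R)
    (pi : unirep G K) : set (K -> K) :=
  [set T | [/\ VN pi T,
    exists2 u, A_ pi u & pairing pi T u != 0 &
    forall u v, A_ pi u -> A_ pi v ->
      pairing pi T (u \* v) = pairing pi T u * pairing pi T v]].

Definition star_semigroup (R : realType) (K : hilbertType R)
    (D : set (K -> K)) : Prop :=
  (forall x y, D x -> D y -> D (x \o y)) /\ (forall x, D x -> D (adj x)).

Definition is_proj (R : realType) (K : hilbertType R) (p : K -> K) : Prop :=
  p \o p = p /\ adj p = p.

Definition Dgroup (R : realType) (G : lcGroupType) (K : hilbertType R)
    (pi : unirep G K) (p : K -> K) : set (K -> K) :=
  [set x | [/\ spectrum pi x, adj x \o x = p & x \o adj x = p]].

Section Cosets.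
Local Open Scope group_scope.

Definition is_subgroup (H : groupType) (K : set H) : Prop :=
  K 1 /\ forall x y, K x -> K y -> K (x * y^-1).

Definition is_coset (H : groupType) (E : set H) : Prop :=
  exists x (K : set H), is_subgroup K /\ E = [set x * k | k in K].

Definition open_coset (H : lcGroupType) (E : set H) : Prop :=
  is_coset E /\ open E.

(* E^-1 E, which is K when E = xK. *)
Definition coset_subgroup (H : groupType) (E : set H) : set H :=
  [set x^-1 * y | x in E & y in E].

(* For cosets E contained in E0. *)
Definition infinite_index (H : groupType) (E E0 : set H) : Prop :=
  infinite_set [set [set y * k | k in coset_subgroup E]
                  | y in coset_subgroup E0].

Definition Omega (H : lcGroupType) : set (set H) := <<r @open_coset H >>.

Definition Omega0 (H : lcGroupType) : set (set H) :=
  [set Z | exists (E0 : set H) (m : nat) (E : 'I_m -> set H),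
    [/\ open_coset E0,
        forall k, [/\ open_coset (E k), E k `<=` E0 & infinite_index (E k) E0]
      & Z = E0 `\` \bigcup_(k in [set: 'I_m]) E k]].

Definition Aff (H : groupType) (S : set H) : set H := smallest (@is_coset H) S.

(* The target group is the set D of elements of F, with product mul and
   inversion inv. *)
Definition affine_map (H : groupType) (F : Type) (D : set F)
    (mul : F -> F -> F) (inv : F -> F) (E : set H) (b : H -> F) : Prop :=
  (forall x, E x -> D (b x)) /\
  forall x y z, E x -> E y -> E z ->
    b (x * y^-1 * z) = mul (mul (b x) (inv (b y))) (b z).

Definition piecewise_affine (H : lcGroupType) (F : Type) (D : set F)
    (mul : F -> F -> F) (inv : F -> F) (Y : set H) (a : H -> F) : Prop :=
  exists n (Z : 'I_n -> set H),
    [/\ forall i, Omega0 (Z i), trivIset [set: 'I_n] Z,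
        Y = \bigcup_(i in [set: 'I_n]) Z i &
        forall i, exists b : H -> F, affine_map D mul inv (Aff (Z i)) b /\
          forall h, Z i h -> a h = b h].

End Cosets.

Definition pw2_affine (R : realType) (G H : lcGroupType) (K : hilbertType R)
    (pi : unirep G K) (Y : set H) (alpha : H -> K -> K) : Prop :=
  exists n (p : 'I_n -> K -> K) (Z : 'I_n -> set H) (a : 'I_n -> H -> K -> K),
    [/\ forall i, spectrum pi (p i) /\ is_proj (p i),
        forall i, piecewise_affine (Dgroup pi (p i))
                    (fun x y => x \o y) (@adj R K) (Z i) (a i),
        trivIset [set: 'I_n] Z,
        Y = \bigcup_(i in [set: 'I_n]) Z i &
        forall i h, Z i h -> alpha h = a i h].

(* Continuity for the weak* topology, the initial topology of the maps
   T |-> <T, u>, u in A_pi. *)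
Definition weakstar_continuous (R : realType) (G H : lcGroupType)
    (K : hilbertType R) (pi : unirep G K) (Y : set H) (alpha : H -> K -> K) :
    Prop :=
  forall u, A_ pi u ->
    {within Y, continuous (fun h => pairing pi (alpha h) u : R[i]^o)}.

Definition j_ (R : realType) (G H : lcGroupType) (K : hilbertType R)
    (pi : unirep G K) (Y : set H) (alpha : H -> K -> K) (u : G -> R[i]) :
    H -> R[i] :=
  fun h => if `[< Y h >] then pairing pi (alpha h) u else 0.

(* Main.v *)
From HB Require Import structures.
Require Import Defs.
From mathcomp Require Import ring lra finmap.
From mathcomp.analysis.showcase Require summability.

Set Implicit Arguments.
Unset Strict Implicit.
Unset Printing Implicit Defensive.

(** Write [phi_T] for the functional on [A = A_pi] given by an element [T] of
    the von Neumann algebra, so that [phi_T (coef pi xi eta) = <T xi, eta>].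

    Where the map is affine, [j u] is a coefficient function.  On a coset [E],
    with [x0] in [E], a continuous affine map [b] into the group at a
    projection [p] has the form [b (x0 k) = b x0 o beta k], where [beta] is a
    unitary representation of the open subgroup [x0^-1 E] on the range of [p].
    Inducing [beta] to [H] gives a representation [rho] on a space of
    square-summable families, and two bounded operators [V], [V'] from the space
    of [pi] into it, with [<rho h (V xi), V' eta> = <b h xi, eta>] on [E] and [0]
    outside [E] ([induced_rep], [affine_matrix_coefficient]).

    The map [alpha] reduces to this case.  By inclusion-exclusion the indicator
    function of a member of [Omega_0] is a signed sum of indicator functions of
    open cosets, and weak* continuity of [alpha] on an open piece spreads to the
    whole coset that the piece generates.  Hence
    [j u h = \sum_l eps_l 1_(E_l)(h) phi_(b_l h) u], a finite sum
    ([decomposable_pw2]), and one pair [V], [V'] serves all the terms.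

    This treats [u = coef pi xi eta].  A general [u] in [A] is a coefficient
    function [coef rho' xi eta] of some other representation [rho'] of [G], whose
    vectors have norms close to optimal for the norm of [B(G)].  The spectrum acts
    on the space of [rho'] too: once [eta] is replaced by its component in the
    cyclic subspace of [xi], all coefficient functions of [rho'] at [eta] are
    limits of translates of [u], hence in [A] ([realization_reduce]); for vectors
    [y] with this property [<theta T x, y> = phi_T (coef rho' x y)] defines a
    *-representation of the spectrum ([theta_spectrum_rep]).  The representation
    induced from the maps [theta o b_l] shows that [j u] is in [B(H)] with norm at
    most a constant times that of [u] ([implemented_BG]).

    For complete boundedness let [S] be a matrix over [VN_omega = W^*(H)].  Each
    entry acts on the space of [rho] by an operator [Th]: on the cyclic subspace
    of a vector this is [W^* S W] for an embedding [W] into the universal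
    representation.  Finitely many vectors lie in a finite orthogonal sum of
    cyclic subspaces, so that passing from [S] to [Th] does not increase the norm
    of a matrix ([transfer_exists], [transfer_contractive]).  Then [V'^* Th V] is a
    matrix over [VN_pi] that pairs with [u] as [S] does with [j u], which
    [implemented_adjoint] states up to a constant factor; this
    bounds the matrix norms of [j u] by those of [u].  Multiplicativity holds because [alpha] has values in the spectrum. *)

(** * Real-valued norms and inner products *)

Section RealNorm.
Variable R : realType.
Local Notation C := R[i].

Section NormedZmod.
Variable V : normedZmodType C.
Implicit Types x y : V.

Lemma rnormE x : `|x| = (rnorm x)%:C.
Proof. by rewrite /rnorm RRe_real // normr_real. Qed.

Lemma rnorm_ge0 x : 0 <= rnorm x.
Proof. by rewrite -ler0c -rnormE normr_ge0. Qed.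

Lemma rnorm0 : rnorm (0 : V) = 0.
Proof. by rewrite /rnorm normr0. Qed.

Lemma rnorm_eq0 x : rnorm x = 0 -> x = 0.
Proof. by move=> h; apply/normr0_eq0; rewrite rnormE h. Qed.

Lemma rnormN x : rnorm (- x) = rnorm x.
Proof. by rewrite /rnorm normrN. Qed.

Lemma rnormBC x y : rnorm (x - y) = rnorm (y - x).
Proof. by rewrite -rnormN opprB. Qed.

Lemma rnormD x y : rnorm (x + y) <= rnorm x + rnorm y.
Proof. by rewrite -lecR rmorphD /= -!rnormE ler_normD. Qed.

Lemma rnorm_sum (I : Type) (r : seq I) (P : pred I) (F : I -> V) :
  rnorm (\sum_(i <- r | P i) F i) <= \sum_(i <- r | P i) rnorm (F i).
Proof.
elim/big_ind2 : _ => [|a b c d h1 h2|//]; first by rewrite rnorm0.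
by apply: le_trans (rnormD _ _) _; apply: lerD.
Qed.

Lemma rnorm_triangle x y z : rnorm (x - z) <= rnorm (x - y) + rnorm (y - z).
Proof. by have := rnormD (x - y) (y - z); rewrite addrA subrK. Qed.

End NormedZmod.

Lemma rnormZ (V : normedModType C) (a : C) (x : V) :
  rnorm (a *: x) = rnorm a * rnorm x.
Proof. by apply: complexI; rewrite rmorphM /= -!rnormE normrZ. Qed.

Lemma rnormM (a b : C) : rnorm (a * b) = rnorm a * rnorm b.
Proof. by apply: complexI; rewrite rmorphM /= -!rnormE normrM. Qed.

Lemma rnorm_real (r : R) : rnorm r%:C = `|r|.
Proof. by rewrite /rnorm normc_def /= expr0n addr0 sqrtr_sqr. Qed.

Lemma rnorm_conj (a : C) : rnorm (conjc a) = rnorm a.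
Proof. by rewrite /rnorm normcJ. Qed.

Lemma rnorm_sqrE (a : C) : rnorm a ^+ 2 = complex.Re a ^+ 2 + complex.Im a ^+ 2.
Proof. by apply: complexI; rewrite rmorphXn /= -rnormE -add_Re2_Im2. Qed.

Lemma ler_Re (a : C) : `|complex.Re a| <= rnorm a.
Proof. by rewrite -lecR -rnormE normc_ge_Re. Qed.

Lemma ler_Im (a : C) : `|complex.Im a| <= rnorm a.
Proof.
rewrite -(@ler_pXn2r _ 2) // ?nnegrE ?rnorm_ge0 // rnorm_sqrE real_normK ?num_real //.
by rewrite lerDr sqr_ge0.
Qed.

Lemma cvg_rnormP (V : normedModType C) (T : Type) (F : set_system T)
    {FF : Filter F} (f : T -> V) (l : V) :
  f @ F --> l <-> forall e : R, 0 < e -> \forall t \near F, rnorm (l - f t) < e.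
Proof.
split=> [/cvgrPdist_lt h e e0|h].
  have /h : 0 < e%:C by rewrite ltcR.
  by apply: filterS => t /=; by rewrite rnormE ltcR.
apply/cvgrPdist_lt => -[e e'] /[dup] e0; rewrite ltcE /= => /andP[/eqP e'0 e1].
rewrite e'0 complexr0; apply: filterS (h e e1) => t; by rewrite rnormE ltcR.
Qed.

Lemma seq_complete (V : completeNormedModType C) (x : nat -> V) :
  (forall e : R, 0 < e -> exists N, forall m n, (N <= m)%N -> (N <= n)%N ->
     rnorm (x m - x n) < e) ->
  exists l, forall e : R, 0 < e -> exists N, forall n, (N <= n)%N -> rnorm (l - x n) < e.
Proof.
move=> hc.
have cx : cauchy (x @ \oo).
  apply/cauchyP => -[e e']; rewrite ltcE /= => /andP[/eqP e'0 e1].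
  have [N hN] := hc e e1; exists (x N); exists N => // n /= Nn.
  rewrite -ball_normE /= rnormE e'0 ltcE /= eqxx /=; exact: hN.
have /cauchy_cvg /cvg_ex [l hl] := cx.
exists l => e e0; have /cvg_rnormP /(_ e e0) [N _ hN] := hl.
by exists N => n Nn; apply: hN.
Qed.

Lemma archi_inv (e : R) : 0 < e -> exists N, forall n, (N <= n)%N -> n.+1%:R^-1 < e.
Proof.
move=> e0; have [N _ hN] := near_infty_natSinv_lt (PosNum e0).
by exists N => n; exact: hN.
Qed.

End RealNorm.

Lemma dotform_CauchySchwarz (C : numClosedFieldType) (U : lmodType C)
    (f : {dot U for (@Num.conj C)}) (u v : U) :
  `|f u v| ^+ 2 <= f u u * f v v.
Proof.
have [->|v0] := eqVneq v 0; first by rewrite linear0r normr0 expr0n mulr_ge0 ?dnorm_ge0.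
have fv : 0 < f v v by rewrite dnorm_gt0.
have fvE : `|f v v| = f v v by rewrite gtr0_norm.
have d_real : (f u v)^* * (f v v * f u v) = f v v * `|f u v| ^+ 2.
  by rewrite normCK; ring.
have ZE a b x y : f (a *: x) (b *: y) = b^* * (a * f x y).
  by rewrite linearZr_LR /= linearZl_LR.
have := dnorm_ge0 f (f v v *: u - f u v *: v).
rewrite dnormB !dnormZ fvE ZE d_real.
have -> : Num.conj (f v v * `|f u v| ^+ 2) = f v v * `|f u v| ^+ 2.
  by apply/conj_Creal/ger0_real/mulr_ge0; [exact: ltW | exact: exprn_ge0].
rewrite [leRHS](_ : _ = f v v * (f u u * f v v - `|f u v| ^+ 2)).
  by rewrite pmulr_rge0 // subr_ge0.
by move: (f v v) (f u u) (`|f u v| ^+ 2) => p q r; ring.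
Qed.

Section Dot.
Variables (R : realType) (K : hilbertType R).
Local Notation C := R[i].
Implicit Types (x y z : K) (a : C).

Lemma dotDl x y z : dot (x + y) z = dot x z + dot y z.
Proof. exact: linearDl. Qed.
Lemma dotZl a x z : dot (a *: x) z = a * dot x z.
Proof. exact: linearZl_LR. Qed.
Lemma dotC x y : dot x y = conjc (dot y x).
Proof. by rewrite /dot hermitian_subproof expr0 mul1r. Qed.
Lemma dotDr x y z : dot x (y + z) = dot x y + dot x z.
Proof. exact: linearDr. Qed.
Lemma dotZr a x z : dot x (a *: z) = conjc a * dot x z.
Proof. exact: linearZr_LR. Qed.
Lemma dotNl x y : dot (- x) y = - dot x y.
Proof. exact: linearNl. Qed.
Lemma dotNr x y : dot x (- y) = - dot x y.
Proof. exact: linearNr. Qed.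
Lemma dotBl x y z : dot (x - y) z = dot x z - dot y z.
Proof. exact: linearBl. Qed.
Lemma dotBr x y z : dot x (y - z) = dot x y - dot x z.
Proof. exact: linearBr. Qed.
Lemma dot0l y : dot 0 y = 0 :> C.
Proof. exact: linear0l. Qed.
Lemma dot0r y : dot y 0 = 0 :> C.
Proof. exact: linear0r. Qed.
Lemma dot_suml (I : Type) (r : seq I) (P : pred I) (F : I -> K) y :
  dot (\sum_(i <- r | P i) F i) y = \sum_(i <- r | P i) dot (F i) y.
Proof. exact: linear_sumlz. Qed.
Lemma dot_sumr (I : Type) (r : seq I) (P : pred I) (F : I -> K) y :
  dot y (\sum_(i <- r | P i) F i) = \sum_(i <- r | P i) dot y (F i).
Proof. exact: linear_sumr. Qed.

Lemma dotxx x : dot x x = (rnorm x ^+ 2)%:C.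
Proof. by rewrite /dot hilbert_dot_norm rnormE rmorphXn. Qed.

Lemma dotxx_eq0 x : dot x x = 0 -> x = 0.
Proof.
by rewrite dotxx => /complexI /eqP; rewrite sqrf_eq0 => /eqP /rnorm_eq0.
Qed.

Lemma dot_ext x y : (forall z, dot x z = dot y z) -> x = y.
Proof.
move=> h; apply/eqP; rewrite -subr_eq0; apply/eqP/dotxx_eq0.
by rewrite dotBl h subrr.
Qed.

Lemma normsqD x y :
  rnorm (x + y) ^+ 2 = rnorm x ^+ 2 + rnorm y ^+ 2 + 2 * complex.Re (dot x y).
Proof.
have := dotxx (x + y); rewrite dotDl !dotDr (dotC y x) !dotxx.
by move/(congr1 (@complex.Re R)); case: (dot x y) => a b /=; lra.
Qed.

Lemma normsqB x y :
  rnorm (x - y) ^+ 2 = rnorm x ^+ 2 + rnorm y ^+ 2 - 2 * complex.Re (dot x y).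
Proof.
rewrite normsqD rnormN dotNr; case: (dot x y) => a b /=; lra.
Qed.

Lemma parallelogram x y :
  rnorm (x + y) ^+ 2 + rnorm (x - y) ^+ 2 = 2 * rnorm x ^+ 2 + 2 * rnorm y ^+ 2.
Proof. rewrite normsqD normsqB; lra. Qed.

Lemma Pythagoras x y : dot x y = 0 ->
  rnorm (x + y) ^+ 2 = rnorm x ^+ 2 + rnorm y ^+ 2.
Proof. by move=> h; rewrite normsqD h /= mulr0 addr0. Qed.

Lemma CauchySchwarz x y : rnorm (dot x y) <= rnorm x * rnorm y.
Proof.
rewrite -(@ler_pXn2r _ 2) // ?nnegrE ?mulr_ge0 ?rnorm_ge0 // exprMn -lecR.
have -> : (rnorm x ^+ 2 * rnorm y ^+ 2)%:C = dot x x * dot y y.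
  by rewrite !dotxx -rmorphM.
rewrite rmorphXn /= -rnormE.
exact: (dotform_CauchySchwarz (hilbert_dot K) x y).
Qed.

Lemma rnorm_le_dot (x : K) (c : R) : 0 <= c -> rnorm (dot x x) <= c * rnorm x ->
  rnorm x <= c.
Proof.
move=> c0 h; have [->//|x0] := eqVneq (rnorm x) 0.
have xp : 0 < rnorm x by rewrite lt_neqAle eq_sym x0 rnorm_ge0.
move: h; rewrite dotxx rnorm_real ger0_norm ?sqr_ge0 // expr2.
by rewrite ler_pM2r.
Qed.

End Dot.

Lemma rnorm_dot_eq (R : realType) (K K' : hilbertType R) (x : K) (y : K') :
  dot x x = dot y y -> rnorm x = rnorm y.
Proof.
move=> h; apply/eqP; rewrite -(@eqrXn2 _ 2) ?rnorm_ge0 //; apply/eqP/complexI.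
by rewrite -!dotxx.
Qed.

(** * Projections, the Riesz theorem and adjoints *)

Section ClosedSubspaces.
Variables (R : realType) (K : hilbertType R).
Local Notation C := R[i].
Implicit Types (x y z : K) (a : C) (M : set K).

Definition closed_subspace M : Prop :=
  [/\ M 0, forall a x y, M x -> M y -> M (a *: x + y) &
      forall x, (forall e : R, 0 < e -> exists2 y, M y & rnorm (x - y) < e) ->
        M x].

Lemma orthogonal_closed (D : set K) :
  closed_subspace [set z | forall y, D y -> dot y z = 0].
Proof.
split=> [y _|a u v hu hv y Dy|u hu y Dy]; first by rewrite dot0r.
  by rewrite dotDr dotZr hu // hv // mulr0 addr0.
apply/rnorm_eq0/eqP; rewrite eq_le rnorm_ge0 andbT.
apply/ler_addgt0Pr => e e0; rewrite add0r.
have y0 : 0 < rnorm y + 1 by rewrite ltr_wpDl ?rnorm_ge0.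
have [v hv huv] := hu _ (divr_gt0 e0 y0).
have -> : dot y u = dot y (u - v) by rewrite dotBr hv // subr0.
apply: le_trans (CauchySchwarz _ _) _.
move: huv; rewrite ltr_pdivlMr // => huv; apply: le_trans (ltW huv).
by rewrite mulrC ler_wpM2l ?rnorm_ge0 // lerDl.
Qed.

Section Projection.
Variable M : set K.
Hypothesis hM : closed_subspace M.

Lemma subspaceD x y : M x -> M y -> M (x + y).
Proof. by case: hM => _ h _ hx hy; rewrite -[x]scale1r; apply: h. Qed.

Lemma subspaceZ a x : M x -> M (a *: x).
Proof. by case: hM => h0 h _ hx; rewrite -[_ *: _]addr0; apply: h. Qed.

Lemma subspaceB x y : M x -> M y -> M (x - y).
Proof. by move=> hx hy; apply: subspaceD => //; rewrite -scaleN1r; apply: subspaceZ. Qed.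

(** The derivative at [p] of the distance to [x] vanishes in every direction of
    the subspace. *)
Lemma nearest_orth x p : M p ->
  (forall y, M y -> rnorm (x - p) ^+ 2 <= rnorm (x - y) ^+ 2) ->
  forall y, M y -> dot (x - p) y = 0.
Proof.
move=> Mp hmin y My.
(* The comparison point is [p + s a y] with [a = <x - p, y>]; adding [1] to
   the square of [rnorm y] avoids the case [y = 0]. *)
have s0 : 0 < (rnorm y ^+ 2 + 1)^-1.
  by rewrite invr_gt0 ltr_wpDl ?ltr01 ?sqr_ge0.
set s := _^-1 in s0.
have := hmin (p + (s%:C * dot (x - p) y) *: y) (subspaceD Mp (subspaceZ _ My)).
rewrite opprD addrA; move: (x - p) => e; set a := dot e y.
rewrite normsqB rnormZ dotZr rnormM rnorm_real -/a.
have -> : complex.Re (conjc (s%:C * a) * a) = s * rnorm a ^+ 2.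
  by rewrite rnorm_sqrE; case: (a) => u v /=; ring.
have hs : s * (rnorm y ^+ 2 + 1) = 1.
  by rewrite mulVf // gt_eqF // ltr_wpDl ?ltr01 ?sqr_ge0.
rewrite (ger0_norm (ltW s0)) => h.
apply/rnorm_eq0/eqP; rewrite -sqrf_eq0 eq_le sqr_ge0 andbT.
have : 0 <= s * (rnorm a ^+ 2 * (s * rnorm y ^+ 2 - 2)) by rewrite !exprMn in h; lra.
rewrite pmulr_rge0 //.
have -> : s * rnorm y ^+ 2 = 1 - s by lra.
have := sqr_ge0 (rnorm a); nra.
Qed.

(** A sequence that minimizes the distance to [x] is Cauchy by the parallelogram
    law. *)
Lemma projection_exists x :
  exists p, M p /\ forall y, M y -> dot (x - p) y = 0.
Proof.
have [M0 _ Mc] := hM.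
pose D := [set r | exists2 y, M y & r = rnorm (x - y) ^+ 2].
have D0 : D !=set0 by exists (rnorm (x - 0) ^+ 2); exists 0.
have Dlb : lbound D 0 by move=> r [y _ ->]; rewrite sqr_ge0.
have hD : has_inf D by split => //; exists 0.
set d := inf D.
have dle y : M y -> d <= rnorm (x - y) ^+ 2.
  by move=> My; apply: ge_inf; [exists 0 | exists y].
have /choice [y hy] : forall n : nat, exists y, M y /\ rnorm (x - y) ^+ 2 < d + n.+1%:R^-1.
  move=> n; have i0 : 0 < (n.+1%:R^-1 : R) by rewrite invr_gt0.
  by have [_ [y My ->] hy] := inf_adherent i0 hD; exists y.
have hcau m n : rnorm (y m - y n) ^+ 2 <= 2 * (m.+1%:R^-1 + n.+1%:R^-1).
  have [Mm hm] := hy m; have [Mn hn] := hy n.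
  have := parallelogram (x - y m) (x - y n).
  have -> : x - y m + (x - y n) = 2%:R *: (x - (2%:R^-1 : C) *: (y m + y n)).
    rewrite scalerBr scalerA mulfV ?pnatr_eq0 // scale1r scaler_nat mulr2n opprD.
    by rewrite addrACA.
  have -> : x - y m - (x - y n) = - (y m - y n).
    by rewrite !opprB addrC addrA subrK.
  rewrite rnormN rnormZ.
  have -> : rnorm (2%:R : C) = 2 by rewrite -(rmorph_nat (real_complex R)) rnorm_real ger0_norm.
  have := dle _ (subspaceZ (2%:R^-1) (subspaceD Mm Mn)).
  rewrite exprMn; move: hm hn; move: (m.+1%:R^-1) (n.+1%:R^-1) => u v; lra.
have [|p hp] := seq_complete (x := y).
  move=> e e0; have e4 : 0 < e ^+ 2 / 4 by rewrite divr_gt0 ?exprn_gt0.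
  have [N hN] := archi_inv e4.
  exists N => m n /hN hm /hN hn.
  rewrite -(@ltr_pXn2r _ 2) // ?nnegrE ?rnorm_ge0 ?ltW //.
  move: hm hn (hcau m n); move: (m.+1%:R^-1) (n.+1%:R^-1) => u v; lra.
have Mp : M p.
  apply: Mc => e /hp [N hN]; exists (y N); first by have [] := hy N.
  exact: hN.
exists p; split => //; apply: nearest_orth => // z Mz.
apply: le_trans (dle z Mz).
rewrite leNgt; apply/negP => hlt.
set q := rnorm (x - p) in hlt.
have d0 : 0 <= d by apply: lb_le_inf.
have q0 : 0 < q.
  rewrite lt_neqAle rnorm_ge0 andbT eq_sym; apply/eqP => q0.
  by move: hlt; rewrite q0 expr0n /= ltNge d0.
have dq : 0 < (q ^+ 2 - d) / (4 * q) by apply: divr_gt0; lra.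
have [N hN] := hp _ dq.
have d4 : 0 < (q ^+ 2 - d) / 4 by apply: divr_gt0; lra.
have [N' hN'] := archi_inv d4.
have h1 := hN (maxn N N') (leq_maxl _ _).
have h2 := hN' (maxn N N') (leq_maxr _ _).
have [_ h3] := hy (maxn N N').
have h4 := rnorm_triangle x (y (maxn N N')) p.
rewrite -/q (rnormBC (y _)) in h4.
set u := rnorm (x - y _) in h3 h4; set v := rnorm (p - y _) in h1 h4.
have u0 : 0 <= u := rnorm_ge0 _; have v0 : 0 <= v := rnorm_ge0 _.
have h5 : v * (4 * q) < q ^+ 2 - d by rewrite -ltr_pdivlMr //; lra.
move: h2 h3; move: (_^-1) => t h2 h3.
have vq : v <= q by rewrite leNgt; apply/negP => qv; nra.
have quv : q - v <= u by rewrite lerBlDr.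
have qv0 : 0 <= q - v by rewrite subr_ge0.
have h6 := ler_pM qv0 qv0 quv quv.
nra.
Qed.

Definition orthoproj x : K := xget 0 [set p | M p /\ forall y, M y -> dot (x - p) y = 0].

Lemma orthoproj_spec x :
  M (orthoproj x) /\ forall y, M y -> dot (x - orthoproj x) y = 0.
Proof. by rewrite /orthoproj; case: xgetP => // h; have [p /h] := projection_exists x. Qed.

Lemma orthoproj_in x : M (orthoproj x).
Proof. by have [] := orthoproj_spec x. Qed.

Lemma orthoproj_orth x y : M y -> dot (x - orthoproj x) y = 0.
Proof. by have [_] := orthoproj_spec x; apply. Qed.

Lemma orthoproj_unique x p : M p -> (forall y, M y -> dot (x - p) y = 0) ->
  orthoproj x = p.
Proof.
move=> Mp hp; apply/eqP; rewrite -subr_eq0; apply/eqP/dotxx_eq0.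
have Mq : M (orthoproj x - p) by apply: subspaceB => //; apply: orthoproj_in.
rewrite {1}(_ : orthoproj x - p = (x - p) - (x - orthoproj x)).
  by rewrite dotBl hp // orthoproj_orth // subrr.
by rewrite opprB [in RHS]addrC addrA subrK.
Qed.

Lemma orthoproj_id x : M x -> orthoproj x = x.
Proof. by move=> Mx; apply: orthoproj_unique => // y _; rewrite subrr dot0l. Qed.

Lemma orthoproj_eq0 x : (forall y, M y -> dot x y = 0) -> orthoproj x = 0.
Proof.
by move=> h; apply: orthoproj_unique => [|y My]; [case: hM | rewrite subr0 h].
Qed.

Lemma orthoproj_linear : linear orthoproj.
Proof.
move=> a x y; apply: orthoproj_unique.
  by case: hM => _ h _; apply: h; apply: orthoproj_in.
move=> z Mz; rewrite opprD addrACA -scalerBr dotDl dotZl !orthoproj_orth //.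
by rewrite mulr0 addr0.
Qed.

Lemma dot_orthoproj x y : dot (orthoproj x) y = dot (orthoproj x) (orthoproj y).
Proof.
apply/eqP; rewrite -subr_eq0 -dotBr dotC orthoproj_orth ?conjc0 //.
exact: orthoproj_in.
Qed.

Lemma orthoproj_adj x y : dot (orthoproj x) y = dot x (orthoproj y).
Proof. by rewrite dot_orthoproj dotC -dot_orthoproj -dotC. Qed.

Lemma orthoproj_Pythagoras x :
  rnorm x ^+ 2 = rnorm (x - orthoproj x) ^+ 2 + rnorm (orthoproj x) ^+ 2.
Proof.
rewrite -Pythagoras ?subrK // orthoproj_orth //; exact: orthoproj_in.
Qed.

Lemma orthoproj_norm x : rnorm (orthoproj x) <= rnorm x.
Proof.
by rewrite -(@ler_pXn2r _ 2) ?nnegrE ?rnorm_ge0 // [leRHS]orthoproj_Pythagoras lerDr sqr_ge0.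
Qed.

Lemma orthoproj_norm_compl x : rnorm (x - orthoproj x) <= rnorm x.
Proof.
by rewrite -(@ler_pXn2r _ 2) ?nnegrE ?rnorm_ge0 // [leRHS]orthoproj_Pythagoras lerDl sqr_ge0.
Qed.

(** Properties of vectors that are stable under limits are established by showing
    that only [0] is orthogonal to the vectors that enjoy them. *)
Lemma closed_subspace_total :
  (forall z, (forall y, M y -> dot z y = 0) -> z = 0) -> forall x, M x.
Proof.
move=> h x; have /subr0_eq -> : x - orthoproj x = 0.
  by apply: h => y; exact: orthoproj_orth.
exact: orthoproj_in.
Qed.

End Projection.

End ClosedSubspaces.

Section Operators.
Variable R : realType.
Local Notation C := R[i].

Definition bounded_by (V W : normedModType C) (c : R) (T : V -> W) : Prop :=
  forall x, rnorm (T x) <= c * rnorm x.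

Lemma lin0 (V W : lmodType C) (T : V -> W) : linear T -> T 0 = 0.
Proof. by move=> h; have := h (-1) 0 0; rewrite scaler0 addr0 scaleN1r addNr. Qed.

Lemma linZ (V W : lmodType C) (T : V -> W) a x : linear T -> T (a *: x) = a *: T x.
Proof. by move=> h; have := h a x 0; rewrite (lin0 h) !addr0. Qed.

Lemma linD (V W : lmodType C) (T : V -> W) x y : linear T -> T (x + y) = T x + T y.
Proof. by move=> h; have := h 1 x y; rewrite !scale1r. Qed.

Lemma linN (V W : lmodType C) (T : V -> W) x : linear T -> T (- x) = - T x.
Proof. by move=> h; rewrite -scaleN1r linZ // scaleN1r. Qed.

Lemma linB (V W : lmodType C) (T : V -> W) x y : linear T -> T (x - y) = T x - T y.
Proof. by move=> h; rewrite linD // linN. Qed.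

Lemma lin_sum (V W : lmodType C) (T : V -> W) (I : Type) (r : seq I) (P : pred I)
    (F : I -> V) : linear T -> T (\sum_(i <- r | P i) F i) = \sum_(i <- r | P i) T (F i).
Proof.
move=> h; elim/big_ind2 : _ => [|a b c d <- <-|//]; first exact: lin0.
exact: linD.
Qed.

Lemma lin_comp (U V W : lmodType C) (S : V -> W) (T : U -> V) :
  linear S -> linear T -> linear (S \o T).
Proof. by move=> hS hT a x y /=; rewrite hT hS. Qed.

Lemma linear_continuous_bounded (V W : normedModType C) (T : V -> W) :
  linear T -> continuous T -> exists2 c, 0 <= c & bounded_by c T.
Proof.
move=> hT /(_ 0) /cvg_rnormP /(_ 1 ltr01); rewrite (lin0 hT).
move=> /nbhs_ballP [[d d'] /= ]; rewrite ltcE /= => /andP[/eqP d'0 d0] h.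
exists (2 / d) => [|x]; first by rewrite divr_ge0 // ltW.
have [x0|x0] := eqVneq (rnorm x) 0.
  by rewrite x0 mulr0 (rnorm_eq0 x0) lin0 // rnorm0.
have xp : 0 < rnorm x by rewrite lt_neqAle eq_sym x0 rnorm_ge0.
set t := d / (2 * rnorm x).
have t0 : 0 < t by rewrite divr_gt0 // mulr_gt0.
have h' : rnorm (t%:C *: x) < d -> rnorm (T (t%:C *: x)) < 1.
  move=> hd; rewrite -rnormN -sub0r; apply: h.
  by rewrite -ball_normE /ball_ /= sub0r normrN rnormE d'0 complexr0 ltcR.
move: h'; rewrite linZ // !rnormZ rnorm_real gtr0_norm // => h'.
have -> : 2 / d = t^-1 / rnorm x.
  by rewrite /t; field; rewrite x0 /= gt_eqF.
rewrite mulfVK // -(ler_pM2l t0) mulfV ?gt_eqF //; apply/ltW/h'.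
rewrite (_ : t * rnorm x = d / 2); first by lra.
by rewrite /t; field.
Qed.

Lemma bounded_linear_continuous (V W : normedModType C) (T : V -> W) c :
  linear T -> bounded_by c T -> continuous T.
Proof.
move=> hT hc x; apply/cvg_rnormP => e e0.
have c0 : 0 < `|c| + 1 by rewrite ltr_wpDl.
have /cvg_rnormP /(_ (e / (`|c| + 1))) : id @ x --> x by exact: cvg_id.
move=> /(_ (divr_gt0 e0 c0)); apply: filterS => y /=; rewrite ltr_pdivlMr // => h.
rewrite -linB //; apply: le_lt_trans (hc _) (le_lt_trans _ h).
rewrite mulrC; apply: ler_wpM2l; first exact: rnorm_ge0.
by have := ler_norm c; lra.
Qed.

Lemma bounded_opP (K : hilbertType R) (T : K -> K) :
  bounded_op T <-> linear T /\ exists2 c, 0 <= c & bounded_by c T.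
Proof.
split=> -[h1 h2]; split=> //; first exact: linear_continuous_bounded.
by have [c _ hc] := h2; apply: bounded_linear_continuous hc.
Qed.

Lemma Riesz (K : hilbertType R) (f : K -> C) c :
  (forall a x y, f (a *: x + y) = a * f x + f y) ->
  (forall x, rnorm (f x) <= c * rnorm x) -> exists z, forall x, f x = dot x z.
Proof.
move=> fl fb.
have f0 : f 0 = 0.
  by have := fl (-1) 0 0; rewrite scaler0 addr0 mulN1r addNr.
have fZ a x : f (a *: x) = a * f x by have := fl a x 0; rewrite f0 !addr0.
have fD x y : f (x + y) = f x + f y by have := fl 1 x y; rewrite scale1r mul1r.
have hM : closed_subspace [set x | f x = 0].
  split=> [//|a x y /= hx hy|x /= h]; first by rewrite fl hx hy mulr0 addr0.
  apply/rnorm_eq0/eqP; rewrite eq_le rnorm_ge0 andbT leNgt; apply/negP => fx0.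
  have c0 : 0 < `|c| + 1 by rewrite ltr_wpDl.
  have [y fy hy] := h _ (divr_gt0 fx0 c0).
  have : rnorm (f x) <= c * rnorm (x - y).
    by rewrite -[f x]subr0 -fy -mulN1r -fZ -fD scaleN1r.
  move: hy; rewrite ltr_pdivlMr // => h1 h2.
  have := ler_wpM2r (rnorm_ge0 (x - y)) (ler_norm c).
  have := rnorm_ge0 (x - y); lra.
have [fall|/existsNP [x fx]] := pselect (forall x, f x = 0).
  by exists 0 => x; rewrite fall dot0r.
(* The kernel has codimension one, so [e] spans its orthogonal complement. *)
set e := x - orthoproj [set x | f x = 0] x.
have fe : f e = f x.
  rewrite /e -scaleN1r addrC fl; have /= -> := orthoproj_in hM x.
  by rewrite mulr0 add0r.
have e0 : dot e e != 0.
  by apply/eqP => /dotxx_eq0 e0; apply: fx; rewrite -fe e0.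
exists (conjc (f e / dot e e) *: e) => y; rewrite dotZr conjcK.
have : dot (y - (f y / f e) *: e) e = 0.
  rewrite dotC (orthoproj_orth hM) ?conjc0 //= -scaleN1r addrC fl fZ mulN1r.
  by rewrite mulfVK ?addNr // fe; apply/eqP.
rewrite dotBl dotZl => /eqP; rewrite subr_eq0 => /eqP ->.
have : f e != 0 by rewrite fe; apply/eqP.
by move: (f e) (dot e e) (f y) e0 => p q r q0 p0; field; rewrite p0.
Qed.

(** By the Riesz theorem in the second variable.  Adjoints, and the operators that
    functionals on coefficient functions induce, are obtained in this way. *)
Lemma sesquilinear_operator (K1 K2 : hilbertType R) (F : K1 -> K2 -> C) c :
  0 <= c ->
  (forall a x x' y, F (a *: x + x') y = a * F x y + F x' y) ->
  (forall a x y y', F x (a *: y + y') = conjc a * F x y + F x y') ->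
  (forall x y, rnorm (F x y) <= c * rnorm x * rnorm y) ->
  exists T : K1 -> K2, [/\ linear T, bounded_by c T &
    forall x y, dot (T x) y = F x y].
Proof.
move=> c0 Fl Fr Fb.
have /choice [T hT] : forall x, exists z, forall y, dot z y = F x y.
  move=> x; have [||z hz] := @Riesz K2 (fun y => conjc (F x y)) (c * rnorm x).
  - by move=> a y y'; rewrite Fr rmorphD rmorphM /= conjcK.
  - by move=> y; rewrite rnorm_conj.
  - by exists z => y; rewrite dotC -hz conjcK.
exists T; split => //.
  by move=> a x y; apply: dot_ext => z; rewrite dotDl dotZl !hT Fl.
by move=> x; apply: rnorm_le_dot; rewrite ?mulr_ge0 ?rnorm_ge0 // hT.
Qed.

Lemma adjoint_exists (K1 K2 : hilbertType R) (T : K1 -> K2) c :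
  0 <= c -> linear T -> bounded_by c T ->
  exists S : K2 -> K1, [/\ linear S, bounded_by c S &
    forall y x, dot (S y) x = dot y (T x)].
Proof.
move=> c0 hT bT.
apply: (@sesquilinear_operator _ _ (fun y x => dot y (T x)) c) => //.
- by move=> a x x' y; rewrite dotDl dotZl.
- by move=> a x y y'; rewrite hT dotDr dotZr.
- move=> x y; apply: le_trans (CauchySchwarz _ _) _.
  by rewrite [c * _]mulrC -mulrA ler_wpM2l ?rnorm_ge0.
Qed.

Lemma adjP (K : hilbertType R) (T : K -> K) : bounded_op T ->
  forall x y, dot (T x) y = dot x (adj T y).
Proof.
move=> /bounded_opP [hT [c c0 bT]]; rewrite /adj; case: xgetP => [//|h].
have [S [_ _ hS]] := adjoint_exists c0 hT bT.
by case: (h S) => x y; rewrite dotC -hS -dotC.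
Qed.

Lemma bounded_comp (U V W : normedModType C) c d (S : V -> W) (T : U -> V) :
  0 <= c -> bounded_by c S -> bounded_by d T -> bounded_by (c * d) (S \o T).
Proof.
move=> c0 hS hT x; apply: le_trans (hS _) _.
by rewrite -mulrA ler_wpM2l.
Qed.

End Operators.

(** * Construction of Hilbert spaces *)

(** Completeness is asked of sequences and for squared norms, the form in which
    the constructions below establish it. *)
Record innerProductSpace (R : realType) := InnerProductSpace {
  ips_mod :> lmodType R[i] ;
  ips_form : {dot ips_mod for (@Num.conj R[i])} ;
  ips_complete : forall x : nat -> ips_mod,
    (forall e : R, 0 < e -> exists N, forall m n, (N <= m)%N -> (N <= n)%N ->
       complex.Re (ips_form (x m - x n) (x m - x n)) < e) ->
    exists l, forall e : R, 0 < e -> exists N, forall n, (N <= n)%N ->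
       complex.Re (ips_form (l - x n) (l - x n)) < e
}.

(** A copy of the carrier, on which the norm of the form is installed. *)
Definition ips_sort (R : realType) (P : innerProductSpace R) : Type := ips_mod P.

Section HilbertOfInnerProduct.
Variables (R : realType) (P : innerProductSpace R).
Local Notation C := R[i].
Local Notation V := (ips_sort P).

HB.instance Definition _ := GRing.Lmodule.on V.

Definition ips_dot (x y : V) : C := ips_form P x y.

Fact ips_dot_bilinear : bilinear_for *%R (Num.conj \; *%R) ips_dot.
Proof.
by split=> [y a u v|y a u v]; [exact: (linearPl (ips_form P)) | exact: (linearPr (ips_form P))].
Qed.

HB.instance Definition _ := bilinear_isBilinear.Build C V V C
  *%R (Num.conj \; *%R) ips_dot ips_dot_bilinear.
HB.instance Definition _ := isHermitianSesquilinear.Build C V false Num.conj ips_dot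
  (hermitian_subproof (s := ips_form P)).
HB.instance Definition _ := isDotProduct.Build C V ips_dot (@neq0_dnorm_gt0 _ _ _ (ips_form P)).

Definition ips_norm (x : V) : C := sqrtC (ips_dot x x).

Lemma ips_normX x : ips_norm x ^+ 2 = ips_dot x x.
Proof. exact: sqrtCK. Qed.

Lemma ips_norm_ge0 x : 0 <= ips_norm x.
Proof. exact: sqrt_dnorm_ge0. Qed.

Lemma ips_normD x y : ips_norm (x + y) <= ips_norm x + ips_norm y.
Proof.
have nD0 : 0 <= ips_norm x + ips_norm y by rewrite addr_ge0 ?ips_norm_ge0.
rewrite -(@ler_pXn2r _ 2) // ?nnegrE ?ips_norm_ge0 // ips_normX sqrrD !ips_normX.
rewrite dnormD [leLHS]addrAC lerD2r lerD2l.
have h : `|ips_dot x y| <= ips_norm x * ips_norm y.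
  rewrite -(@ler_pXn2r _ 2) // ?nnegrE ?mulr_ge0 ?ips_norm_ge0 //.
  by rewrite exprMn !ips_normX; exact: (dotform_CauchySchwarz ips_dot).
rewrite mulr2n; apply: le_trans (lerD h h).
have -> : ips_dot x y + Num.conj (ips_dot x y) = (2 * complex.Re (ips_dot x y))%:C.
  by case: (ips_dot x y) => a b; apply/eqP; rewrite eq_complex /= subrr eqxx andbT mulr_natl mulr2n.
have := normc_ge_Re (ips_dot x y); rewrite rnormE lecR => h2.
rewrite -rmorphD /= lecR; have := ler_norm (complex.Re (ips_dot x y)); lra.
Qed.

Lemma ips_normZ (a : C) x : ips_norm (a *: x) = `|a| * ips_norm x.
Proof.
apply/eqP; rewrite -(@eqrXn2 _ 2) ?mulr_ge0 ?ips_norm_ge0 //.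
by rewrite exprMn !ips_normX dnormZ.
Qed.

Lemma ips_norm_eq0 x : ips_norm x = 0 -> x = 0.
Proof. by move/eqP; rewrite sqrt_dnorm_eq0 => /eqP. Qed.

HB.instance Definition _ :=
  Lmodule_isNormed.Build C V ips_normD ips_normZ ips_norm_eq0.

Lemma ips_dot_norm (x : V) : ips_dot x x = `|x| ^+ 2.
Proof. by rewrite -ips_normX. Qed.

Lemma ips_rnorm (x : V) : complex.Re (ips_dot x x) = rnorm x ^+ 2.
Proof. by rewrite ips_dot_norm rnormE -rmorphXn. Qed.

Lemma ips_cauchy_cvg (F : set_system V) : ProperFilter F -> cauchy F -> cvg F.
Proof.
move=> FF /cauchyP cF.
have /choice [x hx] : forall n : nat, exists x : V, F [set y | rnorm (x - y) < n.+1%:R^-1].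
  move=> n; have n0 : (0 : C) < (n.+1%:R^-1 : R)%:C by rewrite ltcR invr_gt0.
  have [x Fx] := cF _ n0; exists x; apply: filterS Fx => y.
  by rewrite -ball_normE /ball_ /= rnormE ltcR.
have hxx m n : rnorm (x m - x n) < m.+1%:R^-1 + n.+1%:R^-1.
  have [y [/= h1 h2]] := filter_ex (filterI (hx m) (hx n)).
  by apply: le_lt_trans (rnorm_triangle _ y _) _; rewrite (rnormBC y) ltrD.
have [|l hl] := @ips_complete R P (x : nat -> P).
  move=> e e0; have e2 : 0 < Num.sqrt e / 2 by rewrite divr_gt0 ?sqrtr_gt0.
  have [N hN] := archi_inv e2; exists N => m n Nm Nn.
  rewrite -[X in X < _]/(complex.Re (ips_dot (x m - x n) (x m - x n))) ips_rnorm.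
  rewrite -(sqr_sqrtr (ltW e0)) ltr_pXn2r ?nnegrE ?rnorm_ge0 ?sqrtr_ge0 //.
  apply: lt_trans (hxx m n) _; rewrite [ltRHS]splitr.
  by apply: ltrD; apply: hN.
apply/cvg_ex; exists (l : V); apply/(@cvg_rnormP _ _ _ F FF id) => e e0.
have e2 : 0 < e / 2 by lra.
have [N1 h1] := archi_inv e2.
have [N2 h2] := hl _ (exprn_gt0 2 e2).
pose n := maxn N1 N2.
apply: filterS (hx n) => y /= hy.
have := h2 n (leq_maxr _ _).
rewrite -[X in X < _]/(complex.Re (ips_dot (l - x n) (l - x n))) ips_rnorm.
rewrite ltr_pXn2r ?nnegrE ?rnorm_ge0 ?ltW // => h3.
have := h1 n (leq_maxl _ _).
move=> h4; apply: le_lt_trans (rnorm_triangle (l : V) (x n) y) _; rewrite [ltRHS]splitr.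
exact: ltrD h3 (lt_trans hy h4).
Qed.

HB.instance Definition _ := Uniform_isComplete.Build V ips_cauchy_cvg.

Definition hilbert_of : hilbertType R := Hilbert ips_dot_norm.

End HilbertOfInnerProduct.

(** The axioms are relative to [insub_set], since the form that matters need not
    make sense elsewhere, as for square-summable families among all families. *)
Record innerSubspace (R : realType) (V : lmodType R[i]) := InnerSubspace {
  insub_set : set V ;
  insub_form : V -> V -> R[i] ;
  insub0 : insub_set 0 ;
  insubP : forall a x y, insub_set x -> insub_set y -> insub_set (a *: x + y) ;
  insub_formP : forall a x y z, insub_set x -> insub_set y -> insub_set z ->
    insub_form (a *: x + y) z = a * insub_form x z + insub_form y z ;
  insub_formC : forall x y, insub_set x -> insub_set y ->
    insub_form x y = conjc (insub_form y x) ;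
  insub_form_gt0 : forall x, insub_set x -> x != 0 -> 0 < insub_form x x ;
  insub_complete : forall x : nat -> V, (forall n, insub_set (x n)) ->
    (forall e : R, 0 < e -> exists N, forall m n, (N <= m)%N -> (N <= n)%N ->
       complex.Re (insub_form (x m - x n) (x m - x n)) < e) ->
    exists2 l, insub_set l & forall e : R, 0 < e -> exists N, forall n, (N <= n)%N ->
       complex.Re (insub_form (l - x n) (l - x n)) < e
}.

Section HilbertOfInnerSubspace.
Variables (R : realType) (V : lmodType R[i]) (S : innerSubspace V).
Local Notation C := R[i].

Definition insub_pred : {pred V} := fun x => `[< insub_set S x >].

Fact insub_pred_closed : submod_closed insub_pred.
Proof.
split=> [|a x y /asboolP hx /asboolP hy]; apply/asboolP; first exact: insub0.
exact: insubP.
Qed.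

HB.instance Definition _ := GRing.isSubmodClosed.Build C V insub_pred insub_pred_closed.

Record insub_sort := InSub { insub_val :> V ; _ : insub_val \in insub_pred }.
HB.instance Definition _ := [isSub for insub_val].
HB.instance Definition _ := [Choice of insub_sort by <:].
HB.instance Definition _ := [SubChoice_isSubLmodule of insub_sort by <:].

Lemma insub_valP (x : insub_sort) : insub_set S (insub_val x).
Proof. by case: x => x hx; apply/asboolP. Qed.

Lemma insub_val_linear : linear insub_val.
Proof. by move=> a x y; exact: (linearP (\val : {linear insub_sort -> V})). Qed.

Definition insub_dot (x y : insub_sort) : C := insub_form S (insub_val x) (insub_val y).

Fact insub_dot_bilinear : bilinear_for *%R (Num.conj \; *%R) insub_dot.
Proof.
split=> [y a u v|y a u v].
  by rewrite /insub_dot insub_val_linear insub_formP //; exact: insub_valP.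
rewrite /insub_dot insub_formC ?insub_val_linear ?insub_formP; try exact: insub_valP.
  rewrite rmorphD rmorphM /= -!insub_formC //; exact: insub_valP.
by apply: insubP; exact: insub_valP.
Qed.

HB.instance Definition _ := bilinear_isBilinear.Build C insub_sort insub_sort C
  *%R (Num.conj \; *%R) insub_dot insub_dot_bilinear.

Fact insub_dot_hermitian (x y : insub_sort) :
  insub_dot x y = (-1) ^+ false * Num.conj (insub_dot y x).
Proof. by rewrite expr0 mul1r /insub_dot insub_formC //; exact: insub_valP. Qed.

HB.instance Definition _ := isHermitianSesquilinear.Build C insub_sort false Num.conj
  insub_dot insub_dot_hermitian.

Fact insub_dot_gt0 (x : insub_sort) : x != 0 -> 0 < insub_dot x x.
Proof.
move=> x0; apply: insub_form_gt0; first exact: insub_valP.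
by apply: contra x0 => /eqP hx; apply/eqP/val_inj.
Qed.

HB.instance Definition _ := isDotProduct.Build C insub_sort insub_dot insub_dot_gt0.

Fact insub_dot_complete (x : nat -> insub_sort) :
  (forall e : R, 0 < e -> exists N, forall m n, (N <= m)%N -> (N <= n)%N ->
     complex.Re (insub_dot (x m - x n) (x m - x n)) < e) ->
  exists l, forall e : R, 0 < e -> exists N, forall n, (N <= n)%N ->
     complex.Re (insub_dot (l - x n) (l - x n)) < e.
Proof.
move=> h; have [|l hl ll] := insub_complete (fun n => insub_valP (x n)).
  by move=> e /h [N hN]; exists N => m n Nm Nn; have := hN m n Nm Nn;
     rewrite /insub_dot (linB _ _ insub_val_linear).
have hl' : l \in insub_pred by apply/asboolP.
exists (InSub hl') => e /ll [N hN]; exists N => n /hN.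
by rewrite /insub_dot (linB _ _ insub_val_linear).
Qed.

Definition insub_hilbert : hilbertType R :=
  hilbert_of (@InnerProductSpace R insub_sort insub_dot insub_dot_complete).

Definition insub_inc (x : insub_hilbert) : V := insub_val x.

Lemma insub_inc_linear : linear insub_inc.
Proof. exact: insub_val_linear. Qed.

Lemma insub_incP x : insub_set S (insub_inc x).
Proof. exact: insub_valP. Qed.

Lemma insub_inc_inj : injective insub_inc.
Proof. exact: val_inj. Qed.

Lemma insub_inc_surj v : insub_set S v -> exists x, insub_inc x = v.
Proof. by move=> /asboolP hv; exists (InSub hv). Qed.

End HilbertOfInnerSubspace.

Section SubspaceHilbert.
Variables (R : realType) (K : hilbertType R) (M : set K) (hM : closed_subspace M).

Fact subspace_complete (x : nat -> K) : (forall n, M (x n)) ->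
  (forall e : R, 0 < e -> exists N, forall m n, (N <= m)%N -> (N <= n)%N ->
     complex.Re (dot (x m - x n) (x m - x n)) < e) ->
  exists2 l, M l & forall e : R, 0 < e -> exists N, forall n, (N <= n)%N ->
     complex.Re (dot (l - x n) (l - x n)) < e.
Proof.
move=> Mx hx.
have dlt (u : K) e : 0 < e -> (complex.Re (dot u u) < e ^+ 2) = (rnorm u < e).
  by move=> e0; rewrite dotxx /= ltr_pXn2r ?nnegrE ?rnorm_ge0 // ltW.
have [|l hl] := seq_complete (x := x).
  move=> e e0; have [N hN] := hx _ (exprn_gt0 2 e0); exists N => m n Nm Nn.
  by rewrite -dlt // hN.
exists l; first by case: hM => _ _; apply => e /hl [N hN]; exists (x N) => //; apply: hN.
move=> e e0; have se0 : 0 < Num.sqrt e by rewrite sqrtr_gt0.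
have [N hN] := hl _ se0; exists N => n Nn.
by rewrite -(sqr_sqrtr (ltW e0)) dlt // hN.
Qed.

Definition subspace_inner : innerSubspace K.
Proof.
apply: (@InnerSubspace R K M (@dot R K)).
- by case: hM.
- by case: hM.
- by move=> a x y z _ _ _; rewrite dotDl dotZl.
- by move=> x y _ _; rewrite -dotC.
- by move=> x _; exact: (neq0_dnorm_gt0 (s := hilbert_dot K)).
- exact: subspace_complete.
Defined.

End SubspaceHilbert.

(** * Square-summable families *)

Section UnconditionalSums.
Import finmap.
Variables (R : realType) (I : choiceType).
Local Notation totally := (@summability.totally I).
Local Existing Instance summability.totally_filter.
Implicit Types (g h : I -> R) (A B : {fset I}).

Definition psum g A : R := \sum_(i <- A) g i.

Definition abs_summable g := exists c, forall A, psum (fun i => `|g i|) A <= c.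

(** The limit along the directed set of finite subsets, which makes sums over an
    uncountable index set linear without further ado. *)
Definition tsum g : R := lim (psum g @ totally).

Lemma psum_sub g A B : (forall i, 0 <= g i) -> (A `<=` B)%fset -> psum g A <= psum g B.
Proof.
move=> g0 AB; rewrite /psum [leRHS](big_fsetID _ (mem A)) /=.
have -> : [fset x in B | x \in A]%fset = A.
  by apply/fsetP => i; rewrite !inE /= andbC; case: (boolP (i \in A)) => // /(fsubsetP AB) ->.
by rewrite lerDl sumr_ge0.
Qed.

Lemma psumD g h A : psum (fun i => g i + h i) A = psum g A + psum h A.
Proof. exact: big_split. Qed.

Lemma psumZ a g A : psum (fun i => a * g i) A = a * psum g A.
Proof. by rewrite /psum mulr_sumr. Qed.

Lemma ler_psum g h A : (forall i, g i <= h i) -> psum g A <= psum h A.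
Proof. by move=> gh; apply: ler_sum. Qed.

Lemma psum_cvg_ge0 g : (forall i, 0 <= g i) -> (exists c, forall A, psum g A <= c) ->
  cvg (psum g @ totally).
Proof.
move=> g0 [c hc]; pose D := range (psum g).
have hD : has_sup D.
  split; first by exists (psum g fset0%fset); exists fset0%fset.
  by exists c => _ [A _ <-].
apply/cvg_ex; exists (sup D); apply/cvgrPdist_lt => e e0.
have [_ [A _ <-] hA] := sup_adherent e0 hD.
exists A => // B /= AB.
have h1 := psum_sub g0 AB.
have h2 : psum g B <= sup D by apply: ub_le_sup; [case: hD | exists B].
rewrite ger0_norm ?subr_ge0 //; lra.
Qed.

(** Both [g + |g|] and [|g|] are nonnegative with bounded partial sums. *)
Lemma abs_summable_cvg g : abs_summable g -> cvg (psum g @ totally).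
Proof.
move=> [c hc].
have h1 : cvg (psum (fun i => `|g i|) @ totally) by apply: psum_cvg_ge0 => //; exists c.
have h2 : cvg (psum (fun i => g i + `|g i|) @ totally).
  apply: psum_cvg_ge0.
    by move=> i; have := ler_norm (- g i); rewrite normrN; lra.
  exists (2 * c) => A; apply: le_trans (_ : psum (fun i => 2 * `|g i|) A <= _).
    by apply: ler_psum => i; have := ler_norm (g i); lra.
  by rewrite psumZ ler_pM2l.
have -> : psum g = (fun A => psum (fun i => g i + `|g i|) A - psum (fun i => `|g i|) A).
  by apply/funext => A; rewrite psumD addrK.
exact: is_cvgB h2 h1.
Qed.

Lemma tsumD g h : abs_summable g -> abs_summable h ->
  tsum (fun i => g i + h i) = tsum g + tsum h.
Proof.
move=> hg hh; rewrite /tsum.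
rewrite (_ : psum _ = (fun A => psum g A + psum h A)); last by apply/funext => A; rewrite psumD.
apply: cvg_lim => //; apply: cvgD; exact: abs_summable_cvg.
Qed.

Lemma tsumZ a g : abs_summable g -> tsum (fun i => a * g i) = a * tsum g.
Proof.
move=> hg; rewrite /tsum.
rewrite (_ : psum _ = (fun A => a * psum g A)); last by apply/funext => A; rewrite psumZ.
by apply: cvg_lim => //; apply: cvgM; [exact: cvg_cst | exact: abs_summable_cvg].
Qed.

Lemma psum_le_tsum g A : (forall i, 0 <= g i) -> abs_summable g -> psum g A <= tsum g.
Proof.
move=> g0 hg; apply: limr_ge; first exact: abs_summable_cvg.
by exists A => // B /= AB; apply: psum_sub.
Qed.

Lemma tsum_le g c : abs_summable g -> (forall A, psum g A <= c) -> tsum g <= c.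
Proof.
move=> hg hc; apply: limr_le; first exact: abs_summable_cvg.
by exists fset0%fset.
Qed.

Lemma tsum_support g A : (forall i, i \notin A -> g i = 0) -> tsum g = psum g A.
Proof.
move=> gA; apply: lim_near_cst => //; exists A => // B /= AB.
rewrite /psum (big_fsetID _ (mem A)) /= [X in _ + X]big1_fset.
  rewrite addr0; congr (bigop _ _ _); congr enum_fset.
  by apply/fsetP => i; rewrite !inE /= andbC; case: (boolP (i \in A)) => // /(fsubsetP AB) ->.
by move=> i; rewrite !inE /= => /andP[_ /gA ->].
Qed.

Lemma abs_summable_le g h : (forall i, `|g i| <= h i) -> (exists c, forall A, psum h A <= c) ->
  abs_summable g.
Proof.
by move=> gh [c hc]; exists c => A; apply: le_trans (hc A); apply: ler_psum.
Qed.

End UnconditionalSums.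

Section SquareSummable.
Import finmap.
Variables (R : realType) (I : choiceType) (K : hilbertType R).
Local Notation C := R[i].
Local Notation V := (I -> K).
Implicit Types (f g h : V) (A : {fset I}).

Definition sqnorm f : I -> R := fun i => rnorm (f i) ^+ 2.

Definition square_summable f := exists c, forall A, psum (sqnorm f) A <= c.

Lemma sqnorm_ge0 f i : 0 <= sqnorm f i. Proof. exact: sqr_ge0. Qed.

Lemma square_summable_abs f : square_summable f -> abs_summable (sqnorm f).
Proof.
by move=> hf; apply: abs_summable_le hf => i; rewrite ger0_norm // sqnorm_ge0.
Qed.

Lemma sqnormD_le f g i : sqnorm (fun i => f i + g i) i <= 2 * sqnorm f i + 2 * sqnorm g i.
Proof. by rewrite /sqnorm -parallelogram lerDl sqr_ge0. Qed.

Lemma sqnormZ a f i : sqnorm (fun i => a *: f i) i = rnorm a ^+ 2 * sqnorm f i.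
Proof. by rewrite /sqnorm rnormZ exprMn. Qed.

Lemma square_summableP a f g : square_summable f -> square_summable g ->
  square_summable (a *: f + g).
Proof.
move=> [c hc] [d hd]; exists (2 * (rnorm a ^+ 2 * c) + 2 * d) => A.
apply: (@le_trans _ _ (psum (fun i => 2 * (rnorm a ^+ 2 * sqnorm f i) + 2 * sqnorm g i) A)).
  by apply: ler_psum => i; rewrite -sqnormZ; exact: sqnormD_le.
rewrite psumD !psumZ; apply: lerD; rewrite ler_pM2l //.
by apply: ler_wpM2l; rewrite ?sqr_ge0.
Qed.

Lemma square_summable0 : square_summable 0.
Proof.
by exists 0 => A; rewrite /psum big1 // => i _; rewrite /sqnorm rnorm0 expr0n.
Qed.

Lemma rnorm_dot_le (x y : K) : rnorm (dot x y) <= rnorm x ^+ 2 + rnorm y ^+ 2.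
Proof.
apply: le_trans (CauchySchwarz x y) _; have := sqr_ge0 (rnorm x - rnorm y).
have := rnorm_ge0 x; have := rnorm_ge0 y; nra.
Qed.

Lemma dot_abs_summable (p : C -> R) f g : (forall z, `|p z| <= rnorm z) ->
  square_summable f -> square_summable g -> abs_summable (fun i => p (dot (f i) (g i))).
Proof.
move=> hp [c hc] [d hd]; apply: (@abs_summable_le _ _ _ (fun i => sqnorm f i + sqnorm g i)).
  by move=> i; apply: le_trans (hp _) (rnorm_dot_le _ _).
by exists (c + d) => A; rewrite psumD lerD.
Qed.

Lemma Re_summable f g : square_summable f -> square_summable g ->
  abs_summable (fun i => complex.Re (dot (f i) (g i))).
Proof. by apply: dot_abs_summable => z; exact: ler_Re. Qed.

Lemma Im_summable f g : square_summable f -> square_summable g ->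
  abs_summable (fun i => complex.Im (dot (f i) (g i))).
Proof. by apply: dot_abs_summable => z; exact: ler_Im. Qed.

Lemma abs_summableZ (a : R) (u : I -> R) : abs_summable u -> abs_summable (fun i => a * u i).
Proof.
move=> [c hc]; exists (`|a| * c) => A.
apply: le_trans (_ : psum (fun i => `|a| * `|u i|) A <= _).
  by apply: ler_psum => i; rewrite normrM.
by rewrite psumZ ler_wpM2l.
Qed.

Lemma abs_summableD (u v : I -> R) : abs_summable u -> abs_summable v ->
  abs_summable (fun i => u i + v i).
Proof.
move=> [c hc] [d hd]; apply: (@abs_summable_le _ _ _ (fun i => `|u i| + `|v i|)).
  by move=> i; exact: ler_normD.
by exists (c + d) => A; rewrite psumD lerD.
Qed.

(** Real and imaginary parts are summed separately, so that sums of reals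
    suffice. *)
Definition l2_form f g : C :=
  tsum (fun i => complex.Re (dot (f i) (g i))) +i* tsum (fun i => complex.Im (dot (f i) (g i))).

Fact l2_formP a f g h : square_summable f -> square_summable g -> square_summable h ->
  l2_form (a *: f + g) h = a * l2_form f h + l2_form g h.
Proof.
move=> hf hg hh; case: a => a b; rewrite /l2_form /=.
have [[[Rf If] Rg] Ig] :=
  (Re_summable hf hh, Im_summable hf hh, Re_summable hg hh, Im_summable hg hh).
have -> : (fun i => complex.Re (dot (((a +i* b) *: f + g) i) (h i))) =
    (fun i => (a * complex.Re (dot (f i) (h i)) + (- b) * complex.Im (dot (f i) (h i)))
              + complex.Re (dot (g i) (h i))).
  apply/funext => i; rewrite [_ i]/((a +i* b) *: f i + g i) dotDl dotZl.
  by case: (dot (f i) _) => u v; case: (dot (g i) _) => w z /=; ring.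
have -> : (fun i => complex.Im (dot (((a +i* b) *: f + g) i) (h i))) =
    (fun i => (a * complex.Im (dot (f i) (h i)) + b * complex.Re (dot (f i) (h i)))
              + complex.Im (dot (g i) (h i))).
  apply/funext => i; rewrite [_ i]/((a +i* b) *: f i + g i) dotDl dotZl.
  by case: (dot (f i) _) => u v; case: (dot (g i) _) => w z /=; ring.
rewrite !tsumD ?tsumZ //; do ?[exact: abs_summableD | exact: abs_summableZ].
- by apply/eqP; rewrite eq_complex /= mulNr !eqxx.
- by apply: abs_summableD; exact: abs_summableZ.
- by apply: abs_summableD; exact: abs_summableZ.
Qed.

Fact l2_formC f g : square_summable f -> square_summable g ->
  l2_form f g = conjc (l2_form g f).
Proof.
move=> hf hg; rewrite /l2_form /=.
have -> : (fun i => complex.Re (dot (f i) (g i))) = (fun i => complex.Re (dot (g i) (f i))).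
  by apply/funext => i; rewrite dotC; case: (dot _ _).
have -> : (fun i => complex.Im (dot (f i) (g i))) = (fun i => -1 * complex.Im (dot (g i) (f i))).
  by apply/funext => i; rewrite dotC mulN1r; case: (dot _ _).
by rewrite tsumZ ?mulN1r //; exact: Im_summable.
Qed.

Lemma l2_formxx f : l2_form f f = (tsum (sqnorm f))%:C.
Proof.
rewrite /l2_form.
have -> : (fun i => complex.Re (dot (f i) (f i))) = sqnorm f.
  by apply/funext => i; rewrite dotxx.
have -> : (fun i => complex.Im (dot (f i) (f i))) = cst 0.
  by apply/funext => i; rewrite dotxx.
by rewrite [tsum (cst 0)](@tsum_support _ _ _ fset0%fset) // /psum big_seq_fset0.
Qed.

Lemma sqnorm_le_tsum f i : square_summable f -> sqnorm f i <= tsum (sqnorm f).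
Proof.
move=> hf; apply: le_trans (psum_le_tsum [fset i]%fset (sqnorm_ge0 f) (square_summable_abs hf)).
by rewrite /psum big_seq_fset1.
Qed.

Fact l2_form_gt0 f : square_summable f -> f != 0 -> 0 < l2_form f f.
Proof.
move=> hf f0; rewrite l2_formxx ltcR.
have [i fi] : exists i, f i <> 0.
  apply: contrapT => h; move/eqP: f0; apply; apply/funext => i.
  by apply: contrapT => fi; apply: h; exists i.
apply: lt_le_trans (sqnorm_le_tsum i hf).
rewrite /sqnorm lt_neqAle sqr_ge0 andbT eq_sym sqrf_eq0.
by apply/eqP => /rnorm_eq0.
Qed.

Lemma tsum_sqnorm_lt f e : tsum (sqnorm f) < e -> square_summable f ->
  forall A, psum (sqnorm f) A <= e.
Proof.
move=> h hf A; apply: le_trans (ltW h).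
by apply: psum_le_tsum; [exact: sqnorm_ge0 | exact: square_summable_abs].
Qed.

Lemma square_summableB f g : square_summable f -> square_summable g -> square_summable (f - g).
Proof. by move=> hf hg; rewrite addrC -scaleN1r; exact: square_summableP. Qed.

Lemma rnorm_cvg (u : nat -> K) l z : (forall e : R, 0 < e -> exists N, forall n, (N <= n)%N ->
  rnorm (l - u n) < e) -> (fun n => rnorm (u n - z)) @ \oo --> rnorm (l - z).
Proof.
move=> hu; apply/cvgrPdist_lt => e /hu [N hN]; exists N => // n /= /hN; apply: le_lt_trans.
have := rnorm_triangle l (u n) z; have := rnorm_triangle (u n) l z.
rewrite (rnormBC (u n) l) ler_norml => h1 h2; apply/andP; split; lra.
Qed.

(** The limit is taken coordinatewise; bounds on finite partial sums survive it. *)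
Fact l2_complete (x : nat -> V) : (forall n, square_summable (x n)) ->
  (forall e : R, 0 < e -> exists N, forall m n, (N <= m)%N -> (N <= n)%N ->
     complex.Re (l2_form (x m - x n) (x m - x n)) < e) ->
  exists2 l, square_summable l & forall e : R, 0 < e -> exists N, forall n, (N <= n)%N ->
     complex.Re (l2_form (l - x n) (l - x n)) < e.
Proof.
move=> sx hx.
have sxx m n : square_summable (x m - x n) by exact: square_summableB.
have hx' e : 0 < e -> exists N, forall m n, (N <= m)%N -> (N <= n)%N ->
    tsum (sqnorm (x m - x n)) < e.
  by move=> /hx [N hN]; exists N => m n Nm Nn; have := hN m n Nm Nn; rewrite l2_formxx.
have /choice [l hl] : forall i, exists l, forall e : R, 0 < e -> exists N, forall n, (N <= n)%N ->
    rnorm (l - x n i) < e.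
  move=> i; apply: seq_complete => e e0; have [N hN] := hx' _ (exprn_gt0 2 e0).
  exists N => m n Nm Nn; rewrite -(@ltr_pXn2r _ 2) ?nnegrE ?rnorm_ge0 ?ltW //.
  by apply: le_lt_trans (sqnorm_le_tsum i (sxx m n)) (hN m n Nm Nn).
have hlx e : 0 < e -> exists N, forall n, (N <= n)%N ->
    forall A, psum (sqnorm (l - x n)) A <= e.
  move=> e0; have [N hN] := hx' _ e0; exists N => n Nn A.
  have cv : (fun m => psum (sqnorm (x m - x n)) A) @ \oo --> psum (sqnorm (l - x n)) A.
    rewrite /psum; apply: cvg_big => [|i _]; first exact: add_continuous.
    by rewrite /sqnorm; apply: cvgM; exact: rnorm_cvg (hl i).
  rewrite -(cvg_lim _ cv) //; apply: limr_le; first by apply/cvg_ex; eexists; exact: cv.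
  exists N => // m /= Nm; apply: tsum_sqnorm_lt => //; exact: hN.
have [N1 hN1] := hlx _ ltr01.
have slx n : (N1 <= n)%N -> square_summable (l - x n) by exists 1 => A; exact: hN1.
have sl : square_summable l.
  rewrite -(subrK (x N1) l) -[l - _]scale1r; apply: square_summableP => //.
  exact: slx.
exists l => // e e0; have e2 : 0 < e / 2 by rewrite divr_gt0.
have [N2 hN2] := hlx _ e2; exists N2 => n Nn; rewrite l2_formxx /=.
apply: le_lt_trans (_ : e / 2 < e); last by rewrite ltr_pdivrMr // ltr_pMr // ltr1n.
apply: tsum_le; last exact: hN2.
by apply: square_summable_abs; exact: square_summableB.
Qed.

Definition l2_inner : innerSubspace V :=
  InnerSubspace square_summable0 square_summableP l2_formP l2_formC l2_form_gt0 l2_complete.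

Definition l2 : hilbertType R := insub_hilbert l2_inner.

Definition l2_val (x : l2) : V := insub_inc x.

Lemma l2_valP a (x y : l2) i : l2_val (a *: x + y) i = a *: l2_val x i + l2_val y i.
Proof. by rewrite /l2_val insub_inc_linear. Qed.

Lemma l2_ext (x y : l2) : (forall i, l2_val x i = l2_val y i) -> x = y.
Proof. by move=> h; apply: insub_inc_inj; apply/funext. Qed.

Lemma l2_square_summable (x : l2) : square_summable (l2_val x).
Proof. exact: (@insub_incP _ _ l2_inner x). Qed.

Lemma l2_exists f : square_summable f -> exists x : l2, l2_val x = f.
Proof. exact: (@insub_inc_surj _ _ l2_inner f). Qed.

Lemma dot_l2 (x y : l2) : dot x y = l2_form (l2_val x) (l2_val y).
Proof. by []. Qed.

Lemma dot_l2_support (x y : l2) A :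
  (forall i, i \notin A -> l2_val x i = 0 \/ l2_val y i = 0) ->
  dot x y = \sum_(i <- A) dot (l2_val x i) (l2_val y i).
Proof.
move=> h; rewrite dot_l2 /l2_form.
rewrite !(@tsum_support _ _ _ A); first last.
- by move=> i /h [->|->]; rewrite ?dot0l ?dot0r.
- by move=> i /h [->|->]; rewrite ?dot0l ?dot0r.
rewrite /psum; apply/eqP; rewrite eq_complex /=.
by rewrite (raddf_sum (@complex.Re R : Rcomplex R -> R))
  (raddf_sum (@complex.Im R : Rcomplex R -> R)) !eqxx.
Qed.

End SquareSummable.

(** * Unitary representations *)

Section TopologicalGroup.
Variable G : lcGroupType.
Local Open Scope group_scope.

Lemma lcg_mull_continuous (a : G) : continuous (fun s : G => a * s).
Proof.
move=> s; apply: (continuous_comp (f := fun s : G => (a, s)) (g := fun p : G * G => p.1 * p.2)).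
  by apply: cvg_pair; [exact: cvg_cst | exact: cvg_id].
exact: lcg_mul_continuous.
Qed.

Lemma lcg_mulr_continuous (a : G) : continuous (fun s : G => s * a).
Proof.
move=> s; apply: (continuous_comp (f := fun s : G => (s, a)) (g := fun p : G * G => p.1 * p.2)).
  by apply: cvg_pair; [exact: cvg_id | exact: cvg_cst].
exact: lcg_mul_continuous.
Qed.

End TopologicalGroup.

Section Representations.
Variables (R : realType) (G : lcGroupType).
Local Notation C := R[i].

Section Basics.
Variables (K : hilbertType R) (rho : unirep G K).

Lemma rep_linear s : linear (rho s).
Proof. by move=> a x y; exact: linearP. Qed.

Lemma rep1E x : rho 1%g x = x.
Proof. by rewrite rep1. Qed.

Lemma repME s t x : rho (s * t)%g x = rho s (rho t x).
Proof. by rewrite repM. Qed.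

Lemma repKV s x : rho s (rho s^-1%g x) = x.
Proof. by rewrite -repME mulgV rep1E. Qed.

Lemma rep_adj s x y : dot (rho s x) y = dot x (rho s^-1%g y).
Proof. by rewrite -[in LHS](repKV s y) rep_unitary. Qed.

Lemma rep_norm s x : rnorm (rho s x) = rnorm x.
Proof.
by apply: rnorm_dot_eq; rewrite rep_unitary.
Qed.

End Basics.

(** Strong continuity of a unitary representation need only be checked at the
    identity and on a total set of vectors, since the vectors at which it holds
    form a closed subspace. *)
Lemma unirep_exists (K : hilbertType R) (f : G -> K -> K) :
  (forall s, linear (f s)) -> (forall x, f 1%g x = x) ->
  (forall s t x, f (s * t)%g x = f s (f t x)) ->
  (forall s x y, dot (f s x) (f s y) = dot x y) ->
  (forall z, (forall y, (forall e : R, 0 < e -> \forall s \near (1%g : G), rnorm (f s y - y) < e) ->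
     dot z y = 0) -> z = 0) ->
  exists rho : unirep G K, forall s x, rho s x = f s x.
Proof.
move=> fl f1 fM fu ftot.
pose Q := [set y : K | forall e : R, 0 < e -> \forall s \near (1%g : G), rnorm (f s y - y) < e].
have fn s x : rnorm (f s x) = rnorm x.
  by apply: rnorm_dot_eq; rewrite fu.
have hQ : closed_subspace Q.
  split.
  - move=> e e0; near=> s; by rewrite (lin0 (fl s)) subrr rnorm0.
  - move=> a x y Qx Qy e e0; have e2 : 0 < e / 2 by rewrite divr_gt0.
    have a0 : 0 < rnorm a + 1 by rewrite ltr_wpDl ?rnorm_ge0.
    have h1 := Qx _ (divr_gt0 e2 a0); have h2 := Qy _ e2.
    near=> s; rewrite fl opprD addrACA -scalerBr.
    apply: le_lt_trans (rnormD _ _) _; rewrite [ltRHS]splitr rnormZ.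
    apply: ler_ltD; last by near: s.
    apply: (@le_trans _ _ ((rnorm a + 1) * rnorm (f s x - x))).
      by rewrite ler_wpM2r ?rnorm_ge0 // lerDl.
    rewrite mulrC -ler_pdivlMr //; apply: ltW; near: s; exact: h1.
  - move=> x h e e0; have e3 : 0 < e / 3 by rewrite divr_gt0.
    have [y Qy hy] := h _ e3; have h1 := Qy _ e3.
    near=> s; have h2 : rnorm (f s y - y) < e / 3 by near: s.
    have h3 : rnorm (f s x - f s y) < e / 3 by rewrite -(linB _ _ (fl s)) fn.
    have := rnorm_triangle (f s x) (f s y) x; have := rnorm_triangle (f s y) y x.
    rewrite (rnormBC y x); lra.
have Qall : forall x, Q x by apply: closed_subspace_total.
have fc x : continuous (fun s => f s x).
  move=> s0; apply/cvg_rnormP => e e0.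
  have hc : (fun s => s0^-1%g * s)%g @ s0 --> (1%g : G).
    by rewrite -(mulVg s0); exact: lcg_mull_continuous.
  have : \forall s \near s0, rnorm (f (s0^-1 * s)%g x - x) < e := hc _ (Qall x e e0).
  apply: filterS => s /= hs.
  by rewrite rnormBC -(fn s0^-1%g) (linB _ _ (fl _)) -!fM mulVg f1.
pose F s : {linear K -> K} := HB.pack (f s) (GRing.isLinear.Build C K K *:%R (f s) (fl s)).
have F1 : F 1%g = idfun :> (K -> K) by apply/funext => x; exact: f1.
have FM s t : F (s * t)%g = F s \o F t :> (K -> K) by apply/funext => x; exact: fM.
by exists (@Unirep R G K F F1 FM fu fc).
Unshelve. all: by end_near.
Qed.

Section Subrepresentation.
Variables (K : hilbertType R) (rho : unirep G K) (M : set K).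
Hypotheses (hM : closed_subspace M) (invM : forall s x, M x -> M (rho s x)).
Local Notation KM := (insub_hilbert (subspace_inner hM)).

(** The restriction inherits its continuity from [rho]. *)
Lemma subrep_exists : exists rhoM : unirep G KM,
  forall s x, insub_inc (rhoM s x) = rho s (insub_inc x).
Proof.
have /choice [f hf] : forall sx : G * KM, exists y : KM, insub_inc y = rho sx.1 (insub_inc sx.2).
  move=> [s x]; apply: insub_inc_surj; apply: invM; exact: (@insub_incP _ _ (subspace_inner hM)).
pose g s x := f (s, x).
have gE s x : insub_inc (g s x) = rho s (insub_inc x) by rewrite hf.
have inj := @insub_inc_inj _ _ (subspace_inner hM).
have il := @insub_inc_linear _ _ (subspace_inner hM).
have dE (x y : KM) : dot x y = dot (insub_inc x) (insub_inc y) by [].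
have nE (x : KM) : rnorm x = rnorm (insub_inc x).
  exact: rnorm_dot_eq.
have [|||||rhoM h] := @unirep_exists KM g.
- by move=> s a x y; apply: inj; rewrite gE !il !gE rep_linear.
- by move=> x; apply: inj; rewrite gE rep1E.
- by move=> s t x; apply: inj; rewrite !gE repME.
- by move=> s x y; rewrite !dE !gE rep_unitary.
- move=> z hz; apply/dotxx_eq0/hz => e e0.
  have /cvg_rnormP /(_ e e0) := @rep_continuous _ _ _ rho (insub_inc z) 1%g.
  apply: filterS => s; rewrite rep1E rnormBC => h; rewrite nE.
  by rewrite (linB _ _ il) gE.
- by exists rhoM => s x; rewrite h gE.
Qed.

End Subrepresentation.

End Representations.

(** * The Fourier-Stieltjes norm and functionals on the algebra *)

Section FourierStieltjes.
Variables (R : realType) (G : lcGroupType).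
Local Notation C := R[i].
Implicit Types u v : G -> C.

Lemma BG_coef (K : hilbertType R) (rho : unirep G K) xi eta : BG (coef rho xi eta).
Proof. by exists K, rho, xi, eta. Qed.

Lemma BG_norm_coef (K : hilbertType R) (rho : unirep G K) xi eta :
  BG_norm (coef rho xi eta) <= rnorm xi * rnorm eta.
Proof.
apply: ge_inf; last by exists K, rho, xi, eta.
by exists 0 => _ [K' [rho' [x [y [_ ->]]]]]; rewrite mulr_ge0 ?rnorm_ge0.
Qed.

Lemma BG_norm_ge0 u : 0 <= BG_norm u.
Proof.
rewrite /BG_norm; set D := [set r | _].
have [->|/set0P h] := eqVneq D set0.
  by rewrite inf0.
by apply: lb_le_inf => // _ [K' [rho' [x [y [_ ->]]]]]; rewrite mulr_ge0 ?rnorm_ge0.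
Qed.

(** The infimum that defines the norm transports bounds that hold for every
    realization of [u] as a coefficient function. *)
Lemma le_BG_norm u r c : BG u -> 0 <= c ->
  (forall (K : hilbertType R) (rho : unirep G K) xi eta, u = coef rho xi eta ->
     r <= c * (rnorm xi * rnorm eta)) ->
  r <= c * BG_norm u.
Proof.
move=> [K0 [rho0 [x0 [y0 u0]]]] c0 h.
have [c00|cn0] := eqVneq c 0.
  by have := h _ _ _ _ u0; rewrite c00 !mul0r.
have cp : 0 < c by rewrite lt_neqAle eq_sym cn0.
rewrite mulrC -ler_pdivrMr //; apply: lb_le_inf.
  by exists (rnorm x0 * rnorm y0), K0, rho0, x0, y0.
move=> _ [K [rho [x [y [hu ->]]]]]; rewrite ler_pdivrMr // mulrC.
exact: h hu.
Qed.

Lemma coefDl (K : hilbertType R) (rho : unirep G K) a x x' y s :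
  coef rho (a *: x + x') y s = a * coef rho x y s + coef rho x' y s.
Proof. by rewrite /coef (rep_linear rho) dotDl dotZl. Qed.

Lemma coefDr (K : hilbertType R) (rho : unirep G K) a x y y' s :
  coef rho x (a *: y + y') s = conjc a * coef rho x y s + coef rho x y' s.
Proof. by rewrite /coef dotDr dotZr. Qed.

Lemma BG_norm0 : BG (fun _ : G => 0 : C) -> BG_norm (fun _ : G => 0 : C) = 0.
Proof.
move=> [K [rho [x [y h]]]]; apply/eqP; rewrite eq_le BG_norm_ge0 andbT.
have -> : (fun=> 0) = coef rho 0 y.
  by apply/funext => s; rewrite /coef (lin0 (rep_linear rho s)) dot0l.
by apply: le_trans (BG_norm_coef _ _ _) _; rewrite rnorm0 mul0r.
Qed.

Lemma BG_self (S : set (G -> C)) u : S u -> BG u -> BG_closure S u.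
Proof.
move=> Su [K [rho [x [y h]]]]; split; first by exists K, rho, x, y.
have uu : u \- u = coef rho 0 y.
  by apply/funext => s; rewrite /coef (lin0 (rep_linear rho s)) dot0l /= subrr.
have bu : BG (u \- u) by rewrite uu; exact: BG_coef.
move=> e e0; exists u => //; split => //.
rewrite (_ : u \- u = fun=> 0) in bu *; last by apply/funext => s /=; rewrite subrr.
by rewrite BG_norm0.
Qed.

Lemma A_coef (K : hilbertType R) (rho : unirep G K) xi eta : A_ rho (coef rho xi eta).
Proof.
apply: BG_self; last exact: BG_coef.
exists 1%N, (fun=> 1), (fun=> xi), (fun=> eta); apply/funext => s.
by rewrite big_ord1 mul1r.
Qed.

Lemma A_BG (K : hilbertType R) (rho : unirep G K) u : A_ rho u -> BG u.
Proof. by case. Qed.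

Section Subalgebra.
Variables (K : hilbertType R) (pi : unirep G K).
Hypothesis hA : closed_invariant_subalgebra (A_ pi).
Local Notation A := (A_ pi).

Lemma A_zero : A (fun=> 0). Proof. by case: hA => _ []. Qed.

Lemma A_lin a u v : A u -> A v -> A (fun s => a * u s + v s).
Proof. by case: hA => _ [_ +] _ _; apply. Qed.

Lemma A_transl t u : A u -> A (fun s => u (t * s)%g).
Proof. by case: hA => _ _ _ h /(h t) []. Qed.

Lemma A_transr t u : A u -> A (fun s => u (s * t)%g).
Proof. by case: hA => _ _ _ h /(h t) []. Qed.

Lemma A_closed u : BG_closure A u -> A u.
Proof. by case: hA => -[_ +] _ _ _; apply. Qed.

Lemma A_sub u v : A u -> A v -> A (u \- v).
Proof.
move=> hu hv; have := A_lin (-1) hv hu; congr A.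
by apply/funext => s /=; rewrite mulN1r addrC.
Qed.

Lemma A_span u : coef_span pi u -> A u.
Proof.
move=> [n [c [xi [eta ->]]]]; elim: n => [|n IH] in c xi eta *.
  by rewrite (_ : (fun _ => _) = fun=> 0); [exact: A_zero | apply/funext => s; rewrite big_ord0].
rewrite (_ : (fun _ => _) = fun s => c ord0 * coef pi (xi ord0) (eta ord0) s
   + \sum_(i < n) c (lift ord0 i) * coef pi (xi (lift ord0 i)) (eta (lift ord0 i)) s).
  by apply: A_lin; [exact: A_coef | exact: IH].
by apply/funext => s; rewrite big_ord_recl.
Qed.

Definition A_functional (phi : (G -> C) -> C) : Prop :=
  (forall (a : C) u v, A u -> A v -> phi (fun s => a * u s + v s) = a * phi u + phi v) /\
  exists M : R, forall u, A u -> rnorm (phi u) <= M * BG_norm u.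

(** The span of the coefficient functions of [pi] is dense, and differences of
    elements of the algebra stay in it. *)
Lemma A_functional_ext phi psi : A_functional phi -> A_functional psi ->
  (forall xi eta, phi (coef pi xi eta) = psi (coef pi xi eta)) ->
  forall u, A u -> phi u = psi u.
Proof.
move=> hphi hpsi h u Au; have [phil [M hM]] := hphi; have [psil [N hN]] := hpsi.
have lin0 f : A_functional f -> f (fun=> 0) = 0.
  move=> [fl _]; have := fl (-1) _ _ A_zero A_zero.
  by rewrite mulr0 addr0 mulN1r addNr.
have hspan v : coef_span pi v -> phi v = psi v.
  move=> [n [c [xi [eta ->]]]]; elim: n => [|n IH] in c xi eta *.
    rewrite (_ : (fun _ => _) = fun=> 0); last by apply/funext => s; rewrite big_ord0.
    by rewrite !lin0.
  rewrite (_ : (fun _ => _) = fun s => c ord0 * coef pi (xi ord0) (eta ord0) s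
     + \sum_(i < n) c (lift ord0 i) * coef pi (xi (lift ord0 i)) (eta (lift ord0 i)) s).
    have A2 : A (fun s => \sum_(i < n)
        c (lift ord0 i) * coef pi (xi (lift ord0 i)) (eta (lift ord0 i)) s).
      by apply: A_span; exists n, (c \o lift ord0), (xi \o lift ord0), (eta \o lift ord0).
    rewrite phil ?psil //; try exact: A_coef.
    by rewrite h; congr (_ + _); exact: (IH (c \o lift ord0) (xi \o lift ord0) (eta \o lift ord0)).
  by apply/funext => s; rewrite big_ord_recl.
apply/subr0_eq/rnorm_eq0/eqP; rewrite eq_le rnorm_ge0 andbT.
apply/ler_addgt0Pr => e e0; rewrite add0r.
have c0 : 0 < `|M| + `|N| + 1 by rewrite ltr_wpDl // addr_ge0.
have [_ /(_ _ (divr_gt0 e0 c0)) [v Sv [_ hv]]] := Au.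
have Av := A_span Sv; have Auv := A_sub Au Av.
have dif f : A_functional f -> f u = f v + f (u \- v).
  move=> [fl _]; have := fl 1 _ _ Auv Av; rewrite mul1r addrC => <-.
  by congr f; apply/funext => s /=; rewrite mul1r subrK.
rewrite (dif phi) // (dif psi) // hspan //.
rewrite opprD addrACA subrr add0r.
apply: le_trans (rnormD _ _) _; rewrite rnormN.
move: hv; rewrite ltr_pdivlMr // => hv; apply: le_trans (ltW hv).
have n0 := BG_norm_ge0 (u \- v).
apply: le_trans (lerD (hM _ Auv) (hN _ Auv)) _.
have := ler_wpM2r n0 (ler_norm M); have := ler_wpM2r n0 (ler_norm N); nra.
Qed.

Lemma represents_functional T phi : represents pi T phi -> A_functional phi.
Proof. by case. Qed.

Lemma represents_unique T phi psi u : represents pi T phi -> represents pi T psi ->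
  A u -> phi u = psi u.
Proof.
move=> h1 h2; apply: A_functional_ext;
  [exact: represents_functional h1 | exact: represents_functional h2 |].
by move=> xi eta; case: h1 => _ _ ->; case: h2 => _ _ ->.
Qed.

(** The choice made in [pairing] does not matter, by uniqueness. *)
Lemma pairingE T phi u : represents pi T phi -> A u -> pairing pi T u = phi u.
Proof.
move=> h Au; rewrite /pairing; case: xgetP => [c _ [psi h2 ->]|hn].
  exact: represents_unique h2 h Au.
by case: (hn (phi u)); exists phi.
Qed.

Lemma pairing_represents T phi : represents pi T phi -> represents pi T (pairing pi T).
Proof.
move=> h; have [h1 [M h2] h3] := h; split.
- by move=> a u v Au Av; rewrite !(pairingE h) //; [exact: h1 | exact: A_lin].
- by exists M => u Au; rewrite (pairingE h) //; exact: h2.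
- by move=> xi eta; rewrite (pairingE h) ?h3 //; exact: A_coef.
Qed.

(** The default value of [pairing] is [0], whereas a point of the spectrum does not
    annihilate the algebra; hence some functional represents it. *)
Lemma spectrum_represents T : spectrum pi T -> represents pi T (pairing pi T).
Proof.
move=> [_ [u Au hu] _].
have [[phi h]|hn] := pselect (exists phi, represents pi T phi).
  exact: pairing_represents h.
case/eqP: hu; rewrite /pairing; case: xgetP => // c _ [phi h _].
by case: hn; exists phi.
Qed.

End Subalgebra.

End FourierStieltjes.

(** * Monomial representations *)

Section L2Delta.
Import finmap.
Variables (R : realType) (I : choiceType) (K : hilbertType R).
Local Notation C := R[i].
Local Notation l2K := (l2 I K).

Lemma square_summable_delta (i : I) (v : K) :
  square_summable (fun j => if j == i then v else 0).
Proof.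
exists (rnorm v ^+ 2) => A.
have [iA|iA] := boolP (i \in A).
  rewrite /psum (big_fsetD1 i) //= /sqnorm eqxx big1_fset ?addr0 // => j.
  by rewrite !inE => /andP[/negbTE -> _]; rewrite rnorm0 expr0n.
rewrite /psum big1_fset ?sqr_ge0 // => j jA _; rewrite /sqnorm.
by case: eqP => [ji|_]; [rewrite ji (negbTE iA) in jA | rewrite rnorm0 expr0n].
Qed.

Definition l2_delta (i : I) (v : K) : l2K :=
  xget 0 [set x | l2_val x = fun j => if j == i then v else 0].

Lemma l2_deltaE i v j : l2_val (l2_delta i v) j = if j == i then v else 0.
Proof.
rewrite /l2_delta; case: xgetP => [x _ -> //|h].
by have [x /h] := l2_exists (square_summable_delta i v).
Qed.

Lemma dot_deltal i v (x : l2K) : dot (l2_delta i v) x = dot v (l2_val x i).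
Proof.
rewrite (dot_l2_support (A := [fset i]%fset)) ?big_seq_fset1 ?l2_deltaE ?eqxx //.
by move=> j; rewrite inE => /negbTE ji; left; rewrite l2_deltaE ji.
Qed.

Lemma dot_deltar i v (x : l2K) : dot x (l2_delta i v) = dot (l2_val x i) v.
Proof. by rewrite dotC dot_deltal -dotC. Qed.

Lemma dot_delta i j v w : dot (l2_delta i v) (l2_delta j w) = if i == j then dot v w else 0.
Proof. by rewrite dot_deltal l2_deltaE; case: eqP => // _; rewrite dot0r. Qed.

Lemma l2_delta_linear i : linear (l2_delta i).
Proof.
move=> a v w; apply: l2_ext => j; rewrite l2_valP !l2_deltaE.
by case: eqP => // _; rewrite scaler0 addr0.
Qed.

Lemma rnorm_delta i v : rnorm (l2_delta i v) = rnorm v.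
Proof.
by apply: rnorm_dot_eq; rewrite dot_delta eqxx.
Qed.

Lemma l2_delta_total (z : l2K) : (forall i v, dot z (l2_delta i v) = 0) -> z = 0.
Proof.
move=> h; apply: l2_ext => i; apply: dot_ext => v; rewrite -dot_deltar h.
rewrite -(dot_deltar i v (0 : l2K)) dot0l //.
Qed.

End L2Delta.

Section Reindexing.
Import finmap.
Local Existing Instance summability.totally_filter.
Variables (R : realType) (I : choiceType) (s t : I -> I).
Hypotheses (st : cancel s t) (ts : cancel t s).

Lemma psum_reindex (g : I -> R) (A : {fset I}) :
  psum (fun i => g (s i)) A = psum g (s @` A)%fset.
Proof.
by rewrite /psum big_imfset //= => i j _ _ /(can_inj st).
Qed.

Lemma tsum_reindex (g : I -> R) : abs_summable g -> tsum (fun i => g (s i)) = tsum g.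
Proof.
move=> hg; apply: cvg_lim => //.
have -> : psum (fun i => g (s i)) = psum g \o (fun A => s @` A)%fset.
  by apply/funext => A; rewrite psum_reindex.
apply: cvg_comp (abs_summable_cvg hg) => Q [A _ hA].
exists (t @` A)%fset => // B /= AB; apply: hA => /=.
apply/fsubsetP => i iA; apply/imfsetP; exists (t i); last by rewrite ts.
by apply: (fsubsetP AB); apply/imfsetP; exists i.
Qed.

End Reindexing.

Section MonomialRepresentation.
Import finmap.
Variables (R : realType) (H : lcGroupType) (I : choiceType) (K : hilbertType R).
Variables (act : H -> I -> I) (c : H -> I -> K -> K).
Hypotheses (act1 : forall i, act 1%g i = i)
  (actM : forall s t i, act (s * t)%g i = act s (act t i))
  (c_linear : forall s i, linear (c s i))
  (c1 : forall i x, c 1%g i x = x)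
  (cM : forall s t i x, c (s * t)%g i x = c s (act t i) (c t i x))
  (c_unitary : forall s i x y, dot (c s i x) (c s i y) = dot x y)
  (c_near : forall i x (e : R), 0 < e ->
     \forall s \near (1%g : H), act s i = i /\ rnorm (c s i x - x) < e).
Local Notation l2K := (l2 I K).

Lemma act_cancel s : cancel (act s) (act s^-1%g).
Proof. by move=> i; rewrite -actM mulVg act1. Qed.

Lemma act_cancelV s : cancel (act s^-1%g) (act s).
Proof. by move=> i; rewrite -actM mulgV act1. Qed.

Lemma rnorm_c s i x : rnorm (c s i x) = rnorm x.
Proof.
by apply: rnorm_dot_eq; rewrite c_unitary.
Qed.

(** Sums are invariant under the permutations [act s], which makes the operators
    unitary; the vectors supported at one index are total, and on them continuity
    is the hypothesis [c_near]. *)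
Lemma monomial_rep : exists rho : unirep H l2K,
  forall s i v, rho s (l2_delta i v) = l2_delta (act s i) (c s i v).
Proof.
have /choice [f hf] : forall sx : H * l2K, exists y : l2K, l2_val y =
    fun i => c sx.1 (act sx.1^-1%g i) (l2_val sx.2 (act sx.1^-1%g i)).
  move=> [s x]; apply: l2_exists => /=; have [d hd] := l2_square_summable x.
  exists d => A; apply: le_trans (hd (act s^-1%g @` A)%fset).
  rewrite -(psum_reindex (act_cancelV s)) /sqnorm.
  by apply: ler_psum => i; rewrite rnorm_c.
pose g s x := f (s, x).
have gE s x i : l2_val (g s x) i = c s (act s^-1%g i) (l2_val x (act s^-1%g i)).
  by rewrite hf.
have gdelta s i v : g s (l2_delta i v) = l2_delta (act s i) (c s i v).
  apply: l2_ext => j; rewrite gE !l2_deltaE.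
  have -> : (act s^-1%g j == i) = (j == act s i).
    by apply/eqP/eqP => [<-|->]; rewrite ?act_cancelV ?act_cancel.
  by case: eqP => [->|_]; [rewrite act_cancel | rewrite (lin0 (c_linear _ _))].
have [|||||rho hrho] := @unirep_exists R H l2K g.
- move=> s a x y; apply: l2_ext => i; rewrite l2_valP !gE l2_valP.
  exact: c_linear.
- by move=> x; apply: l2_ext => i; rewrite gE c1 invg1 act1.
- move=> s t x; apply: l2_ext => i; rewrite !gE cM invgM !actM.
  by rewrite act_cancelV.
- move=> s x y; rewrite !dot_l2 /l2_form.
  have sx := l2_square_summable x; have sy := l2_square_summable y.
  rewrite -[in RHS](tsum_reindex (act_cancelV s) (act_cancel s) (Re_summable sx sy)).
  rewrite -[in RHS](tsum_reindex (act_cancelV s) (act_cancel s) (Im_summable sx sy)).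
  by congr Complex; congr tsum; apply/funext => i; rewrite !gE c_unitary.
- move=> z hz; apply: l2_delta_total => i v; apply: hz => e e0.
  apply: filterS (c_near i v e0) => s [ai hs].
  have dl := @l2_delta_linear R I K i.
  by rewrite gdelta ai -(linB (c s i v) v dl) rnorm_delta.
- by exists rho => s i v; rewrite hrho gdelta.
Qed.

End MonomialRepresentation.

(** * Transfer from the universal representation *)

Section Commutation.
Variables (R : realType) (G : lcGroupType) (K : hilbertType R) (rho : unirep G K) (M : set K).
Hypotheses (hM : closed_subspace M) (invM : forall s x, M x -> M (rho s x)).

Lemma orthoproj_rep s x : orthoproj M (rho s x) = rho s (orthoproj M x).
Proof.
apply: (orthoproj_unique hM) => [|y My]; first by apply: invM; exact: orthoproj_in.
rewrite -(linB _ _ (@rep_linear _ _ _ rho s)) rep_adj (orthoproj_orth hM) //.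
exact: invM.
Qed.

End Commutation.

Section Intertwiners.
Variables (R : realType) (H : lcGroupType).
Local Notation C := R[i].

Definition intertwiner (K1 K2 : hilbertType R) (rho1 : unirep H K1) (rho2 : unirep H K2)
    (X : K1 -> K2) : Prop :=
  [/\ linear X, exists2 c, 0 <= c & bounded_by c X & forall s x, X (rho1 s x) = rho2 s (X x)].

(** The one identity says both that [P] is self-adjoint and that it is
    idempotent. *)
Definition orthogonal_projection (K : hilbertType R) (P : K -> K) : Prop :=
  linear P /\ forall x y, dot (P x) (P y) = dot (P x) y.

Lemma projection_sym (K : hilbertType R) (P : K -> K) : orthogonal_projection P ->
  forall x y, dot (P x) y = dot x (P y).
Proof. by move=> [_ h] x y; rewrite -h dotC h -dotC. Qed.

Lemma projection_idem (K : hilbertType R) (P : K -> K) : orthogonal_projection P ->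
  forall x, P (P x) = P x.
Proof. by move=> h x; apply: dot_ext => y; rewrite projection_sym //; case: h. Qed.

Lemma projection_le (K : hilbertType R) (P : K -> K) : orthogonal_projection P ->
  forall x, rnorm (P x) <= rnorm x.
Proof.
move=> [_ h] x; apply: rnorm_le_dot; first exact: rnorm_ge0.
by rewrite h mulrC; exact: CauchySchwarz.
Qed.

Definition orbit_span (K : hilbertType R) (rho : unirep H K) (xi : K) : set K :=
  [set x | exists n (c : 'I_n -> C) (s : 'I_n -> H), x = \sum_(i < n) c i *: rho (s i) xi].

Lemma orbit_spanP (K : hilbertType R) (rho : unirep H K) xi a x y :
  orbit_span rho xi x -> orbit_span rho xi y -> orbit_span rho xi (a *: x + y).
Proof.
move=> [n [c [s ->]]] [m [d [t ->]]].
exists (n + m)%N,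
  (fun i : 'I_(n + m) => match fintype.split i with inl j => a * c j | inr j => d j end).
exists (fun i : 'I_(n + m) => match fintype.split i with inl j => s j | inr j => t j end).
rewrite big_split_ord scaler_sumr; congr (_ + _); apply: eq_bigr => i _.
  by rewrite (unsplitK (inl i)) scalerA.
by rewrite (unsplitK (inr i)).
Qed.

Lemma orbit_span_orbit (K : hilbertType R) (rho : unirep H K) xi s :
  orbit_span rho xi (rho s xi).
Proof. by exists 1%N, (fun=> 1), (fun=> s); rewrite big_ord1 scale1r. Qed.

(** The closure of the orbit span is a closed subspace, and only [0] is orthogonal
    to the orbit. *)
Lemma cyclicP (K : hilbertType R) (rho : unirep H K) xi :
  (forall z, (forall s, dot (rho s xi) z = 0) -> z = 0) -> cyclic_rep rho.
Proof.
move=> htot; exists xi; apply/seteqP; split => // x _.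
pose Q := [set x : K | forall e : R, 0 < e -> exists2 y, orbit_span rho xi y & rnorm (x - y) < e].
have hQ : closed_subspace Q.
  split.
  - move=> e e0; exists 0; last by rewrite subrr rnorm0.
    by exists 0%N, (fun=> 0), (fun=> 1%g); rewrite big_ord0.
  - move=> a u v hu hv e e0; have e2 : 0 < e / 2 by rewrite divr_gt0.
    have a0 : 0 < rnorm a + 1 by rewrite ltr_wpDl ?rnorm_ge0.
    have [u' Du hu'] := hu _ (divr_gt0 e2 a0); have [v' Dv hv'] := hv _ e2.
    exists (a *: u' + v'); first exact: orbit_spanP.
    rewrite opprD addrACA -scalerBr; apply: le_lt_trans (rnormD _ _) _.
    rewrite [ltRHS]splitr rnormZ; apply: ler_ltD => //.
    apply: (@le_trans _ _ ((rnorm a + 1) * rnorm (u - u'))).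
      by rewrite ler_wpM2r ?rnorm_ge0 // lerDl.
    by rewrite mulrC -ler_pdivlMr // ltW.
  - move=> u hu e e0; have e2 : 0 < e / 2 by rewrite divr_gt0.
    have [y hy hy'] := hu _ e2; have [z hz hz'] := hy _ e2; exists z => //.
    by apply: le_lt_trans (rnorm_triangle _ y _) _; rewrite [ltRHS]splitr ltrD.
have /(_ x) Qx : forall x, Q x.
  apply: closed_subspace_total hQ _ => z hz; apply: htot => s.
  rewrite dotC hz ?conjc0 // => e e0; exists (rho s xi); last by rewrite subrr rnorm0.
  exact: orbit_span_orbit.
move=> B /nbhs_ballP [[e e'] /=]; rewrite ltcE /= => /andP[/eqP e'0 e0] hB.
have [y hy xy] := Qx e e0; exists y; split; first exact: hy.
by apply: hB; rewrite -ball_normE /ball_ /= rnormE e'0 complexr0 ltcR.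
Qed.

Lemma adjoint_intertwiner (K1 K2 : hilbertType R) (rho1 : unirep H K1) (rho2 : unirep H K2) X :
  intertwiner rho1 rho2 X ->
  exists2 Y, intertwiner rho2 rho1 Y & forall y x, dot (Y y) x = dot y (X x).
Proof.
move=> [lX [c c0 bX] hX]; have [Y [lY bY hY]] := adjoint_exists c0 lX bX.
exists Y => //; split => //; first by exists c.
by move=> s y; apply: dot_ext => x; rewrite hY rep_adj -hX -hY -rep_adj.
Qed.

Lemma comp_intertwiner (K1 K2 K3 : hilbertType R) (rho1 : unirep H K1) (rho2 : unirep H K2)
    (rho3 : unirep H K3) X Y :
  intertwiner rho2 rho3 X -> intertwiner rho1 rho2 Y -> intertwiner rho1 rho3 (X \o Y).
Proof.
move=> [lX [c c0 bX] hX] [lY [d d0 bY] hY]; split; first exact: lin_comp.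
  by exists (c * d); [exact: mulr_ge0 | exact: bounded_comp].
by move=> s x /=; rewrite hY hX.
Qed.

End Intertwiners.

Section Universal.
Variables (R : realType) (H : lcGroupType) (L : hilbertType R) (omega : unirep H L).
Hypothesis homega : universal_rep omega.
Local Notation C := R[i].

Section OneRepresentation.
Variables (K : hilbertType R) (rho : unirep H K).

(** The cyclic subspace of [x] embeds into [L] by universality, and the embedding
    is extended by zero to the orthogonal complement; [P] is the projection onto
    the cyclic subspace. *)
Lemma cyclic_embedding x : exists (W : K -> L) (P : K -> K),
  [/\ intertwiner rho omega W /\ (forall y, rnorm (W y) <= rnorm y),
      orthogonal_projection P /\ (forall s y, P (rho s y) = rho s (P y)),
      forall y z, dot (W y) (W z) = dot (P y) z,
      P x = x &
      forall z, (forall s, dot (rho s x) z = 0) -> P z = 0].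
Proof.
pose D := [set y : K | forall s, dot (rho s x) y = 0].
(* The closed linear span of the orbit of [x], as a double orthogonal. *)
pose M := [set z : K | forall y, D y -> dot y z = 0].
have hM : closed_subspace M := orthogonal_closed D.
have invM s z : M z -> M (rho s z).
  move=> Mz y hy; rewrite dotC rep_adj -dotC; apply: Mz => t.
  by rewrite -rep_adj -repME hy.
have Mx : M x by move=> y /(_ 1%g); rewrite rep1E => h; rewrite dotC h conjc0.
have [rhoM hrhoM] := subrep_exists hM invM.
set KM := insub_hilbert _ in rhoM hrhoM.
have il := @insub_inc_linear _ _ (subspace_inner hM).
have dE (u v : KM) : dot u v = dot (insub_inc u) (insub_inc v) by [].
have [xM hxM] := @insub_inc_surj _ _ (subspace_inner hM) x Mx.
have /homega [W0 [W0d W0i]] : cyclic_rep rhoM.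
  apply: (@cyclicP _ _ _ _ xM) => z hz; apply: dotxx_eq0; rewrite dE.
  apply: (@insub_incP _ _ (subspace_inner hM) z) => s.
  by have := hz s; rewrite dE hrhoM hxM.
pose P := orthoproj M.
have /choice [T hT] : forall y, exists m : KM, insub_inc m = P y.
  by move=> y; apply: insub_inc_surj; exact: (orthoproj_in hM).
have inj := @insub_inc_inj _ _ (subspace_inner hM).
have Tl : linear T by move=> a u v; apply: inj; rewrite il !hT; exact: (orthoproj_linear hM).
have PP : orthogonal_projection P.
  split; first exact: (orthoproj_linear hM).
  by move=> y z; rewrite -dot_orthoproj.
have Pi s y : P (rho s y) = rho s (P y) by exact: (orthoproj_rep hM invM).
have Wd y z : dot (W0 (T y)) (W0 (T z)) = dot (P y) z by rewrite W0d dE !hT PP.2.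
have Wn y : rnorm (W0 (T y)) <= rnorm y.
  apply: le_trans (projection_le PP y).
  rewrite -(@ler_pXn2r _ 2) // ?nnegrE ?rnorm_ge0 // -lecR -!dotxx Wd PP.2 //.
exists (W0 \o T), P; split => //.
- split; last exact: Wn.
  split; first by move=> a u v /=; rewrite Tl linearP.
    by exists 1 => // y; rewrite mul1r; exact: Wn.
  move=> s y /=; rewrite -W0i; congr (W0 _); apply: inj.
  by rewrite hrhoM !hT Pi.
- by rewrite /P (orthoproj_id hM).
- by move=> z hz; apply: (orthoproj_eq0 hM) => y My; exact: My.
Qed.

(** The embedding of the cyclic subspace of [y] is isometric at [y]. *)
Lemma intertwiners_separate (y : K) :
  (forall X, intertwiner rho omega X -> X y = 0) -> y = 0.
Proof.
move=> h; have [W [P [[iW _] _ WP Px _]]] := cyclic_embedding y.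
by apply: dotxx_eq0; rewrite -{1}Px -WP h ?dot0l.
Qed.

(** This characterizes the image [T] of [S] under the normal homomorphism from the
    von Neumann algebra of [omega] onto that of [rho], without a topology. *)
Definition transfers (S : L -> L) (T : K -> K) : Prop :=
  forall X, intertwiner rho omega X -> forall x, X (T x) = S (X x).

(** For the embedding [W] of the cyclic subspace of [x], the vector
    [W^* S W x] is the value at [x]; it does not depend on [W] since [X W^*]
    commutes with [omega], hence with [S], for every intertwiner [X]. *)
Lemma transfer_exists S : VN omega S -> exists T, transfers S T.
Proof.
move=> [bS cS].
have /choice [T hT] : forall x, exists y, forall X, intertwiner rho omega X -> X y = S (X x).
  move=> x; have [W [P [[iW _] _ WP Px _]]] := cyclic_embedding x.
  have [Y iY hY] := adjoint_intertwiner iW.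
  have YW : Y (W x) = x by apply: dot_ext => z; rewrite hY WP Px.
  exists (Y (S (W x))) => X iX.
  have [lXY cXY hXY] := comp_intertwiner iX iY.
  have /cS h : bounded_op (X \o Y) by apply/bounded_opP.
  have /(congr1 (fun f => f (W x))) /= : (X \o Y) \o S = S \o (X \o Y).
    by apply: h => s; apply/funext => l; exact: hXY.
  by rewrite YW.
by exists T => X iX x; exact: hT.
Qed.

Section Transfer.
Variables (S : L -> L) (T : K -> K).
Hypotheses (lS : linear S) (hT : transfers S T).

Lemma transfer_linear : linear T.
Proof.
move=> a x y; apply/subr0_eq/intertwiners_separate => X iX.
have [lX _ _] := iX.
by rewrite (linB _ _ lX) lX !hT // lX lS subrr.
Qed.

Lemma transfer_commute B : intertwiner rho rho B -> forall x, T (B x) = B (T x).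
Proof.
move=> iB x; apply/subr0_eq/intertwiners_separate => X iX; have [lX _ _] := iX.
by rewrite (linB _ _ lX) hT // -(hT (comp_intertwiner iX iB)) subrr.
Qed.

Lemma transfer_projection P x : orthogonal_projection P ->
  (forall s y, P (rho s y) = rho s (P y)) -> P x = x -> P (T x) = T x.
Proof.
move=> hP Pi Px; rewrite -transfer_commute ?Px //.
split; [exact: hP.1 | | exact: Pi].
by exists 1 => // y; rewrite mul1r projection_le.
Qed.

Lemma dot_transfer x W P :
  intertwiner rho omega W -> orthogonal_projection P ->
  (forall s y, P (rho s y) = rho s (P y)) ->
  (forall y z, dot (W y) (W z) = dot (P y) z) -> P x = x ->
  forall y, dot (T x) y = dot (S (W x)) (W y).
Proof.
by move=> iW hP Pi WP Px y; rewrite -hT // WP (transfer_projection hP).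
Qed.

Lemma transfer_cyclic x z : (forall s, dot (rho s x) z = 0) -> dot (T x) z = 0.
Proof.
move=> hz; have [W [P [_ [hP Pi] _ Px /(_ _ hz) Pz]]] := cyclic_embedding x.
by rewrite -(transfer_projection hP Pi Px) (projection_sym hP) Pz dot0r.
Qed.

Lemma transfer_bounded c : 0 <= c -> bounded_by c S -> bounded_by c T.
Proof.
move=> c0 bS x; apply: rnorm_le_dot; first by rewrite mulr_ge0 ?rnorm_ge0.
have [W [P [[iW Wn] [hP Pi] WP Px _]]] := cyclic_embedding x.
rewrite (dot_transfer iW hP Pi WP Px); apply: le_trans (CauchySchwarz _ _) _.
apply: ler_pM; rewrite ?rnorm_ge0 //.
by apply: le_trans (bS _) _; rewrite ler_wpM2l.
Qed.

End Transfer.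

(** Gram-Schmidt for cyclic subspaces: a finite family of vectors lies in a finite
    orthogonal sum of subspaces that embed into [L].  The projection onto the
    orthogonal complement of that sum is [Q]. *)
Lemma intertwiner_frame n (x : 'I_n -> K) :
  exists r (X : 'I_r -> K -> L) (Q : K -> K),
  [/\ forall k, intertwiner rho omega (X k),
      orthogonal_projection Q /\ (forall s y, Q (rho s y) = rho s (Q y)),
      forall z, \sum_k rnorm (X k z) ^+ 2 = rnorm z ^+ 2 - rnorm (Q z) ^+ 2 &
      forall i, Q (x i) = 0].
Proof.
elim: n x => [|n IH] x.
  exists 0%N, (fun _ _ => 0), id; split=> [[]//|||[]//].
    by split=> //; split=> // a y z.
  by move=> z; rewrite big_ord0 subrr.
have [r [X [Q [iX [hQ Qi] sX Qx]]]] := IH (fun i => x (lift ord0 i)).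
have [W [P [[iW Wn] [hP Pi] WP Px P0]]] := cyclic_embedding (Q (x ord0)).
have [lQ _] := hQ; have [lP _] := hP.
have PQ z : P (Q z) = P z.
  apply/esym/subr0_eq; rewrite -(linB _ _ lP); apply: P0 => s.
  by rewrite -Qi (projection_sym hQ) (linB _ _ lQ) projection_idem // subrr dot0r.
have QP z : Q (P z) = P z.
  apply: dot_ext => y; rewrite (projection_sym hQ) (projection_sym hP).
  by rewrite PQ -(projection_sym hP).
pose Q' z := Q z - P z.
have hQ' : orthogonal_projection Q'.
  split=> [a y z|y z].
    by rewrite /Q' lQ lP opprD addrACA -scalerBr.
  rewrite /Q' !dotBl !dotBr !hQ.2 hP.2.
  by rewrite -(projection_sym hP (Q y)) PQ -(projection_sym hQ (P y)) QP subrr subr0.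
exists r.+1, (fun k => if unlift ord0 k is Some j then X j else W), Q'.
split.
- by move=> k; case: unliftP => [j _|_].
- split=> // s y; rewrite /Q' Qi Pi -(linB _ _ (@rep_linear _ _ _ rho s)) //.
- move=> z; rewrite big_ord_recl unlift_none.
  under eq_bigr do rewrite liftK.
  rewrite sX.
  have -> : rnorm (W z) ^+ 2 = rnorm (P z) ^+ 2.
    by apply: complexI; rewrite -!dotxx WP hP.2.
  have -> : Q z = Q' z + P z by rewrite /Q' subrK.
  rewrite Pythagoras; last first.
    rewrite (projection_sym hQ') /Q' QP projection_idem // subrr dot0r //.
  ring.
- move=> i; case: (unliftP ord0 i) => [j ->|->].
    by rewrite /Q' -PQ Qx (lin0 lP) subrr.
  by rewrite /Q' -PQ Px subrr.
Qed.

Definition contractive_mx (V : normedModType C) (I : finType) (T : I -> I -> V -> V) : Prop :=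
  forall x : I -> V, \sum_i rnorm (\sum_j T i j (x j)) ^+ 2 <= \sum_j rnorm (x j) ^+ 2.

(** A frame for the vectors [x j] and their images computes all the norms in [L],
    where the bound on [S] applies to each member of the frame. *)
Lemma transfer_contractive m (S : 'I_m -> 'I_m -> L -> L) (T : 'I_m -> 'I_m -> K -> K) :
  (forall k l, transfers (S k l) (T k l)) -> contractive_mx S -> contractive_mx T.
Proof.
move=> hT cS x; pose y k := \sum_j T k j (x j).
have [r [X [Q [iX _ sX Qv]]]] := intertwiner_frame
  (fun i : 'I_(m + m) => match fintype.split i with inl j => x j | inr j => y j end).
have nx j : rnorm (x j) ^+ 2 = \sum_k rnorm (X k (x j)) ^+ 2.
  have := Qv (lshift m j); rewrite (unsplitK (inl j)) => Q0.
  by rewrite sX Q0 rnorm0 expr0n subr0.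
have ny j : rnorm (y j) ^+ 2 = \sum_k rnorm (X k (y j)) ^+ 2.
  have := Qv (rshift m j); rewrite (unsplitK (inr j)) => Q0.
  by rewrite sX Q0 rnorm0 expr0n subr0.
rewrite (eq_bigr _ (fun j _ => ny j)) (eq_bigr _ (fun j _ => nx j)).
rewrite exchange_big [leRHS]exchange_big; apply: ler_sum => k _.
have [lX _ _] := iX k.
apply: le_trans (cS (fun j => X k (x j))).
apply: ler_sum => i _; rewrite /y lin_sum //.
by under eq_bigr do rewrite hT //.
Qed.

End OneRepresentation.
End Universal.

(** * Duality for the universal representation *)

Section UniversalPairing.
Variables (R : realType) (H : lcGroupType) (L : hilbertType R) (omega : unirep H L).
Hypothesis homega : universal_rep omega.
Local Notation C := R[i].

Lemma coef_omega (K : hilbertType R) (rho : unirep H K) x y : exists xi eta,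
  [/\ coef rho x y = coef omega xi eta, rnorm xi <= rnorm x, rnorm eta <= rnorm y &
      forall S T, transfers omega rho S T -> dot (T x) y = dot (S xi) eta].
Proof.
have [W [P [[iW Wn] [hP Pi] WP Px _]]] := cyclic_embedding homega rho x.
exists (W x), (W y); split => //.
  apply/funext => s; rewrite /coef; have [_ _ <-] := iW.
  by rewrite WP Pi Px.
move=> S T hT; exact: (dot_transfer homega hT iW hP Pi WP Px).
Qed.

Lemma diagonal_rep n : exists rho : unirep H (l2 'I_n L),
  forall s i v, rho s (l2_delta i v) = l2_delta i (omega s v).
Proof.
have [|||||||rho h] := @monomial_rep R H 'I_n L (fun _ i => i) (fun s _ => omega s).
- by [].
- by [].
- by move=> s _; exact: rep_linear.
- by move=> _ x; exact: rep1E.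
- by move=> s t _ x; exact: repME.
- by move=> s _ x y; exact: rep_unitary.
- move=> i x e e0; have /cvg_rnormP /(_ e e0) := @rep_continuous _ _ _ omega x 1%g.
  by apply: filterS => s; rewrite rep1E rnormBC.
- by exists rho.
Qed.

Lemma dot_sum_delta n (xi eta : 'I_n -> L) :
  dot (\sum_i l2_delta i (xi i)) (\sum_i l2_delta i (eta i)) = \sum_i dot (xi i) (eta i).
Proof.
rewrite dot_suml; apply: eq_bigr => i _; rewrite dot_sumr (bigD1 i) //= dot_delta eqxx.
by rewrite big1 ?addr0 // => j /negbTE ji; rewrite dot_delta eq_sym ji.
Qed.

Lemma coef_diagonal n (rho : unirep H (l2 'I_n L)) (xi eta : 'I_n -> L) :
  (forall s i v, rho s (l2_delta i v) = l2_delta i (omega s v)) ->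
  coef rho (\sum_i l2_delta i (xi i)) (\sum_i l2_delta i (eta i)) =
  fun s => \sum_i coef omega (xi i) (eta i) s.
Proof.
move=> h; apply/funext => s; rewrite /coef (lin_sum _ _ _ (@rep_linear _ _ _ rho s)).
by under eq_bigr do rewrite h; rewrite dot_sum_delta.
Qed.

Lemma delta_intertwiner n (rho : unirep H (l2 'I_n L)) i :
  (forall s i v, rho s (l2_delta i v) = l2_delta i (omega s v)) ->
  intertwiner omega rho (l2_delta i).
Proof.
move=> h; split; [exact: l2_delta_linear | | by move=> s x; rewrite h].
by exists 1 => // x; rewrite rnorm_delta mul1r.
Qed.

Lemma VN_commute S B : VN omega S -> intertwiner omega omega B -> forall x, S (B x) = B (S x).
Proof.
move=> [_ cS] [lB cB iB] x.
have /cS h : bounded_op B by apply/bounded_opP.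
have /(congr1 (fun f => f x)) /= -> // : B \o S = S \o B.
by apply: h => s; apply/funext => l; exact: iB.
Qed.

(** A linear relation between coefficient functions says that one vector of a
    direct sum of copies of [omega] is orthogonal to the orbit of another, and
    operators of the von Neumann algebra preserve cyclic subspaces. *)
Lemma omega_relation n (xi eta : 'I_n -> L) S : VN omega S ->
  (forall s, \sum_i coef omega (xi i) (eta i) s = 0) ->
  \sum_i dot (S (xi i)) (eta i) = 0.
Proof.
move=> hS h0; have [rho hrho] := diagonal_rep n.
have [T hT] := transfer_exists homega rho hS.
have [[lS _] _] := hS.
have Tdelta i v : T (l2_delta i v) = l2_delta i (S v).
  apply/subr0_eq/(intertwiners_separate homega (rho := rho)) => X iX.
  have [lX _ _] := iX.
  rewrite (linB _ _ lX) (hT _ iX).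
  by rewrite (VN_commute hS (comp_intertwiner iX (delta_intertwiner i hrho))) subrr.
have lT := transfer_linear homega lS hT.
have : dot (T (\sum_i l2_delta i (xi i))) (\sum_i l2_delta i (eta i)) = 0.
  apply: (transfer_cyclic homega hT) => s.
  have := congr1 (fun f => f s) (coef_diagonal xi eta hrho); rewrite /coef => ->.
  exact: h0.
rewrite (lin_sum _ _ _ lT); under eq_bigr do rewrite Tdelta.
by rewrite dot_sum_delta.
Qed.

Lemma BG_omega (v : H -> C) : BG v -> exists xi eta, v = coef omega xi eta.
Proof.
move=> [K [rho [x [y ->]]]]; have [xi [eta [h _ _ _]]] := coef_omega rho x y.
by exists xi, eta.
Qed.

Lemma BG_lin (a : C) (u v : H -> C) : BG u -> BG v -> BG (fun s => a * u s + v s).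
Proof.
move=> /BG_omega [x [y ->]] /BG_omega [x' [y' ->]]; have [rho hrho] := diagonal_rep 2.
have := coef_diagonal (fun i : 'I_2 => if i == 0 then a *: x else x')
  (fun i : 'I_2 => if i == 0 then y else y') hrho.
set w := coef _ _ _ => hw.
have -> : (fun s => a * coef omega x y s + coef omega x' y' s) = w.
  rewrite hw; apply/funext => s; rewrite big_ord_recl big_ord1 /=.
  by rewrite /coef (linZ _ _ (@rep_linear _ _ _ omega s)) dotZl.
exact: BG_coef.
Qed.

Section OneOperator.
Variable S : L -> L.
Hypothesis hS : VN omega S.

(** Every element of [B(H)] is a coefficient function of [omega], and
    [omega_relation] makes its pairing with [S] independent of the vectors. *)
Lemma omega_represented : exists phi, represents omega S phi.
Proof.
pose phi (v : H -> C) : C :=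
  xget 0 [set c | exists xi eta, v = coef omega xi eta /\ c = dot (S xi) eta].
have [[lS _] _] := hS.
have phiE xi eta : phi (coef omega xi eta) = dot (S xi) eta.
  rewrite /phi; case: xgetP => [c _ [x [y [h ->]]]|/(_ (dot (S xi) eta))]; last first.
    by case; exists xi, eta.
  have := @omega_relation 2 (fun i => if i == 0 then x else - xi)
    (fun i => if i == 0 then y else eta) S hS.
  rewrite !big_ord_recl !big_ord0 /= !addr0 (linN _ lS) dotNl => /(_ _)/subr0_eq -> //.
  move=> s; rewrite !big_ord_recl big_ord0 /= addr0.
  rewrite /coef (linN _ (@rep_linear _ _ _ omega s)) dotNl.
  by have := congr1 (fun f => f s) h; rewrite /coef => ->; rewrite subrr.
exists phi; split=> //.
- move=> a u v /A_BG Bu /A_BG Bv.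
  have /BG_omega [x3 [y3 h3]] := BG_lin a Bu Bv.
  have [x1 [y1 h1]] := BG_omega Bu; have [x2 [y2 h2]] := BG_omega Bv.
  rewrite h3 h1 h2 !phiE.
  have := @omega_relation 3 (fun i => if i == 0 then a *: x1 else if i == 1 then x2 else - x3)
    (fun i => if i == 0 then y1 else if i == 1 then y2 else y3) S hS.
  rewrite !big_ord_recl !big_ord0 /= !addr0 (linN _ lS) (linZ _ _ lS) dotNl dotZl addrA.
  move=> /(_ _)/subr0_eq -> // s; rewrite !big_ord_recl big_ord0 /= addr0.
  rewrite /coef (linN _ (@rep_linear _ _ _ omega s)) (linZ _ _ (@rep_linear _ _ _ omega s)).
  rewrite dotNl dotZl addrA.
  have := congr1 (fun f => f s) h3; rewrite h1 h2 /coef => ->.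
  by rewrite subrr.
- have [c c0 bS] : exists2 c, 0 <= c & bounded_by c S.
    by have [/bounded_opP [_ +] _] := hS.
  exists c => u /A_BG Bu; apply: le_BG_norm => // K rho x y ->.
  have [xi [eta [-> hx hy _]]] := coef_omega rho x y.
  rewrite phiE; apply: le_trans (CauchySchwarz _ _) _.
  rewrite mulrA; apply: ler_pM; rewrite ?rnorm_ge0 //.
  by apply: le_trans (bS _) _; rewrite ler_wpM2l.
Qed.

Lemma pairing_omega_coef xi eta : pairing omega S (coef omega xi eta) = dot (S xi) eta.
Proof.
rewrite /pairing; case: xgetP => [c _ [phi [_ _ h] ->]|h]; first exact: h.
by have [phi hphi] := omega_represented; case: (h (phi (coef omega xi eta))); exists phi.
Qed.

Lemma pairing_omega (K : hilbertType R) (rho : unirep H K) T x y :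
  transfers omega rho S T -> pairing omega S (coef rho x y) = dot (T x) y.
Proof.
move=> hT; have [xi [eta [-> _ _ /(_ _ _ hT) ->]]] := coef_omega rho x y.
exact: pairing_omega_coef.
Qed.

Lemma pairing_omegaE phi v : represents omega S phi -> BG v -> pairing omega S v = phi v.
Proof.
move=> [_ _ h] /BG_omega [xi [eta ->]]; by rewrite pairing_omega_coef h.
Qed.

Lemma BG_A_omega v : BG v -> A_ omega v.
Proof. by move=> /BG_omega [xi [eta ->]]; exact: A_coef. Qed.

Lemma pairing_omega_lin a u v : BG u -> BG v ->
  pairing omega S (fun s => a * u s + v s) = a * pairing omega S u + pairing omega S v.
Proof.
have [phi hphi] := omega_represented; have [lphi _ _] := hphi => Bu Bv.
by rewrite !(pairing_omegaE hphi) //; [apply: lphi; exact: BG_A_omega | exact: BG_lin].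
Qed.

Lemma pairing_omega_bounded : exists M : R, forall v, BG v ->
  rnorm (pairing omega S v) <= M * BG_norm v.
Proof.
have [phi hphi] := omega_represented; have [_ [M hM] _] := hphi.
by exists M => v Bv; rewrite (pairing_omegaE hphi) //; apply: hM; exact: BG_A_omega.
Qed.

End OneOperator.

End UniversalPairing.

(** * Representations of the spectrum *)

Section SpectrumRepresentations.
Variables (R : realType) (G : lcGroupType) (K : hilbertType R) (pi : unirep G K).
Hypothesis hA : closed_invariant_subalgebra (A_ pi).
Local Notation C := R[i].
Local Notation A := (A_ pi).
Local Notation phi := (pairing pi).

(** The last clause expresses continuity from the weak* topology to the weak
    operator topology: matrix coefficients are evaluations at elements of the
    algebra. *)
Definition spectrum_rep (K' : hilbertType R) (theta : (K -> K) -> K' -> K') : Prop :=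
  [/\ forall T, spectrum pi T -> bounded_op (theta T),
      forall T S, spectrum pi T -> spectrum pi S -> theta (T \o S) = theta T \o theta S,
      forall T, spectrum pi T -> forall x y, dot (theta (adj T) x) y = dot x (theta T y) &
      forall x y, exists2 v, A v & forall T, spectrum pi T -> dot (theta T x) y = phi T v].

Lemma spectrum_bounded T : spectrum pi T -> bounded_op T.
Proof. by move=> [[]]. Qed.

Lemma dot_adj (T : K -> K) : bounded_op T -> forall x y, dot (adj T x) y = dot x (T y).
Proof. by move=> bT x y; rewrite dotC -adjP // -dotC. Qed.

Lemma pairing_coef T x y : spectrum pi T -> phi T (coef pi x y) = dot (T x) y.
Proof. by move=> /(spectrum_represents hA) [_ _]. Qed.

Lemma pairing_lin T a u v : spectrum pi T -> A u -> A v ->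
  phi T (fun s => a * u s + v s) = a * phi T u + phi T v.
Proof. by move=> /(spectrum_represents hA) [+ _ _]; apply. Qed.

Lemma pairing_bounded T : spectrum pi T ->
  exists2 M, 0 <= M & forall u, A u -> rnorm (phi T u) <= M * BG_norm u.
Proof.
move=> /(spectrum_represents hA) [_ [M hM] _]; exists `|M| => // u Au.
apply: le_trans (hM u Au) _; rewrite ler_wpM2r ?BG_norm_ge0 //; exact: ler_norm.
Qed.

Lemma pairing_functional T : spectrum pi T -> A_functional pi (phi T).
Proof. by move=> /(spectrum_represents hA) /represents_functional. Qed.

Lemma spectrum_rep_id : star_semigroup (spectrum pi) -> spectrum_rep id.
Proof.
move=> hstar; split=> [T sT|//|T sT x y|x y]; first exact: spectrum_bounded.
  exact/dot_adj/spectrum_bounded.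
by exists (coef pi x y) => [|T sT]; [exact: A_coef | rewrite pairing_coef].
Qed.

Section Realization.
Variables (K' : hilbertType R) (rho : unirep G K').

Lemma A_coefl_closed y : closed_subspace [set x | A (coef rho x y)].
Proof.
split=> [|a x x' /= hx hx'|x /= h].
- rewrite /= (_ : coef rho 0 y = fun=> 0); first exact: A_zero.
  by apply/funext => s; rewrite /coef (lin0 (@rep_linear _ _ _ rho s)) dot0l.
- rewrite (_ : coef rho _ y = fun s => a * coef rho x y s + coef rho x' y s).
    exact: A_lin.
  by apply/funext => s; rewrite coefDl.
- apply: (A_closed hA); split=> [|e e0]; first exact: BG_coef.
  have c1 : 0 < rnorm y + 1 by rewrite ltr_wpDl ?rnorm_ge0.
  have [z Az hz] := h _ (divr_gt0 e0 c1); exists (coef rho z y) => //.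
  have -> : coef rho x y \- coef rho z y = coef rho (x - z) y.
    by apply/funext => s; rewrite /coef (linB _ _ (@rep_linear _ _ _ rho s)) dotBl.
  split; first exact: BG_coef.
  apply: le_lt_trans (BG_norm_coef _ _ _) _.
  move: hz; rewrite ltr_pdivlMr // => hz; apply: le_lt_trans hz.
  by rewrite ler_wpM2l ?rnorm_ge0 // lerDl.
Qed.

Definition A_vectors : set K' := [set y | forall x, A (coef rho x y)].

Lemma A_vectors_closed : closed_subspace A_vectors.
Proof.
split=> [x|a y y' hy hy' x|y hy x].
- rewrite (_ : coef rho x 0 = fun=> 0); first exact: A_zero.
  by apply/funext => s; rewrite /coef dot0r.
- rewrite (_ : coef rho x _ = fun s => conjc a * coef rho x y s + coef rho x y' s).
    exact: A_lin.
  by apply/funext => s; rewrite coefDr.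
- apply: (A_closed hA); split=> [|e e0]; first exact: BG_coef.
  have c1 : 0 < rnorm x + 1 by rewrite ltr_wpDl ?rnorm_ge0.
  have [z Az hz] := hy _ (divr_gt0 e0 c1); exists (coef rho x z) => //.
  have -> : coef rho x y \- coef rho x z = coef rho x (y - z).
    by apply/funext => s; rewrite /coef dotBr.
  split; first exact: BG_coef.
  apply: le_lt_trans (BG_norm_coef _ _ _) _.
  move: hz; rewrite ltr_pdivlMr // => hz; apply: le_lt_trans hz.
  by rewrite mulrC ler_wpM2l ?rnorm_ge0 // lerDl.
Qed.

Lemma coef_repr x y t : coef rho x (rho t y) = fun s => coef rho x y (t^-1 * s)%g.
Proof. by apply/funext => s; rewrite /coef repME [in RHS]rep_adj invgK. Qed.

Lemma coef_repl x y t : coef rho (rho t x) y = fun s => coef rho x y (s * t)%g.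
Proof. by apply/funext => s; rewrite /coef repME. Qed.

Lemma A_vectors_invariant s y : A_vectors y -> A_vectors (rho s y).
Proof. by move=> hy x; rewrite coef_repr; apply: A_transl. Qed.

(** Only the component of [eta] in the cyclic subspace of [xi] matters for
    [coef rho xi eta], and every coefficient function of that component is a
    limit of combinations of translates of [coef rho xi eta]. *)
Lemma realization_reduce xi eta : A (coef rho xi eta) ->
  exists eta', [/\ rnorm eta' <= rnorm eta, coef rho xi eta = coef rho xi eta' & A_vectors eta'].
Proof.
move=> Au; pose D := [set y : K' | forall s, dot (rho s xi) y = 0].
have hD : closed_subspace D.
  have := orthogonal_closed (range (fun s => rho s xi)).
  rewrite (_ : [set z | _] = D) //; apply/seteqP; split=> y hy.
    by move=> s; apply: hy; exists s.
  by move=> _ [s _ <-]; exact: hy.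
have invD s y : D y -> D (rho s y).
  by move=> Dy t; rewrite -(repKV rho s (rho t xi)) rep_unitary -repME Dy.
exists (eta - orthoproj D eta).
have cE : coef rho xi eta = coef rho xi (eta - orthoproj D eta).
  apply/funext => s; rewrite /coef dotBr.
  by have -> := orthoproj_in hD eta; rewrite subr0.
split=> //.
  exact: orthoproj_norm_compl.
set eta' := eta - _ in cE *.
rewrite cE in Au.
move=> x; apply: (closed_subspace_total (A_coefl_closed eta')) => z hz.
have Dz : D z.
  move=> s; rewrite dotC hz ?conjc0 //= coef_repl.
  exact: A_transr.
apply: dotxx_eq0; apply: hz => /=.
rewrite (_ : coef rho z eta' = fun=> 0); first exact: A_zero.
apply/funext => s; rewrite /coef dotC /eta' (orthoproj_orth hD) ?conjc0 //.
exact: invD.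
Qed.

Local Notation P := (orthoproj A_vectors).
Let hN := A_vectors_closed.

Lemma coef_projl x y : A_vectors y -> coef rho (P x) y = coef rho x y.
Proof.
move=> Ny; apply/funext => s.
rewrite /coef -(orthoproj_rep hN A_vectors_invariant) (orthoproj_adj hN).
by rewrite (orthoproj_id hN).
Qed.

Lemma A_coef_proj x y : A (coef rho x (P y)).
Proof. exact: (orthoproj_in hN). Qed.

(** The functional of [T] on coefficient functions of [rho] is a bounded
    sesquilinear form; the projection [P] keeps these functions in the algebra. *)
Definition theta_form (T : K -> K) x y : C := phi T (coef rho x (P y)).

Lemma theta_exists T : spectrum pi T -> exists T' : K' -> K',
  [/\ linear T', exists2 c, 0 <= c & bounded_by c T' & forall x y, dot (T' x) y = theta_form T x y].
Proof.
move=> sT; have [M M0 hM] := pairing_bounded sT.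
have [|||T' [lT' bT' hT']] := @sesquilinear_operator R K' K' (theta_form T) M M0.
- move=> a x x' y; rewrite /theta_form -pairing_lin //; try exact: A_coef_proj.
  by congr (phi T _); apply/funext => s; rewrite coefDl.
- move=> a x y y'; rewrite /theta_form -pairing_lin //; try exact: A_coef_proj.
  congr (phi T _); apply/funext => s.
  by rewrite (orthoproj_linear hN) coefDr.
- move=> x y; rewrite /theta_form; apply: le_trans (hM _ (A_coef_proj _ _)) _.
  rewrite -mulrA; apply: ler_wpM2l => //; apply: le_trans (BG_norm_coef _ _ _) _.
  by rewrite ler_wpM2l ?rnorm_ge0 // orthoproj_norm.
- by exists T'; split => //; exists M.
Qed.

Definition theta (T : K -> K) : K' -> K' :=
  xget (fun=> 0) [set T' | forall x y, dot (T' x) y = theta_form T x y].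

Lemma thetaE T x y : spectrum pi T -> dot (theta T x) y = phi T (coef rho x (P y)).
Proof.
move=> sT; rewrite /theta; case: xgetP => [T' _ -> //|h].
by have [T' [_ _ /h]] := theta_exists sT.
Qed.

Lemma theta_bounded T : spectrum pi T -> bounded_op (theta T).
Proof.
move=> sT; have [T' [lT' bT' hT']] := theta_exists sT.
have -> : theta T = T'.
  by apply/funext => x; apply: dot_ext => y; rewrite thetaE // hT'.
by apply/bounded_opP.
Qed.

Lemma pairing_theta T x y : spectrum pi T -> A_vectors y ->
  phi T (coef rho x y) = dot (theta T x) y.
Proof. by move=> sT Ny; rewrite thetaE // (orthoproj_id hN). Qed.

Lemma pairing_translate T x y : spectrum pi T -> A_vectors y ->
  (fun s => phi T (fun t => coef rho x y (s * t)%g)) = coef rho (theta T x) y.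
Proof.
move=> sT Ny; apply/funext => s.
have -> : (fun t => coef rho x y (s * t)%g) = coef rho x (rho s^-1%g y).
  by rewrite coef_repr invgK.
by rewrite pairing_theta ?/coef ?rep_adj //; exact: A_vectors_invariant.
Qed.

End Realization.

(** The action of [S], as an element of the dual, on the module of coefficient
    functions. *)
Definition pairing_shift (S : K -> K) (u : G -> C) : G -> C :=
  fun s => phi S (fun t => u (s * t)%g).

Lemma realizationP u : A u ->
  exists (K' : hilbertType R) (rho : unirep G K') xi eta,
    u = coef rho xi eta /\ A_vectors rho eta.
Proof.
move=> Au; have [K' [rho [xi [eta uE]]]] := A_BG Au.
rewrite uE in Au *; have [eta' [_ -> h]] := realization_reduce Au.
by exists K', rho, xi, eta'.
Qed.

Lemma A_pairing_shift S u : spectrum pi S -> A u -> A (pairing_shift S u).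
Proof.
move=> sS /realizationP [K' [rho [xi [eta [-> Neta]]]]].
by rewrite /pairing_shift pairing_translate.
Qed.

Lemma pairing_shift_bounded S : spectrum pi S ->
  exists2 M, 0 <= M & forall u, A u -> BG_norm (pairing_shift S u) <= M * BG_norm u.
Proof.
move=> sS; have [M M0 hM] := pairing_bounded sS; exists M => // u Au.
apply: le_BG_norm => //; first exact: A_BG Au.
move=> K' rho xi eta uE; rewrite uE in Au.
have [eta' [n1 uE' Neta]] := realization_reduce Au.
rewrite uE uE' /pairing_shift pairing_translate //.
apply: le_trans (BG_norm_coef _ _ _) _; rewrite mulrA.
apply: ler_pM; rewrite ?rnorm_ge0 //.
apply: rnorm_le_dot; first by rewrite mulr_ge0 ?rnorm_ge0.
rewrite thetaE //; apply: le_trans (hM _ (A_coef_proj _ _ _)) _.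
rewrite -mulrA ler_wpM2l //; apply: le_trans (BG_norm_coef _ _ _) _.
by rewrite ler_wpM2l ?rnorm_ge0 // (orthoproj_norm (A_vectors_closed rho)).
Qed.

Hypothesis hstar : star_semigroup (spectrum pi).

Lemma spectrum_comp T S : spectrum pi T -> spectrum pi S -> spectrum pi (T \o S).
Proof. by case: hstar => h _; exact: h. Qed.

Lemma spectrum_adj T : spectrum pi T -> spectrum pi (adj T).
Proof. by case: hstar => _; apply. Qed.

(** Both sides are bounded functionals of [u], so that coefficient functions of [pi]
    suffice. *)
Lemma pairing_comp T S u : spectrum pi T -> spectrum pi S -> A u ->
  phi (T \o S) u = phi T (pairing_shift S u).
Proof.
move=> sT sS Au; apply/esym.
apply: (A_functional_ext hA (phi := fun u => phi T (pairing_shift S u))) u Au; last first.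
- move=> xi eta; rewrite pairing_coef //; last exact: spectrum_comp.
  rewrite (_ : pairing_shift S _ = coef pi (S xi) eta) ?pairing_coef //.
  apply/funext => s; rewrite /pairing_shift.
  have -> : (fun t => coef pi xi eta (s * t)%g) = coef pi xi (pi s^-1%g eta).
    by rewrite coef_repr invgK.
  by rewrite pairing_coef // /coef rep_adj.
- exact/pairing_functional/spectrum_comp.
split.
  move=> a u v Au Av; rewrite -pairing_lin //; try exact: A_pairing_shift.
  congr (phi T _); apply/funext => s; rewrite /pairing_shift -pairing_lin //; exact: A_transl.
have [M M0 hM] := pairing_bounded sT; have [N N0 hN] := pairing_shift_bounded sS.
exists (M * N) => u Au; apply: le_trans (hM _ (A_pairing_shift sS Au)) _.
by rewrite -mulrA ler_wpM2l // hN.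
Qed.

(** The involution of [B(G)] that exchanges the two vectors of a coefficient
    function. *)
Definition invol (u : G -> C) : G -> C := fun s => conjc (u s^-1%g).

Lemma invol_coef (K' : hilbertType R) (rho : unirep G K') x y :
  invol (coef rho x y) = coef rho y x.
Proof. by apply/funext => s; rewrite /invol /coef -dotC [in RHS]rep_adj. Qed.

Lemma BG_invol u : BG u -> BG (invol u) /\ BG_norm (invol u) <= BG_norm u.
Proof.
move=> Bu; split.
  by have [K' [rho [x [y ->]]]] := Bu; rewrite invol_coef; exact: BG_coef.
rewrite -[leRHS]mul1r; apply: le_BG_norm => // K' rho x y ->.
by rewrite invol_coef mul1r mulrC; exact: BG_norm_coef.
Qed.

Lemma A_invol u : A u -> A (invol u).
Proof.
move=> [Bu hu]; split; first by have [] := BG_invol Bu.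
move=> e /hu [v Sv [Buv nuv]]; exists (invol v).
  have [n [c [xi [eta ->]]]] := Sv.
  exists n, (fun i => conjc (c i)), eta, xi; apply/funext => s.
  rewrite /invol rmorph_sum; apply: eq_bigr => i _; rewrite rmorphM /=.
  by congr (_ * _); have := congr1 (fun f => f s) (invol_coef pi (xi i) (eta i)).
have -> : invol u \- invol v = invol (u \- v).
  by apply/funext => s; rewrite /invol /= rmorphB.
have [h1 h2] := BG_invol Buv; split => //; exact: le_lt_trans h2 nuv.
Qed.

Lemma pairing_adj T u : spectrum pi T -> A u -> phi (adj T) u = conjc (phi T (invol u)).
Proof.
move=> sT Au; apply: (A_functional_ext hA (psi := fun u => conjc (phi T (invol u)))) u Au.
- exact/pairing_functional/spectrum_adj.
- split.
    move=> a u v Au Av.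
    rewrite (_ : invol _ = fun s => conjc a * invol u s + invol v s).
      by rewrite pairing_lin ?rmorphD ?rmorphM /= ?conjcK //; exact: A_invol.
    by apply/funext => s; rewrite /invol rmorphD rmorphM.
  have [M M0 hM] := pairing_bounded sT; exists M => u Au; rewrite rnorm_conj.
  apply: le_trans (hM _ (A_invol Au)) _; apply: ler_wpM2l => //.
  by have [_] := BG_invol (A_BG Au).
- move=> xi eta; rewrite pairing_coef; last exact: spectrum_adj.
  rewrite invol_coef pairing_coef // -dotC dot_adj //; exact: spectrum_bounded.
Qed.

Section ThetaStar.
Variables (K' : hilbertType R) (rho : unirep G K').
Local Notation P := (orthoproj (A_vectors rho)).
Let hN := A_vectors_closed rho.

Lemma theta_comp T S : spectrum pi T -> spectrum pi S ->
  theta rho (T \o S) = theta rho T \o theta rho S.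
Proof.
move=> sT sS; apply/funext => x; apply: dot_ext => y /=.
rewrite !thetaE //; last exact: spectrum_comp.
rewrite pairing_comp //; last exact: A_coef_proj.
by rewrite /pairing_shift pairing_translate //; exact: (orthoproj_in hN).
Qed.

Lemma theta_adj T x y : spectrum pi T -> dot (theta rho (adj T) x) y = dot x (theta rho T y).
Proof.
move=> sT; rewrite thetaE; last exact: spectrum_adj.
have Nx z : A_vectors rho (P z) by exact: (orthoproj_in hN).
rewrite -(coef_projl _ (Nx y)) pairing_adj //; last exact: A_coef_proj.
by rewrite invol_coef (coef_projl _ (Nx x)) [in RHS]dotC thetaE.
Qed.

Lemma theta_spectrum_rep : spectrum_rep (theta rho).
Proof.
split.
- exact: theta_bounded.
- exact: theta_comp.
- by move=> T sT x y; exact: theta_adj.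
- by move=> x y; exists (coef rho x (P y)) => [|T sT]; [exact: A_coef_proj | exact: thetaE].
Qed.

End ThetaStar.
End SpectrumRepresentations.

(** * Representations induced from open subgroups *)

Section InducedRepresentation.
Variables (R : realType) (H : lcGroupType) (I : finType) (K : hilbertType R).
Variables (N : I -> set H) (beta : I -> H -> K -> K).
Hypotheses (N_subgroup : forall l, is_subgroup (N l)) (N_open : forall l, open (N l))
  (beta_linear : forall l k, N l k -> linear (beta l k))
  (beta1 : forall l x, beta l 1%g x = x)
  (betaM : forall l k k' x, N l k -> N l k' -> beta l (k * k')%g x = beta l k (beta l k' x))
  (beta_unitary : forall l k x y, N l k -> dot (beta l k x) (beta l k y) = dot x y)
  (beta_near : forall l x (e : R), 0 < e ->
     \forall k \near (1%g : H), rnorm (beta l k x - x) < e).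

Lemma open_subgroup1 l : N l 1%g. Proof. by case: (N_subgroup l). Qed.

Lemma open_subgroupV l x : N l x -> N l x^-1%g.
Proof.
by move=> hx; rewrite -(mul1g x^-1%g); apply: (N_subgroup l).2 => //; exact: open_subgroup1.
Qed.

Lemma open_subgroupM l x y : N l x -> N l y -> N l (x * y)%g.
Proof.
by move=> hx hy; rewrite -(invgK y); apply: (N_subgroup l).2 => //; exact: open_subgroupV.
Qed.

(** The coset [N l] is represented by [1], so that [N l] acts on the vectors at
    [(l, 1)] by [beta l] itself. *)
Definition coset_repr l (h : H) : H :=
  if `[< N l h >] then 1%g else xget 1%g [set g | N l (h^-1 * g)%g].

Lemma coset_reprP l h : N l (h^-1 * coset_repr l h)%g.
Proof.
rewrite /coset_repr; case: asboolP => hN; first by rewrite mulg1; exact: open_subgroupV.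
case: xgetP => [//|h0]; by case: (h0 h); rewrite /= mulVg; exact: open_subgroup1.
Qed.

Lemma coset_repr_eq l h h' : N l (h^-1 * h')%g -> coset_repr l h = coset_repr l h'.
Proof.
move=> hh; have hh' : N l (h'^-1 * h)%g by have := open_subgroupV hh; rewrite invgM invgK.
have hN : `[< N l h >] = `[< N l h' >].
  apply/asbool_equiv_eq; split=> hN; first by have := open_subgroupM hN hh; rewrite mulVKg.
  by have := open_subgroupM hN hh'; rewrite mulVKg.
rewrite /coset_repr hN; case: ifP => // _; congr xget; apply/seteqP; split=> g /= hg.
  by have := open_subgroupM hh' hg; rewrite mulgA mulgK.
by have := open_subgroupM hh hg; rewrite mulgA mulgK.
Qed.

Lemma coset_repr_id l h : coset_repr l (coset_repr l h) = coset_repr l h.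
Proof. by apply/esym/coset_repr_eq; exact: coset_reprP. Qed.

Lemma coset_repr1 l h : (coset_repr l h == 1%g) = `[< N l h >].
Proof.
apply/eqP/asboolP => [h1|hN]; last by rewrite /coset_repr asboolT.
by have := open_subgroupV (coset_reprP l h); rewrite h1 mulg1 invgK.
Qed.

Lemma coset_repr_1 l : coset_repr l 1%g = 1%g.
Proof. by apply/eqP; rewrite coset_repr1; apply/asboolP; exact: open_subgroup1. Qed.

(** Elements that represent no coset are fixed and carry the trivial cocycle; thus
    [H] can replace the set of cosets as the index set, for all [l] at once. *)
Definition ind_act (h : H) (li : I * H) : I * H :=
  (li.1, if coset_repr li.1 li.2 == li.2 then coset_repr li.1 (h * li.2)%g else li.2).

Definition ind_cocycle (h : H) (li : I * H) : K -> K :=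
  if coset_repr li.1 li.2 == li.2 then beta li.1 ((coset_repr li.1 (h * li.2))^-1 * (h * li.2))%g
  else id.

Lemma cocycle_N l h : N l ((coset_repr l h)^-1 * h)%g.
Proof. by have := open_subgroupV (coset_reprP l h); rewrite invgM invgK. Qed.

Lemma coset_repr_mul l h i : coset_repr l (h * coset_repr l i)%g = coset_repr l (h * i)%g.
Proof.
apply/esym/coset_repr_eq; rewrite invgM -mulgA mulKg; exact: coset_reprP.
Qed.

Lemma induced_rep : exists rho : unirep H (l2 (I * H)%type K),
  forall g l v l' w, dot (rho g (l2_delta (l, 1%g) v)) (l2_delta (l', 1%g) w) =
    if (l == l') && `[< N l g >] then dot (beta l g v) w else 0.
Proof.
have [|||||||rho hrho] := @monomial_rep R H (I * H)%type K ind_act ind_cocycle.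
- by move=> [l i]; rewrite /ind_act /= mul1g; case: eqP => // ->.
- move=> s t [l i]; rewrite /ind_act /=; case: (eqVneq (coset_repr l i) i) => [hi|hi].
    by rewrite coset_repr_id eqxx coset_repr_mul mulgA.
  by rewrite (negbTE hi).
- move=> s [l i]; rewrite /ind_cocycle /=; case: ifP => // _.
  exact/beta_linear/cocycle_N.
- move=> [l i] x; rewrite /ind_cocycle /= mul1g; case: eqP => // ->.
  by rewrite mulVg beta1.
- move=> s t [l i] x; rewrite /ind_cocycle /ind_act /=.
  case: (eqVneq (coset_repr l i) i) => [hi|hi]; last by rewrite (negbTE hi).
  rewrite coset_repr_id eqxx coset_repr_mul mulgA -betaM.
  + by rewrite !mulgA mulgK.
  + by rewrite -(coset_repr_mul l s (t * i)%g); exact: cocycle_N.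
  + exact: cocycle_N.
- move=> s [l i] x y; rewrite /ind_cocycle /=; case: ifP => // _.
  exact/beta_unitary/cocycle_N.
- move=> [l i] x e e0; rewrite /ind_act /ind_cocycle /=.
  case: (eqVneq (coset_repr l i) i) => [hi|hi]; last first.
    by near=> s; rewrite subrr rnorm0.
  have hc : (fun s : H => i^-1 * (s * i))%g @ (1%g : H) --> (1%g : H).
    have := @continuous_comp H H H (fun s => s * i)%g (fun s => i^-1 * s)%g 1%g
      (@lcg_mulr_continuous H i _) (@lcg_mull_continuous H i^-1%g _).
    by rewrite /prop_for /continuous_at /= mul1g mulVg.
  have h1 : \forall s \near (1%g : H), N l (i^-1 * (s * i))%g.
    by apply: hc; apply: open_nbhs_nbhs; split; [exact: N_open | exact: open_subgroup1].
  have h2 : \forall s \near (1%g : H), rnorm (beta l (i^-1 * (s * i))%g x - x) < e.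
    exact: hc _ (beta_near l x e0).
  near=> s.
  have hs : coset_repr l (s * i)%g = i.
    by rewrite -[RHS]hi; apply/esym/coset_repr_eq; near: s.
  by rewrite hs; split => //; near: s.
exists rho => g l v l' w; rewrite hrho dot_delta /ind_act /ind_cocycle /=.
rewrite coset_repr_1 eqxx mulg1 xpair_eqE coset_repr1.
case: (l == l') => //=; case: asboolP => // hN.
by have /eqP -> : coset_repr l g == 1%g; [rewrite coset_repr1; apply/asboolP | rewrite invg1 mul1g].
Unshelve. all: by end_near.
Qed.

End InducedRepresentation.

(** * Affine maps as matrix coefficients *)

Section AffineUnitary.
Variables (R : realType) (H : lcGroupType) (K : hilbertType R).
Local Notation C := R[i].

Definition coset_closed (E : set H) : Prop :=
  forall x y z, E x -> E y -> E z -> E (x * y^-1 * z)%g.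

(** The values of [B] are unitary on the range of [P] and vanish on its orthogonal
    complement; [Bs h] is the adjoint of [B h]. *)
Record affine_unitary (E : set H) (B Bs : H -> K -> K) (P : K -> K) : Prop := AffineUnitary {
  au_linear : forall h, E h -> linear (B h) ;
  au_adj : forall h x y, E h -> dot (Bs h x) y = dot x (B h y) ;
  au_affine : forall x y z v, E x -> E y -> E z ->
    B (x * y^-1 * z)%g v = B x (Bs y (B z v)) ;
  au_proj : orthogonal_projection P ;
  au_l : forall h v, E h -> Bs h (B h v) = P v ;
  au_r : forall h v, E h -> B h (Bs h v) = P v ;
  au_near : forall h xi eta (e : R), E h -> 0 < e ->
    \forall k \near h, rnorm (dot (B k xi) eta - dot (B h xi) eta) < e
}.

Section OnePiece.
Variables (E : set H) (B Bs : H -> K -> K) (P : K -> K) (x0 : H).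
Hypotheses (cE : coset_closed E) (oE : open E) (Ex0 : E x0) (au : affine_unitary E B Bs P).

Let hP := au_proj au.
Let lP : linear P := hP.1.

Lemma au_adj_sym h x y : E h -> dot (B h x) y = dot x (Bs h y).
Proof. by move=> Eh; rewrite dotC -(au_adj au) // -dotC. Qed.

Lemma au_adj_linear h : E h -> linear (Bs h).
Proof.
move=> Eh a x y; apply: dot_ext => z.
by rewrite (au_adj au) // !dotDl !dotZl !(au_adj au).
Qed.

Lemma au_kernel h v : E h -> B h (v - P v) = 0.
Proof.
move=> Eh; apply: dotxx_eq0; rewrite au_adj_sym // (au_l au) //.
by rewrite (linB _ _ lP) projection_idem // subrr dot0r.
Qed.

Lemma au_projr h v : E h -> B h (P v) = B h v.
Proof.
move=> Eh; apply/esym/subr0_eq; rewrite -(linB _ _ (au_linear au Eh)).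
exact: au_kernel.
Qed.

Lemma au_projl h v : E h -> P (B h v) = B h v.
Proof. by move=> Eh; rewrite -(au_r au (h := h)) // (au_l au) // au_projr. Qed.

Lemma au_adj_projl h v : E h -> P (Bs h v) = Bs h v.
Proof.
move=> Eh; apply: dot_ext => y.
by rewrite (projection_sym hP) !(au_adj au) // au_projr.
Qed.

Lemma au_adj_norm h v : E h -> rnorm (Bs h v) <= rnorm v.
Proof.
move=> Eh; rewrite -(@ler_pXn2r _ 2) ?nnegrE ?rnorm_ge0 // -lecR -dotxx.
rewrite (au_adj au) // (au_r au) // -(projection_sym hP) -hP.2 dotxx lecR.
by rewrite ler_pXn2r ?nnegrE ?rnorm_ge0 // projection_le.
Qed.

Definition stab : set H := [set k | E (x0 * k)%g].

(** Adding the identity on the orthogonal complement of the range of [P] makes the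
    operators unitary on all of [K], so that no smaller space is needed. *)
Definition stab_unitary (k : H) (v : K) : K := Bs x0 (B (x0 * k)%g v) + (v - P v).

Lemma stab_subgroup : is_subgroup stab.
Proof.
split; first by rewrite /stab /= mulg1.
move=> x y /= hx hy; rewrite /stab /=.
have -> : (x0 * (x * y^-1))%g = ((x0 * x) * (x0 * y)^-1 * x0)%g.
  by rewrite invgM !mulgA mulgVK.
exact: cE.
Qed.

Lemma stab_open : open stab.
Proof. by apply: (continuousP _).1 => //; exact: lcg_mull_continuous. Qed.

Lemma stab_unitary_linear k : stab k -> linear (stab_unitary k).
Proof.
move=> hk a v w; rewrite /stab_unitary (au_linear au hk) (au_adj_linear Ex0) lP.
by rewrite scalerDr [RHS]addrACA; congr (_ + _); rewrite opprD addrACA -scalerBr.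
Qed.

Lemma stab_unitary1 v : stab_unitary 1%g v = v.
Proof. by rewrite /stab_unitary mulg1 (au_l au) // addrCA subrr addr0. Qed.

Lemma stab_unitaryM k k' v : stab k -> stab k' ->
  stab_unitary (k * k')%g v = stab_unitary k (stab_unitary k' v).
Proof.
move=> hk hk'; rewrite /stab_unitary; set r := v - P v; set w := Bs x0 (B (x0 * k')%g v).
rewrite (linD _ _ (au_linear au hk)) au_kernel // addr0.
rewrite (linD _ _ lP) {2 3}/w au_adj_projl // [P r](linB _ _ lP) projection_idem // subrr addr0.
have -> : w + r - Bs x0 (B (x0 * k')%g v) = r by rewrite -/w addrAC subrr add0r.
congr (_ + _); rewrite /w -(au_affine au) //.
by rewrite !mulgA mulgVK.
Qed.

Lemma stab_unitary_unitary k v w : stab k -> dot (stab_unitary k v) (stab_unitary k w) = dot v w.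
Proof.
move=> hk; rewrite /stab_unitary.
have orth a u : dot (Bs x0 a) (u - P u) = 0.
  rewrite -(au_adj_projl a Ex0) (projection_sym hP) (linB _ _ lP).
  by rewrite projection_idem // subrr dot0r.
rewrite dotDl ![dot _ (Bs _ _ + _)]dotDr orth addr0 [dot (v - P v) (Bs _ _)]dotC orth conjc0 add0r.
rewrite (au_adj au) // (au_r au) // au_projl // au_adj_sym // (au_l au) //.
by rewrite dotBl !dotBr hP.2 (projection_sym hP) subrr subr0 addrC subrK.
Qed.

(** For unitary operators strong continuity follows from weak continuity, as
    [|U v - v|^2 = 2 |v|^2 - 2 Re <U v, v>]. *)
Lemma stab_unitary_near v (e : R) : 0 < e ->
  \forall k \near (1%g : H), rnorm (stab_unitary k v - v) < e.
Proof.
move=> e0; have e2 : 0 < e ^+ 2 / 2 by rewrite divr_gt0 ?exprn_gt0.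
have hc : (fun k : H => x0 * k)%g @ (1%g : H) --> x0.
  by have := @lcg_mull_continuous H x0 1%g; rewrite /continuous_at mulg1.
have h1 : \forall k \near (1%g : H),
    rnorm (dot (B (x0 * k)%g v) (B x0 v) - dot (B x0 v) (B x0 v)) < e ^+ 2 / 2.
  exact: hc _ (au_near au v (B x0 v) Ex0 e2).
have h2 : \forall k \near (1%g : H), stab k.
  apply: open_nbhs_nbhs; split; [exact: stab_open | exact: stab_subgroup.1].
near=> k.
have hk : stab k by near: k.
have nk : rnorm (stab_unitary k v) = rnorm v.
  by apply: rnorm_dot_eq; rewrite stab_unitary_unitary.
have dk : dot (stab_unitary k v) v - dot v v =
    dot (B (x0 * k)%g v) (B x0 v) - dot (B x0 v) (B x0 v).
  have -> : dot (B x0 v) (B x0 v) = dot (P v) v.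
    by rewrite au_adj_sym // (au_l au) // -(projection_sym hP).
  by rewrite /stab_unitary dotDl (au_adj au) // dotBl; ring.
have hlt : rnorm (dot (stab_unitary k v) v - dot v v) < e ^+ 2 / 2 by rewrite dk; near: k.
rewrite -(@ltr_pXn2r _ 2) ?nnegrE ?rnorm_ge0 ?ltW // normsqB nk.
have := le_lt_trans (ler_Re _) hlt; rewrite raddfB /= dotxx /=.
rewrite ltr_norml => /andP[h3 _]; lra.
Unshelve. all: by end_near.
Qed.

Lemma stab_unitary_coef h xi eta : E h ->
  dot (stab_unitary (x0^-1 * h)%g (P xi)) (Bs x0 eta) = dot (B h xi) eta.
Proof.
move=> Eh; rewrite /stab_unitary mulVKg projection_idem // subrr addr0 au_projr //.
by rewrite (au_adj au) // (au_r au) // -(projection_sym hP) au_projl.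
Qed.

End OnePiece.

Variable I : finType.
Variables (E : I -> set H) (B Bs : I -> H -> K -> K) (P : I -> K -> K) (x0 : I -> H) (eps : I -> C).
Hypotheses (cE : forall l, coset_closed (E l)) (oE : forall l, open (E l))
  (Ex0 : forall l, E l (x0 l))
  (au : forall l, affine_unitary (E l) (B l) (Bs l) (P l)) (eps1 : forall l, rnorm (eps l) <= 1).

(** The coset [E l] is the translate by [x0 l] of the subgroup that carries the
    induced representation, and [V'] contains that translation. *)
Lemma affine_matrix_coefficient :
  exists (rho : unirep H (l2 (I * H)%type K)) (V V' : K -> l2 (I * H)%type K),
    [/\ linear V /\ bounded_by #|I|%:R V, linear V' /\ bounded_by #|I|%:R V' &
        forall h xi eta, dot (rho h (V xi)) (V' eta) =
          \sum_l eps l * (if `[< E l h >] then dot (B l h xi) eta else 0)].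
Proof.
have [|||||||rho hrho] := @induced_rep R H I K (fun l => stab (E l) (x0 l))
  (fun l => stab_unitary (B l) (Bs l) (P l) (x0 l)).
- by move=> l; exact: stab_subgroup.
- by move=> l; exact: stab_open.
- by move=> l k; exact: stab_unitary_linear.
- by move=> l v; exact: (stab_unitary1 (Ex0 l) (au l)).
- by move=> l k k' v; exact: stab_unitaryM.
- by move=> l k v w; exact: (stab_unitary_unitary (Ex0 l) (au l)).
- by move=> l v e; exact: stab_unitary_near.
pose V xi := \sum_l l2_delta (l, 1%g : H) (P l xi).
pose V' eta := \sum_l conjc (eps l) *: rho (x0 l) (l2_delta (l, 1%g : H) (Bs l (x0 l) eta)).
have dl l := @l2_delta_linear R _ K (l, 1%g : H).
exists rho, V, V'; split.
- split.
    move=> a u v; rewrite /V scaler_sumr -big_split; apply: eq_bigr => l _ /=.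
    by rewrite (au_proj (au l)).1 dl.
  move=> xi; apply: le_trans (rnorm_sum _ _ _) _.
  rewrite mulr_natl -sumr_const; apply: ler_sum => l _; rewrite rnorm_delta.
  exact: projection_le (au_proj (au l)) _.
- split.
    move=> a u v; rewrite /V' scaler_sumr -big_split; apply: eq_bigr => l _ /=.
    rewrite (au_adj_linear (au l) (Ex0 l)) dl (@rep_linear _ _ _ rho (x0 l)).
    by rewrite scalerDr !scalerA mulrC.
  move=> eta; apply: le_trans (rnorm_sum _ _ _) _.
  rewrite mulr_natl -sumr_const; apply: ler_sum => l _.
  rewrite rnormZ rnorm_conj rep_norm rnorm_delta -[leRHS]mul1r.
  by apply: ler_pM; rewrite ?rnorm_ge0 //; exact: (au_adj_norm (au l)).
move=> h xi eta; rewrite /V /V' (lin_sum _ _ _ (@rep_linear _ _ _ rho h)) dot_sumr.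
apply: eq_bigr => l _; rewrite dotZr conjcK; congr (_ * _).
rewrite dot_suml (bigD1 l) //= big1 ?addr0 => [|l' /negbTE l'l].
  rewrite -[x0 l]invgK -rep_adj -repME hrho eqxx /= /stab /= mulVKg invgK.
  by case: asboolP => // Eh; exact: (stab_unitary_coef (Ex0 l) (au l)).
by rewrite -[x0 l]invgK -rep_adj -repME hrho l'l.
Qed.

End AffineUnitary.

(** * Open cosets *)

Section Cosets.
Variable H : lcGroupType.
Implicit Types (E Z S : set H).

Lemma is_coset_closed E : is_coset E -> coset_closed E.
Proof.
move=> [a [N [[N1 NB] ->]]] x y z [k Nk <-] [k' Nk' <-] [k'' Nk'' <-].
exists (k * k'^-1 * k'')%g; last by rewrite invgM !mulgA mulgVK.
have Nk3 : N k''^-1%g by rewrite -(mul1g k''^-1%g); exact: NB.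
by rewrite -(invgK k''); exact: (NB _ _ (NB _ _ Nk Nk') Nk3).
Qed.

Lemma Aff_sub S : S `<=` Aff S.
Proof. exact: sub_smallest. Qed.

Lemma Aff_le S E : is_coset E -> S `<=` E -> Aff S `<=` E.
Proof. by move=> cE SE; apply: smallest_sub. Qed.

(** Closure under the ternary operation passes to intersections. *)
Lemma Aff_closed S : coset_closed (Aff S).
Proof.
move=> x y z hx hy hz E [/= cE SE].
by apply: is_coset_closed => //; [exact: hx | exact: hy | exact: hz].
Qed.

(** Translations inside [E] carry an interior point to every point of [E]. *)
Lemma coset_open E Z : coset_closed E -> open Z -> Z `<=` E -> Z !=set0 -> open E.
Proof.
move=> cE oZ ZE [z Zz]; rewrite openE => h Eh; rewrite /interior.
have hc : (fun k : H => k * (h^-1 * z))%g @ h --> z.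
  by have := @lcg_mulr_continuous H (h^-1 * z)%g h; rewrite /continuous_at mulVKg.
have : \forall k \near h, Z (k * (h^-1 * z))%g by apply: hc; exact: open_nbhs_nbhs.
apply: filterS => k /ZE Ek.
by have := cE _ _ _ Ek (ZE _ Zz) Eh; rewrite mulgA mulgK mulgVK.
Qed.

(** An open coset is closed: its other translates are open. *)
Lemma coset_near_compl E h : coset_closed E -> open E -> ~ E h -> \forall k \near h, ~ E k.
Proof.
move=> cE oE nEh; have [[y Ey]|nE] := pselect (E !=set0); last first.
  by near=> k => Ek; apply: nE; exists k.
have hc : (fun k : H => y * k^-1 * h)%g @ h --> y.
  have : {for h, continuous (fun k : H => y * k^-1 * h)%g}.
    apply: (@continuous_comp H H H (fun k => k^-1)%g (fun k => y * k * h)%g).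
      exact: lcg_inv_continuous.
    apply: (@continuous_comp H H H (fun k => y * k)%g (fun k => k * h)%g).
      exact: lcg_mull_continuous.
    exact: lcg_mulr_continuous.
  by rewrite /prop_for /continuous_at /= mulgVK.
have : \forall k \near h, E (y * k^-1 * h)%g by apply: hc; exact: open_nbhs_nbhs.
apply: filterS => k h1 Ek; apply: nEh.
by have := cE _ _ _ Ek Ey h1; rewrite !mulgA mulgVK mulgV mul1g.
Unshelve. all: by end_near.
Qed.

Lemma Omega0_open Z : Omega0 Z -> open Z.
Proof.
move=> [E0 [m [E [[_ oE0] hE ->]]]]; rewrite openE => h [E0h nE]; rewrite /interior.
have h1 : \forall k \near h, E0 k by exact: open_nbhs_nbhs.
have h2 : \forall k \near h, forall i : 'I_m, ~ E i k.
  apply: filter_forall => i; have [[ci oi] _ _] := hE i.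
  by apply: coset_near_compl => //; [exact: is_coset_closed | move=> Eih; apply: nE; exists i].
by near=> k; split; [near: k | move=> [i _]; move: (i); near: k].
Unshelve. all: by end_near.
Qed.

End Cosets.

(** * Piecewise affine maps as signed sums over open cosets *)

Section Decomposition.
Variables (R : realType) (G H : lcGroupType) (K : hilbertType R) (pi : unirep G K).
Hypotheses (hA : closed_invariant_subalgebra (A_ pi)) (hstar : star_semigroup (spectrum pi)).
Local Notation C := R[i].
Local Notation A := (A_ pi).
Local Notation phi := (pairing pi).
Implicit Types (E Z : set H) (b : H -> K -> K) (p : K -> K).

Record affine_piece E b p : Prop := AffinePiece {
  ap_closed : coset_closed E ;
  ap_open : open E ;
  ap_proj : spectrum pi p /\ is_proj p ;
  ap_group : forall h, E h -> Dgroup pi p (b h) ;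
  ap_affine : forall x y z, E x -> E y -> E z ->
    b (x * y^-1 * z)%g = (b x \o adj (b y)) \o b z ;
  ap_near : forall u h (e : R), A u -> E h -> 0 < e ->
    \forall k \near h, rnorm (phi (b k) u - phi (b h) u) < e
}.

Lemma affine_pieceI E E' b p : affine_piece E b p -> coset_closed E' -> open E' ->
  affine_piece (E `&` E') b p.
Proof.
move=> [h1 h2 h3 h4 h5 h6] c o; split=> //.
- by move=> x y z [? ?] [? ?] [? ?]; split; [exact: h1 | exact: c].
- exact: openI.
- by move=> h [/h4].
- by move=> x y z [? _] [? _] [? _]; exact: h5.
- by move=> u h e Au [Eh _]; exact: h6.
Qed.

(** In use, [f h u] is [j u h].  A combination with bounded coefficients is allowed
    because only the number of terms enters the final constant. *)
Definition decomposable (f : H -> (G -> C) -> C) : Prop :=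
  exists (I : finType) (E : I -> set H) (b : I -> H -> K -> K) (p : I -> K -> K)
    (x0 : I -> H) (eps : I -> C),
  [/\ forall l, affine_piece (E l) (b l) (p l), forall l, E l (x0 l),
      forall l, rnorm (eps l) <= 1 &
      forall h u, A u -> f h u = \sum_l eps l * (if `[< E l h >] then phi (b l h) u else 0)].

Lemma decomposable_eq f g : (forall h u, A u -> f h u = g h u) -> decomposable f -> decomposable g.
Proof.
move=> fg [I [E [b [p [x0 [eps [h1 h2 h3 h4]]]]]]].
by exists I, E, b, p, x0, eps; split=> // h u Au; rewrite -fg // h4.
Qed.

Lemma decomposable0 : decomposable (fun _ _ => 0).
Proof.
exists 'I_0, (fun=> set0), (fun _ _ => id), (fun _ => id), (fun=> 1%g), (fun=> 0).
by split=> [[]//|[]//|[]//|h u _]; rewrite big_ord0.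
Qed.

Lemma decomposableD f g : decomposable f -> decomposable g ->
  decomposable (fun h u => f h u + g h u).
Proof.
move=> [I [E [b [p [x0 [eps [h1 h2 h3 h4]]]]]]] [J [E' [b' [p' [x0' [eps' [h1' h2' h3' h4']]]]]]].
exists (I + J)%type, (fun l => match l with inl i => E i | inr j => E' j end),
  (fun l => match l with inl i => b i | inr j => b' j end),
  (fun l => match l with inl i => p i | inr j => p' j end),
  (fun l => match l with inl i => x0 i | inr j => x0' j end),
  (fun l => match l with inl i => eps i | inr j => eps' j end).
split; try by case.
by move=> h u Au; rewrite h4 // h4' // big_sumType.
Qed.

Lemma decomposableN f : decomposable f -> decomposable (fun h u => - f h u).
Proof.
move=> [I [E [b [p [x0 [eps [h1 h2 h3 h4]]]]]]].
exists I, E, b, p, x0, (fun l => - eps l); split=> // [l|h u Au]; first by rewrite rnormN.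
by rewrite h4 // -sumrN; apply: eq_bigr => l _; rewrite mulNr.
Qed.

Lemma decomposable_sum n (f : 'I_n -> H -> (G -> C) -> C) :
  (forall i, decomposable (f i)) -> decomposable (fun h u => \sum_i f i h u).
Proof.
elim: n f => [|n IH] f hf.
  by apply: decomposable_eq decomposable0 => h u _; rewrite big_ord0.
apply: decomposable_eq (decomposableD (hf ord0) (IH _ (fun i => hf (lift ord0 i)))) => h u _.
by rewrite big_ord_recl.
Qed.

Definition restricted (Z : set H) b : H -> (G -> C) -> C :=
  fun h u => if `[< Z h >] then phi (b h) u else 0.

Lemma decomposable_piece E b p : affine_piece E b p -> decomposable (restricted E b).
Proof.
move=> hE; have [[x Ex]|nE] := pselect (E !=set0).
  exists 'I_1, (fun=> E), (fun=> b), (fun=> p), (fun=> x), (fun=> 1).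
  split=> // [l|h u _]; last by rewrite big_ord1 mul1r.
  by rewrite rnorm_real normr1.
apply: decomposable_eq decomposable0 => h u _; rewrite /restricted asboolF // => Eh.
by apply: nE; exists h.
Qed.

(** Inclusion-exclusion, one removed coset at a time. *)
Lemma decomposable_diff m (E' : 'I_m -> set H) E b p : affine_piece E b p ->
  (forall k, coset_closed (E' k) /\ open (E' k)) ->
  decomposable (restricted (E `\` \bigcup_(k in [set: 'I_m]) E' k) b).
Proof.
elim: m E' E => [|m IH] E' E hE hE'.
  have -> : E `\` \bigcup_(k in [set: 'I_0]) E' k = E.
    by apply/seteqP; split=> [x []//|x Ex]; split=> // -[[]].
  exact: decomposable_piece hE.
have hE1 : affine_piece (E `&` E' ord0) b p by apply: affine_pieceI => //; apply (hE' ord0).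
have h1 := IH _ _ hE (fun k => hE' (lift ord0 k)).
have h2 := IH _ _ hE1 (fun k => hE' (lift ord0 k)).
apply: decomposable_eq (decomposableD h1 (decomposableN h2)) => h u _.
have bE (Q : set H) : `[< (Q `\` \bigcup_(k in [set: 'I_m.+1]) E' k) h >] =
    `[< (Q `\` \bigcup_(k in [set: 'I_m]) E' (lift ord0 k)) h >] && ~~ `[< E' ord0 h >].
  apply/asboolP/andP => [[Qh nh]|[/asboolP [Qh nh] /asboolP n0]].
    split; last by apply/asboolP => E0; apply: nh; exists ord0.
    by apply/asboolP; split=> // -[k _ Ek]; apply: nh; exists (lift ord0 k).
  split=> // -[k _]; case: (unliftP ord0 k) => [j ->|->] // Ek.
  by apply: nh; exists j.
rewrite /restricted bE.
have -> : `[< ((E `&` E' ord0) `\` \bigcup_(k in [set: 'I_m]) E' (lift ord0 k)) h >] =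
    `[< (E `\` \bigcup_(k in [set: 'I_m]) E' (lift ord0 k)) h >] && `[< E' ord0 h >].
  by apply/asboolP/andP => [[[? ?] ?]|[/asboolP [? ?] /asboolP ?]]; split=> //; apply/asboolP.
case: `[< (E `\` _) h >] => /=; last by rewrite subr0.
by case: `[< E' ord0 h >] => /=; rewrite ?subrr ?subr0.
Qed.

Lemma restricted_union n (Z : 'I_n -> set H) (Y : set H) b h u :
  trivIset [set: 'I_n] Z -> Y = \bigcup_(i in [set: 'I_n]) Z i ->
  restricted Y b h u = \sum_i restricted (Z i) b h u.
Proof.
move=> tZ ->; rewrite /restricted; case: asboolP => [[i _ Zi]|nY].
  rewrite (bigD1 i) //= asboolT // big1 ?addr0 // => j ji; rewrite asboolF // => Zj.
  by move/eqP: ji; apply; apply: tZ => //; exists h.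
by rewrite big1 // => i _; rewrite asboolF // => Zi; apply: nY; exists i.
Qed.

Section Pieces.
Variables (Y : set H) (alpha : H -> K -> K).
Hypotheses (hcont : weakstar_continuous pi Y alpha).

(** Weak* continuity spreads from the open set [Z] to the coset that it
    generates, along [b k = b (k h^-1 z) b(z)^* b(h)]. *)
Lemma affine_piece_Aff Z p b : Omega0 Z -> Z !=set0 -> Z `<=` Y ->
  spectrum pi p /\ is_proj p ->
  affine_map (Dgroup pi p) (fun x y => x \o y) (@adj R K) (Aff Z) b ->
  (forall h, Z h -> alpha h = b h) -> affine_piece (Aff Z) b p.
Proof.
move=> hZ Z0 ZY hp [bD bM] ab; have oZ := Omega0_open hZ.
have sb h : Aff Z h -> spectrum pi (b h) by move=> /bD [].
split=> //; [exact: Aff_closed | exact: coset_open (@Aff_closed _ _) oZ (@Aff_sub _ _) Z0 |].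
move=> u h e Au Ah e0; have [z Zz] := Z0; have Az := Aff_sub Zz.
pose c := adj (b z) \o b h.
have sc : spectrum pi c.
  by apply: spectrum_comp => //; [apply: spectrum_adj => //; exact: sb | exact: sb].
have Av := A_pairing_shift hA sc Au; set v := pairing_shift pi c u in Av.
have /subspace_continuousP /(_ z (ZY _ Zz)) /cvg_rnormP /(_ e e0) hz := hcont Av.
have hz' : \forall k \near z, Z k -> rnorm (phi (alpha z) v - phi (alpha k) v) < e.
  by move: hz; rewrite /prop_near1 nbhs_filterE /within /=; apply: filterS => k hk /ZY.
have hc : (fun k : H => k * (h^-1 * z))%g @ h --> z.
  by have := @lcg_mulr_continuous H (h^-1 * z)%g h; rewrite /continuous_at mulVKg.
have h1 : \forall k \near h, Z (k * (h^-1 * z))%g by apply: hc; exact: open_nbhs_nbhs.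
have h2 : \forall k \near h, Z (k * (h^-1 * z))%g ->
    rnorm (phi (alpha z) v - phi (alpha (k * (h^-1 * z))%g) v) < e := hc _ hz'.
have key k : Z (k * (h^-1 * z))%g -> phi (b k) u = phi (alpha (k * (h^-1 * z))%g) v.
  move=> Zk; have Ak := Aff_sub Zk.
  have {1}-> : k = ((k * (h^-1 * z)) * z^-1 * h)%g by rewrite !mulgA mulgK mulgVK.
  rewrite bM // -pairing_comp // ?ab //; exact: sb.
near=> k.
have Zk : Z (k * (h^-1 * z))%g by near: k.
have -> : phi (b h) u = phi (alpha z) v.
  by rewrite key mulVKg.
rewrite key // rnormBC; move: (Zk); near: k; exact: h2.
Unshelve. all: by end_near.
Qed.

End Pieces.
End Decomposition.

Section PiecewiseAffine.
Variables (R : realType) (G H : lcGroupType) (K : hilbertType R) (pi : unirep G K).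
Hypotheses (hA : closed_invariant_subalgebra (A_ pi)) (hstar : star_semigroup (spectrum pi)).
Variables (Y : set H) (alpha : H -> K -> K).
Hypotheses (hcont : weakstar_continuous pi Y alpha).
Local Notation C := R[i].

Lemma decomposable_piecewise Z p a : Z `<=` Y -> (forall h, Z h -> alpha h = a h) ->
  spectrum pi p /\ is_proj p ->
  piecewise_affine (Dgroup pi p) (fun x y => x \o y) (@adj R K) Z a ->
  decomposable pi (restricted pi Z alpha).
Proof.
move=> ZY ha hp [n [W [hW tW ZE hb]]].
apply: (@decomposable_eq _ _ _ _ pi (fun h u => \sum_i restricted pi (W i) alpha h u)).
  by move=> h u _; rewrite -(restricted_union _ _ _ _ tW ZE).
apply: decomposable_sum => i; have [b [hb1 hb2]] := hb i.
have WZ : W i `<=` Z by rewrite ZE => h Wh; exists i.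
have [Wne|Wem] := pselect (W i !=set0); last first.
  apply: decomposable_eq (decomposable0 H pi) => h u _; rewrite /restricted asboolF // => Wh.
  by apply: Wem; exists h.
have ab h : W i h -> alpha h = b h by move=> Wh; rewrite ha ?hb2 //; exact: WZ.
have hE := affine_piece_Aff hA hstar hcont (hW i) Wne (subset_trans WZ ZY) hp hb1 ab.
have [E0 [m [E [[cE0 _] hEk WE]]]] := hW i.
(* The coset [E0] may be replaced by the smaller [Aff (W i)]. *)
have WAff : W i = Aff (W i) `\` \bigcup_(k in [set: 'I_m]) E k.
  apply/seteqP; split=> [h Wh|h [Ah nEh]].
    split; first exact: Aff_sub.
    by move: Wh; rewrite WE => -[].
  rewrite WE; split=> //; apply: (Aff_le cE0) Ah.
  by rewrite WE => x [].
have hd : decomposable pi (restricted pi (Aff (W i) `\` \bigcup_(k in [set: 'I_m]) E k) b).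
  apply: (decomposable_diff hE) => k; have [[ck ok] _ _] := hEk k.
  by split=> //; exact: is_coset_closed.
apply: decomposable_eq hd => h u _; rewrite -WAff /restricted.
by case: asboolP => // Wh; rewrite ab.
Qed.

Lemma decomposable_pw2 : pw2_affine pi Y alpha -> decomposable pi (restricted pi Y alpha).
Proof.
move=> [n [p [Z [a [hp pa tZ YE ha]]]]].
apply: (@decomposable_eq _ _ _ _ pi (fun h u => \sum_i restricted pi (Z i) alpha h u)).
  by move=> h u _; rewrite -(restricted_union _ _ _ _ tZ YE).
apply: decomposable_sum => i.
apply: (decomposable_piecewise _ _ (hp i) (pa i)); last exact: ha.
by rewrite YE => h Zh; exists i.
Qed.

End PiecewiseAffine.

Section PieceOperators.
Variables (R : realType) (G H : lcGroupType) (K : hilbertType R) (pi : unirep G K).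
Hypotheses (hA : closed_invariant_subalgebra (A_ pi)) (hstar : star_semigroup (spectrum pi)).
Variables (K' : hilbertType R) (theta : (K -> K) -> K' -> K').
Hypothesis htheta : spectrum_rep pi theta.

Lemma affine_unitary_piece E b p : affine_piece (H := H) pi E b p ->
  affine_unitary E (fun h => theta (b h)) (fun h => theta (adj (b h))) (theta p).
Proof.
move=> hE; have [tb tM ta tv] := htheta.
have [sp [pp pa]] := ap_proj hE.
have sb h : E h -> spectrum pi (b h) by move=> /(ap_group hE) [].
have sa h : E h -> spectrum pi (adj (b h)) by move=> Eh; apply: spectrum_adj => //; exact: sb.
split.
- by move=> h Eh; have [] := tb _ (sb _ Eh).
- by move=> h x y Eh; exact: ta (sb _ Eh) _ _.
- move=> x y z v Ex Ey Ez; rewrite (ap_affine hE) //.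
  rewrite (tM _ _ (spectrum_comp hstar (sb _ Ex) (sa _ Ey)) (sb _ Ez)).
  by rewrite (tM _ _ (sb _ Ex) (sa _ Ey)).
- have [lp _] := tb _ sp; split=> // x y.
  rewrite -(ta _ sp) pa.
  by have := congr1 (fun f => f x) (tM _ _ sp sp); rewrite pp /= => <-.
- move=> h v Eh; have [_ hl _] := ap_group hE Eh.
  by rewrite -hl (tM _ _ (sa _ Eh) (sb _ Eh)).
- move=> h v Eh; have [_ _ hr] := ap_group hE Eh.
  by rewrite -hr (tM _ _ (sb _ Eh) (sa _ Eh)).
move=> h xi eta e Eh e0; have [v Av hv] := tv xi eta.
have h1 : \forall k \near h, E k by apply: open_nbhs_nbhs; split=> //; exact: ap_open hE.
have h2 := ap_near hE Av Eh e0.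
near=> k; have Ek : E k by near: k.
by rewrite !hv; [near: k | exact: sb | exact: sb].
Unshelve. all: by end_near.
Qed.

End PieceOperators.

(** * Matrix norms *)

Section OpmxNorm.
Variable R : realType.
Local Notation C := R[i].

Lemma opmx_norm_le1 (V : normedModType C) (I : finType) (T : I -> I -> V -> V) :
  contractive_mx T -> (opmx_norm T <= 1)%E.
Proof.
move=> hT; apply: ge_ereal_sup => _ [x hx ->]; rewrite lee_fin.
by rewrite -sqrtr1 ler_sqrt ?ler01 //; apply: le_trans (hT x) hx.
Qed.

(** By homogeneity; [t] scales the vector [x] into the unit ball. *)
Lemma opmx_norm_contractive (V : normedModType C) (I : finType) (T : I -> I -> V -> V) :
  (forall i j, linear (T i j)) -> (opmx_norm T <= 1)%E -> contractive_mx T.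
Proof.
move=> lT hT x; pose s := \sum_j rnorm (x j) ^+ 2; rewrite -/s.
have s0 : 0 <= s by apply: sumr_ge0 => j _; exact: sqr_ge0.
have ub t : 0 < t -> t ^+ 2 * s <= 1 -> t ^+ 2 * \sum_i rnorm (\sum_j T i j (x j)) ^+ 2 <= 1.
  move=> t0 ts.
  have : ((Num.sqrt (\sum_i rnorm (\sum_j T i j (t%:C *: x j)) ^+ 2))%:E
      <= 1)%E.
    apply: (le_trans _ hT); apply: ereal_sup_ubound; exists (fun j => t%:C *: x j) => //.
    under eq_bigr do rewrite rnormZ rnorm_real gtr0_norm // exprMn.
    by rewrite -mulr_sumr.
  rewrite lee_fin -[X in _ <= X]sqrtr1 ler_sqrt ?ler01 //.
  have -> : \sum_i rnorm (\sum_j T i j (t%:C *: x j)) ^+ 2 =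
            t ^+ 2 * \sum_i rnorm (\sum_j T i j (x j)) ^+ 2.
    rewrite mulr_sumr; apply: eq_bigr => i _.
    rewrite (eq_bigr (fun j => t%:C *: T i j (x j))) => [|j _]; last by rewrite linZ.
    by rewrite -scaler_sumr rnormZ rnorm_real gtr0_norm // exprMn.
  exact.
have [sz|sn] := eqVneq s 0.
  rewrite sz leNgt; apply/negP => r0; set r := \sum_i _ in ub r0.
  have q0 : 0 < 2 / r by rewrite divr_gt0.
  have := ub (Num.sqrt (2 / r)); rewrite sqrtr_gt0 q0 sz mulr0 ler01.
  rewrite (sqr_sqrtr (ltW q0)) mulfVK ?gt_eqF // => /(_ isT isT).
  by rewrite lern1.
have sp : 0 < s by rewrite lt_neqAle eq_sym sn.
have := ub (Num.sqrt s^-1); rewrite sqrtr_gt0 invr_gt0 sp sqr_sqrtr ?invr_ge0 //.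
rewrite mulVf // lexx => /(_ isT isT).
by rewrite mulrC ler_pdivrMr // mul1r.
Qed.

Lemma scalarmx_normZ (I : finType) (M : R) (a b : I -> I -> C) : 0 < M ->
  (forall i j, b i j = M%:C * a i j) -> (scalarmx_norm b <= M%:E * scalarmx_norm a)%E.
Proof.
move=> M0 hb; apply: ge_ereal_sup => _ [x hx ->].
have -> : \sum_i rnorm (\sum_j b i j * x j) ^+ 2 = M ^+ 2 * \sum_i rnorm (\sum_j a i j * x j) ^+ 2.
  rewrite mulr_sumr; apply: eq_bigr => i _.
  under eq_bigr do rewrite hb -mulrA.
  by rewrite -mulr_sumr rnormM rnorm_real gtr0_norm // exprMn.
rewrite sqrtrM ?sqr_ge0 // sqrtr_sqr gtr0_norm // EFinM lee_pmul2l ?lte_fin //.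
by apply: ereal_sup_ubound; exists x.
Qed.

End OpmxNorm.

(** * Complete boundedness *)

Section Conclusion.
Variables (R : realType) (G H : lcGroupType) (K : hilbertType R) (pi : unirep G K).
Hypotheses (hA : closed_invariant_subalgebra (A_ pi)) (hstar : star_semigroup (spectrum pi)).
Local Notation C := R[i].
Local Notation A := (A_ pi).

Variable j : (G -> C) -> (H -> C).
Variable c : R.
Hypothesis c0 : 0 <= c.

(** All that is retained of the piecewise affine map.  The representation [theta] is
    a variable because elements of the algebra are realized on Hilbert spaces
    other than that of [pi]. *)
Definition spatially_implemented : Prop :=
  forall (K' : hilbertType R) (theta : (K -> K) -> K' -> K'), spectrum_rep pi theta ->
  exists (L' : hilbertType R) (rho : unirep H L') (V V' : K' -> L'),
    [/\ linear V /\ bounded_by c V, linear V' /\ bounded_by c V' &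
        forall u xi eta, A u ->
          (forall T, spectrum pi T -> pairing pi T u = dot (theta T xi) eta) ->
          j u = coef rho (V xi) (V' eta)].

Hypothesis hj : spatially_implemented.

(** Each realization of [u] as a coefficient function yields one of [j u] on vectors
    that are at most [c] times longer. *)
Lemma implemented_BG u : A u -> BG (j u) /\ BG_norm (j u) <= c * c * BG_norm u.
Proof.
move=> Au.
have key (K' : hilbertType R) (rho' : unirep G K') xi eta : u = coef rho' xi eta ->
    BG (j u) /\ BG_norm (j u) <= c * c * (rnorm xi * rnorm eta).
  move=> uE; rewrite uE in Au *; have [eta' [n1 uE' Neta]] := realization_reduce hA Au.
  have [L' [rho [V [V' [[_ bV] [_ bV'] hV]]]]] := hj (theta_spectrum_rep hA hstar rho').
  have -> : j (coef rho' xi eta) = coef rho (V xi) (V' eta').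
    by apply: hV => // T sT; rewrite uE' (pairing_theta hA).
  split; first exact: BG_coef.
  apply: le_trans (BG_norm_coef _ _ _) _; rewrite mulrACA.
  apply: ler_pM; rewrite ?rnorm_ge0 //.
  by apply: le_trans (bV' _) _; rewrite ler_wpM2l.
have [K' [rho' [xi [eta uE]]]] := A_BG Au; split; first by have [] := key _ _ _ _ uE.
apply: le_BG_norm; [exact: A_BG Au | exact: mulr_ge0 |].
by move=> ? ? ? ? /key [].
Qed.

Section CompletelyBounded.
Variables (L : hilbertType R) (omega : unirep H L).
Hypothesis homega : universal_rep omega.
Hypothesis j_lin : forall a u v, A u -> A v ->
  j (fun s => a * u s + v s) = fun h => a * j u h + j v h.
Local Notation M := (c * c + 1).

Let M0 : 0 < M. Proof. by rewrite ltr_wpDl // mulr_ge0. Qed.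

(** The entries of [M T] are the images under the adjoint of [j] of those of [S]; as
    [V'^* Th V], they are controlled simultaneously.  The [1] in [M] makes it
    invertible. *)
Lemma implemented_adjoint m (S : 'I_m -> 'I_m -> L -> L) :
  (forall k l, VN omega (S k l)) -> (opmx_norm S <= 1)%E ->
  exists T : 'I_m -> 'I_m -> K -> K,
    [/\ forall k l, VN pi (T k l), (opmx_norm T <= 1)%E &
        forall k l u, A u -> pairing omega (S k l) (j u) = M%:C * pairing pi (T k l) u].
Proof.
move=> hS nS.
have lS k l : linear (S k l) by have [[]] := hS k l.
have [L' [rho [V [V' [[lV bV] [lV' bV'] hV]]]]] := hj (spectrum_rep_id hA hstar).
have jcoef xi eta : j (coef pi xi eta) = coef rho (V xi) (V' eta).
  by apply: hV => [|T sT]; [exact: A_coef | rewrite pairing_coef].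
have /choice [Th hTh] : forall kl : 'I_m * 'I_m,
    exists T : L' -> L', transfers omega rho (S kl.1 kl.2) T.
  by move=> kl; exact: transfer_exists.
have cTh : contractive_mx (fun k l => Th (k, l)).
  apply: (transfer_contractive homega (S := S)) => [k l|]; first exact: (hTh (k, l)).
  exact: opmx_norm_contractive.
have lTh k l : linear (Th (k, l)) by apply: (transfer_linear homega (lS k l)); exact: (hTh (k, l)).
have [Vs [lVs bVs hVs]] := adjoint_exists c0 lV' bV'.
pose T k l x := (M^-1)%:C *: Vs (Th (k, l) (V x)).
pose phi k l u := (M^-1)%:C * pairing omega (S k l) (j u).
have phicoef k l xi eta : phi k l (coef pi xi eta) = dot (T k l xi) eta.
  rewrite /phi /T dotZl jcoef; congr (_ * _).
  by rewrite (pairing_omega homega (hS k l) _ _ (hTh (k, l))) hVs.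
have hphi k l : represents pi (T k l) (phi k l).
  split=> //.
  - move=> a u v Au Av; rewrite /phi j_lin // (pairing_omega_lin homega) //.
    + by rewrite mulrDr mulrCA.
    + by have [] := implemented_BG Au.
    + by have [] := implemented_BG Av.
  - have [B hB] := pairing_omega_bounded homega (hS k l).
    exists (M^-1 * (`|B| * (c * c))) => u Au; have [BGj nj] := implemented_BG Au.
    rewrite /phi rnormM rnorm_real ger0_norm ?invr_ge0 ?(ltW M0) // -[leRHS]mulrA.
    apply: ler_wpM2l; first by rewrite invr_ge0 ltW.
    apply: le_trans (hB _ BGj) _; rewrite -[leRHS]mulrA.
    apply: (@le_trans _ _ (`|B| * BG_norm (j u))).
      by rewrite ler_wpM2r ?BG_norm_ge0 // ler_norm.
    by rewrite ler_wpM2l.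
have lT k l : linear (T k l).
  move=> a x y; rewrite /T lV lTh lVs scalerDr !scalerA.
  by rewrite [in LHS]mulrC.
have bT k l : bounded_op (T k l).
  have [[_ cS] _] := hS k l.
  have [d d0 bS] := linear_continuous_bounded (lS k l) cS.
  have bTh := transfer_bounded homega (hTh (k, l)) d0 bS.
  apply/bounded_opP; split=> //; exists (M^-1 * (c * (d * c))).
    by rewrite !mulr_ge0 // invr_ge0 (ltW M0).
  move=> x; rewrite /T rnormZ rnorm_real ger0_norm ?invr_ge0 ?(ltW M0) // -[leRHS]mulrA.
  apply: ler_wpM2l; first by rewrite invr_ge0 ltW.
  apply: le_trans (bVs _) _; rewrite -!mulrA; apply: ler_wpM2l => //.
  by apply: le_trans (bTh _) _; apply: ler_wpM2l.
exists T; split.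
- move=> k l; split=> // Q bQ cQ; apply/funext => x /=; apply: dot_ext => y.
  rewrite (adjP bQ) -!phicoef; congr (phi k l _); apply/funext => s.
  rewrite /coef -(adjP bQ); congr dot.
  exact: (congr1 (fun f => f x) (cQ s)).
- apply: opmx_norm_le1 => x.
  have h1 i : rnorm (\sum_j T i j (x j)) ^+ 2 <=
      (M^-1 * c) ^+ 2 * rnorm (\sum_j Th (i, j) (V (x j))) ^+ 2.
    rewrite /T -scaler_sumr -(lin_sum _ _ _ lVs) rnormZ rnorm_real.
    rewrite ger0_norm ?invr_ge0 ?(ltW M0) // -exprMn.
    rewrite ler_pXn2r ?nnegrE ?mulr_ge0 ?invr_ge0 ?rnorm_ge0 ?(ltW M0) //.
    by rewrite -[leRHS]mulrA; apply: ler_wpM2l; rewrite ?invr_ge0 ?(ltW M0).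
  apply: le_trans (ler_sum _ (fun i _ => h1 i)) _; rewrite -mulr_sumr.
  apply: (@le_trans _ _ ((M^-1 * c) ^+ 2 * (c ^+ 2 * \sum_j rnorm (x j) ^+ 2))).
    apply: ler_wpM2l; first exact: sqr_ge0.
    apply: le_trans (cTh (fun j => V (x j))) _.
    rewrite mulr_sumr; apply: ler_sum => i _; rewrite -exprMn.
    by rewrite ler_pXn2r ?nnegrE ?mulr_ge0 ?rnorm_ge0.
  rewrite mulrA ler_piMl //; first by apply: sumr_ge0 => i _; exact: sqr_ge0.
  rewrite -exprMn -mulrA expr_le1 // ?mulr_ge0 ?invr_ge0 ?(ltW M0) //.
  by rewrite mulrC ler_pdivrMr // mul1r lerDl.
- move=> k l u Au; rewrite (pairingE hA (hphi k l) Au) /phi mulrA -rmorphM mulfV ?gt_eqF //.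
  by rewrite mul1r.
Qed.

Lemma implemented_cb n (u : 'M[G -> C]_n) : (forall i k, A (u i k)) ->
  (predual_mxnorm omega (map_mx j u) <= M%:E * predual_mxnorm pi u)%E.
Proof.
move=> Au; apply: ge_ereal_sup => _ [m [S [hS nS ->]]].
have [T [hT nT ST]] := implemented_adjoint hS nS.
apply: le_trans (scalarmx_normZ M0 _) _; last first.
  rewrite lee_pmul2l ?lte_fin //; apply: ereal_sup_ubound.
  by exists m, T; split.
by move=> i k /=; rewrite mxE ST.
Qed.

End CompletelyBounded.
End Conclusion.

Theorem proposition2p13 (R : realType) (G H : lcGroupType)
    (K : hilbertType R) (pi : unirep G K)
    (L : hilbertType R) (omega : unirep H L)
    (homega : universal_rep omega)
    (hA : closed_invariant_subalgebra (A_ pi))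
    (hstar : star_semigroup (spectrum pi))
    (hnorm : forall x, spectrum pi x -> op_norm x = 1%E)
    (Y : set H) (hY : Omega Y)
    (alpha : H -> K -> K)
    (halpha : forall h, Y h -> spectrum pi (alpha h))
    (hcont : weakstar_continuous pi Y alpha)
    (hpw : pw2_affine pi Y alpha) :
  cb_homomorphism pi omega (j_ pi Y alpha).
Proof.
set j := j_ pi Y alpha.
have [I [E [b [p [x0 [eps [hE Ex0 eps1 jE]]]]]]] := decomposable_pw2 hA hstar hcont hpw.
have c0 : 0 <= #|I|%:R :> R by exact: ler0n.
have sb l h : E l h -> spectrum pi (b l h) by move=> /(ap_group (hE l)) [].
have hj : spatially_implemented pi j #|I|%:R.
  move=> K' theta htheta.
  have [rho [V [V' [hV hV' hVV]]]] := affine_matrix_coefficient (fun l => ap_closed (hE l))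
    (fun l => ap_open (hE l)) Ex0 (fun l => affine_unitary_piece hstar htheta (hE l)) eps1.
  exists (l2 (I * H)%type K'), rho, V, V'; split=> // u xi eta Au hu.
  apply/funext => h; rewrite /coef hVV -[LHS]/(restricted pi Y alpha h u) jE //.
  by apply: eq_bigr => l _; case: asboolP => // Eh; rewrite hu //; exact: sb.
have jlin a u v : A_ pi u -> A_ pi v -> j (fun s => a * u s + v s) = fun h => a * j u h + j v h.
  move=> Au Av; apply/funext => h; rewrite /j /j_; case: asboolP => [Yh|_].
    by rewrite (pairing_lin hA) //; exact: halpha.
  by rewrite mulr0 addr0.
split=> //.
- by move=> u Au; have [] := implemented_BG hA hstar c0 hj Au.
- move=> u v Au Av; apply/funext => h; rewrite /j /j_ /=; case: asboolP => [Yh|_].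
    by have [_ _ ->] := halpha _ Yh.
  by rewrite mulr0.
- exists (#|I|%:R * #|I|%:R + 1); split; first by rewrite addr_ge0 ?mulr_ge0 ?ler01.
  by move=> n u Au; exact: (implemented_cb hA hstar c0 hj homega jlin).
Qed.
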